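(* There is an algorithm that, given a set $D_i$ of $n_i$ unit disks in the plane each of which intersects a given horizontal line $L_i$, computes a subset $D'\subseteq D_i$ of maximum cardinality such that no two disks in $D'$ have a common intersection point (that is, it solves the problem MISUDG-L optimally), using $O(n_i^2)$ time and $O(n_i^2)$ space.
   Context: A unit disk is a closed disk of diameter $1$ in the plane; two unit disks intersect if and only if their centers are at Euclidean distance at most $1$. The problem MISUDG-L is: given a set $D_i$ of $n_i$ unit disks that are all intersected by a horizontal line $L_i$, find a subset $D'\subseteq D_i$ of maximum cardinality such that no two disks in $D'$ have a common intersection point. The input disks are given geometrically (by the coordinates of their centers). Time and space are measured in the standard unit-cost model of computational geometry (real RAM). *)

(* Defs.v *)
From Stdlib Require Export Reals List Arith Rgeom.
Export ListNotations.

(** * Unit disks *)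

(** A unit disk is represented by its center, so a finite set of unit disks is
    a duplicate-free list of points. *)
Definition point : Type := (R * R)%type.

Definition in_disk (c p : point) : Prop :=
  (dist_euc (fst p) (snd p) (fst c) (snd c) <= 1 / 2)%R.

Definition disks_meet (c1 c2 : point) : Prop :=
  exists p : point, in_disk c1 p /\ in_disk c2 p.

(** The disk centered at [c] meets the horizontal line of ordinate [h]. *)
Definition disk_meets_line (h : R) (c : point) : Prop :=
  exists x : R, in_disk c (x, h).

Definition independent (D : list point) : Prop :=
  forall c1 c2 : point,
    In c1 D -> In c2 D -> c1 <> c2 -> ~ disks_meet c1 c2.

Definition independent_subset (D E : list point) : Prop :=
  NoDup E /\ incl E D /\ independent E.

Definition maximum_independent_subset (D E : list point) : Prop :=
  independent_subset D E /\
  forall F : list point, independent_subset D F -> length F <= length E.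

(** * The unit-cost real RAM

    The machine has integer and real registers, an addressable memory of
    integer words and an addressable memory of exact real numbers.  Integers
    serve for addresses and indices; there is no conversion between reals and
    integers (in particular no floor function), and the operations on reals are
    the four field operations and comparison. *)

Inductive int_op : Type := IAdd | ISub | IMul.
Inductive real_op : Type := RAdd | RSub | RMul | RDiv.

(** Destinations come first, registers are named by their numbers, and [l] is
    the index of an instruction in the program. *)
Inductive instr : Type :=
  | Halt
  | Jump (l : nat)
  | IJumpLe (a b l : nat)          (* if i_a <= i_b then goto l *)
  | RJumpLe (a b l : nat)          (* if r_a <= r_b then goto l *)
  | IConst (d k : nat)             (* i_d := k *)
  | IMove (d a : nat)              (* i_d := i_a *)
  | IOp (o : int_op) (d a b : nat) (* i_d := i_a o i_b *)
  | ILoad (d a : nat)              (* i_d := IMEM[i_a] *)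
  | IStore (a s : nat)             (* IMEM[i_a] := i_s *)
  | RConst (d : nat) (k : Z)       (* r_d := k *)
  | RMove (d a : nat)              (* r_d := r_a *)
  | ROp (o : real_op) (d a b : nat)(* r_d := r_a o r_b *)
  | RLoad (d a : nat)              (* r_d := RMEM[i_a] *)
  | RStore (a s : nat).            (* RMEM[i_a] := r_s *)

Definition program : Type := list instr.

Record state : Type := State {
  pc : nat;
  ireg : nat -> nat;
  rreg : nat -> R;
  imem : nat -> nat;
  rmem : nat -> R
}.

Definition update {A : Type} (f : nat -> A) (k : nat) (v : A) : nat -> A :=
  fun j => if Nat.eqb j k then v else f j.

(** Subtraction of integers is truncated at [0]. *)
Definition int_eval (o : int_op) (x y : nat) : nat :=
  match o with
  | IAdd => x + y
  | ISub => x - y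
  | IMul => x * y
  end.

(** Division by zero is an error. *)
Definition real_eval (o : real_op) (x y : R) : option R :=
  match o with
  | RAdd => Some (x + y)%R
  | RSub => Some (x - y)%R
  | RMul => Some (x * y)%R
  | RDiv => if Req_dec_T y 0%R then None else Some (x / y)%R
  end.

Definition goto (l : nat) (s : state) : state :=
  State l (ireg s) (rreg s) (imem s) (rmem s).

Definition set_ireg (d v : nat) (s : state) : state :=
  State (S (pc s)) (update (ireg s) d v) (rreg s) (imem s) (rmem s).

Definition set_rreg (d : nat) (v : R) (s : state) : state :=
  State (S (pc s)) (ireg s) (update (rreg s) d v) (imem s) (rmem s).

Definition set_imem (k v : nat) (s : state) : state :=
  State (S (pc s)) (ireg s) (rreg s) (update (imem s) k v) (rmem s).

Definition set_rmem (k : nat) (v : R) (s : state) : state :=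
  State (S (pc s)) (ireg s) (rreg s) (imem s) (update (rmem s) k v).

(** One instruction on a machine with [m] cells in each of its two memories.
    The result [None] means that the machine has stopped, either on [Halt] or
    on an error: leaving the program, addressing a cell outside the memory,
    dividing by zero, or producing an integer greater than [m].  The last
    restriction makes an integer word just large enough for an address
    (logarithmically many bits), so that unit-cost integer arithmetic gives no
    spurious power. *)
Definition step (m : nat) (P : program) (s : state) : option state :=
  let put_int d v := if v <=? m then Some (set_ireg d v s) else None in
  match nth_error P (pc s) with
  | None | Some Halt => None
  | Some (Jump l) => Some (goto l s)
  | Some (IJumpLe a b l) =>
      Some (goto (if ireg s a <=? ireg s b then l else S (pc s)) s)
  | Some (RJumpLe a b l) =>
      Some (goto (if Rle_dec (rreg s a) (rreg s b) then l else S (pc s)) s)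
  | Some (IConst d k) => put_int d k
  | Some (IMove d a) => put_int d (ireg s a)
  | Some (IOp o d a b) => put_int d (int_eval o (ireg s a) (ireg s b))
  | Some (ILoad d a) =>
      if ireg s a <? m then put_int d (imem s (ireg s a)) else None
  | Some (IStore a b) =>
      if ireg s a <? m then Some (set_imem (ireg s a) (ireg s b) s) else None
  | Some (RConst d k) => Some (set_rreg d (IZR k) s)
  | Some (RMove d a) => Some (set_rreg d (rreg s a) s)
  | Some (ROp o d a b) =>
      match real_eval o (rreg s a) (rreg s b) with
      | Some v => Some (set_rreg d v s)
      | None => None
      end
  | Some (RLoad d a) =>
      if ireg s a <? m then Some (set_rreg d (rmem s (ireg s a)) s) else None
  | Some (RStore a b) =>
      if ireg s a <? m then Some (set_rmem (ireg s a) (rreg s b) s) else None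
  end.

Fixpoint run (m : nat) (P : program) (t : nat) (s : state) : option state :=
  match t with
  | 0 => Some s
  | S t' => match step m P s with
            | Some s' => run m P t' s'
            | None => None
            end
  end.

(** Started in [s], the program [P] reaches a [Halt] instruction in state [s']
    after executing at most [T] instructions, with [m] cells in each memory.
    Registers need not be counted as space: a program only names a fixed finite
    number of them. *)
Definition halts_within (m T : nat) (P : program) (s s' : state) : Prop :=
  exists t : nat,
    t <= T /\ run m P t s = Some s' /\ nth_error P (pc s') = Some Halt.

(** * Input and output *)

(** Coordinates of the centers, two consecutive cells per disk; the remaining
    cells are zero. *)
Fixpoint coordinates (D : list point) : list R :=
  match D with
  | [] => []
  | c :: D' => fst c :: snd c :: coordinates D'
  end.

(** The number of disks is in the integer register 0, the ordinate of the line
    in the real register 0, and the centers are in the real memory. *)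
Definition input_state (h : R) (D : list point) : state :=
  State 0
    (update (fun _ => 0) 0 (length D))
    (update (fun _ => 0%R) 0 h)
    (fun _ => 0)
    (fun k => nth k (coordinates D) 0%R).

(** The answer is the list of input disks whose indices (counted from 0) are in
    the first cells of the integer memory; their number is in the integer
    register 0.  All these indices have to be valid. *)
Definition outputs (D : list point) (s : state) (E : list point) : Prop :=
  map (fun j => nth_error D (imem s j)) (seq 0 (ireg s 0)) = map Some E.

(** [P] solves, on every instance of [n] disks, the problem in at most [T n]
    steps with [m n] memory cells (of each kind). *)
Definition solves_MISUDG_L (P : program) (T m : nat -> nat) : Prop :=
  forall (h : R) (D : list point),
    NoDup D ->
    (forall c : point, In c D -> disk_meets_line h c) ->
    exists (s : state) (E : list point),
      halts_within (m (length D)) (T (length D)) P (input_state h D) s /\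
      outputs D s E /\
      maximum_independent_subset D E.

(* Main.v *)
(** Sort the centers by abscissa and call a chain an independent set listed in
    this order.  The geometric key: if [a <= i <= j <= k] lie in a strip of
    height 1, [a], [i], [j] are pairwise at distance more than 1 and so are [j]
    and [k], then [a] and [k] are at distance more than 1, whether or not [i]
    and [k] are.  So a chain may be extended as soon as its last two points
    allow it; and if only [j] allows it, deleting [i] makes room for [k].  Let
    [f j k] be the largest size of a chain ending with [j], [k] and [F j] that
    of a chain ending with [j].  Then [f j k] is [F j + 1] if [F j = 1] or if
    some [i] with [f i j = F j] is at distance more than 1 from [k], and it is
    [F j] otherwise.

    For fixed [j], all these existence questions are answered in linear time.
    The right halves of the unit circles around the points [i] cross pairwise at
    most once, so the region within distance 1 of all of them is bounded by a
    lower envelope.  It is built by a stack scan over the points [i] sorted by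
    ordinate, and the points [k], sorted by ordinate too, are located by a
    pointer moving along it.  The scan never needs a square root: it compares
    arcs at the lowest and highest ordinates, and decides whether the middle one
    of three arcs is useless from the sign of a polynomial expression. *)
Require Import Defs.
From Stdlib Require Import Lra Lia Psatz Ranalysis5.

(** * Unit circles around points of a strip *)

Local Open Scope R_scope.

(** Two obstacles shape the development. The half circles have to be comparable over a common range
    of ordinates; concavity then makes the horizontal gap between two of them a monotone function of
    the ordinate. The range is the band between the lowest and the highest center: its height is at
    most 1, so every arc is defined over all of it. The other obstacle is that the bounds are
    claimed for a concrete machine with short integer words. The algorithm is therefore written in a
    small structured language that is compiled to machine code, and it is verified with Hoare
    triples carrying a time bound: loop-free code costs at most its length, and the rounds of a loop
    are counted by a decreasing measure. The two scans are linear because their measures combine the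
    height of the stack with the number of points still to be read. The table stores lengths only;
    an optimal chain is recovered from it by one linear search per disk. *)

Definition far (a b : point) : Prop :=
  1 < (fst a - fst b) ^ 2 + (snd a - snd b) ^ 2.

(** By contradiction. Once the horizontal gaps sum to at most 1, the ordinates have little freedom:
    [q] lies below [p], by at most [u], and not above [r], while the ordinate of [s] is at most [w].
    Then the angle at [q] between [p] and [s] is at least a right one, so [ps] is at least as long
    as [pq]. *)
Lemma no_turn_back_oriented (px py qx qy rx ry sx sy : R) :
  0 <= py <= 1 -> 0 <= qy <= 1 -> 0 <= ry <= 1 -> 0 <= sy <= 1 ->
  px <= qx -> qx <= rx -> rx <= sx -> sy <= ry ->
  1 < (px - qx) ^ 2 + (py - qy) ^ 2 -> 1 < (px - rx) ^ 2 + (py - ry) ^ 2 ->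
  1 < (qx - rx) ^ 2 + (qy - ry) ^ 2 -> 1 < (rx - sx) ^ 2 + (ry - sy) ^ 2 ->
  1 < (px - sx) ^ 2 + (py - sy) ^ 2.
Proof.
intros Hp Hq Hr Hs pq' qr' rs' sr pq pr qr rs.
destruct (Rlt_le_dec 1 ((px - sx) ^ 2 + (py - sy) ^ 2)) as [H | near]; [exact H | exfalso].
remember (qx - px) as u eqn:Eu; remember (rx - qx) as v eqn:Ev;
  remember (sx - rx) as w eqn:Ew.
replace (px - qx) with (- u) in pq by lra.
replace (px - rx) with (- (u + v)) in pr by lra.
replace (qx - rx) with (- v) in qr by lra.
replace (rx - sx) with (- w) in rs by lra.
replace (px - sx) with (- (u + v + w)) in near by lra.
assert (Hu : 0 <= u) by lra. assert (Hv : 0 <= v) by lra. assert (Hw : 0 <= w) by lra.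
clear Eu Ev Ew pq' qr' rs' px qx rx sx.
assert (sq_le : forall a b, 0 <= a <= b -> a ^ 2 <= b ^ 2) by (intros; nra).
assert (sq_lt : forall a b, 0 <= b -> b ^ 2 < a ^ 2 -> 0 <= a -> b < a).
{ intros a b Hb Hab Ha. destruct (Rlt_le_dec b a) as [K | K]; [exact K |].
  pose proof (sq_le a b ltac:(lra)). lra. }
assert (sq_id : forall a, 0 <= a <= 1 -> a ^ 2 <= a).
{ intros a Ha. assert (0 <= a * (1 - a)) by (apply Rmult_le_pos; lra). lra. }
assert (uvw : u + v + w <= 1).
{ destruct (Rle_lt_dec (u + v + w) 1) as [H | H]; [exact H | exfalso].
  pose proof (pow2_ge_0 (py - sy)). assert (0 < (u + v + w - 1) * (u + v + w + 1)) by (apply Rmult_lt_0_compat; lra). lra. }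
replace ((- u) ^ 2) with (u ^ 2) in pq by ring.
replace ((- v) ^ 2) with (v ^ 2) in qr by ring.
replace ((- w) ^ 2) with (w ^ 2) in rs by ring.
replace ((- (u + v)) ^ 2) with ((u + v) ^ 2) in pr by ring.
replace ((- (u + v + w)) ^ 2) with ((u + v + w) ^ 2) in near by ring.
assert (u2 := sq_id u ltac:(lra)). assert (v2 := sq_id v ltac:(lra)).
assert (w2 := sq_id w ltac:(lra)). assert (uv2 := sq_id (u + v) ltac:(lra)).
set (H := ry - sy) in *.
assert (HH : 0 <= H * (1 - H)) by (apply Rmult_le_pos; unfold H; lra).
(* With [r] below [q], the squared lengths of [qr] and [rs] would sum to at most
   [v ^ 2 + w ^ 2 + (1 - H) ^ 2 + H ^ 2], which is at most 2. *)
destruct (Rlt_le_dec ry qy) as [rq | qr''].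
{ assert ((qy - ry) ^ 2 <= (1 - H) ^ 2) by (apply sq_le; unfold H; lra).
  replace ((qy - ry) ^ 2) with ((qy - ry) ^ 2) in * by ring.
  replace ((1 - H) ^ 2) with (1 - 2 * H + H ^ 2) in * by ring.
  replace (H * (1 - H)) with (H - H ^ 2) in HH by ring. lra. }
(* If the heights increased from [p] to [r], both the horizontal and the vertical gaps of [pq] and
   [qr] would sum to at most 1, and so would their squares. *)
destruct (Rle_lt_dec py qy) as [pq'' | qp''].
{ assert (E : (py - qy) ^ 2 + (qy - ry) ^ 2 = (ry - py) ^ 2 - 2 * ((qy - py) * (ry - qy))) by ring.
  assert (0 <= (qy - py) * (ry - qy)) by (apply Rmult_le_pos; lra).
  pose proof (sq_id (ry - py) ltac:(lra)). lra. }
(* A descent from [p] to [q] larger than [u] is the longer leg of a right triangle with hypotenuse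
   above 1, hence exceeds 7/10. If [r] is not below [p], this makes [w] and [H] too small for [rs];
   if it is, the squared lengths of [pr] and [rs] sum to at most 2 as above. *)
assert (uB : py - qy <= u).
{ destruct (Rle_lt_dec (py - qy) u) as [K | small]; [exact K | exfalso].
  assert (B2 := sq_le u (py - qy) ltac:(lra)).
  assert (B7 : 7 / 10 < py - qy) by (apply sq_lt; lra).
  destruct (Rle_lt_dec py ry) as [pr'' | rp''].
  - pose proof (sq_le (ry - py) (3 / 10) ltac:(lra)).
    replace ((py - ry) ^ 2) with ((ry - py) ^ 2) in pr by ring.
    assert (91 / 100 < u + v) by lra.
    assert (w < 1 / 10) by lra.
    assert ((9 / 10) ^ 2 <= (u + v + w) ^ 2) by (apply sq_le; lra).
    assert (py - sy < 1 / 2).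
    { destruct (Rlt_le_dec (py - sy) (1 / 2)) as [K | K]; [exact K|].
      pose proof (sq_le (1 / 2) (py - sy) ltac:(lra)). lra. }
    pose proof (sq_le w (1 / 10) ltac:(lra)).
    assert (ry - sy <= 9 / 10) by lra.
    pose proof (sq_le H (9 / 10) ltac:(unfold H; lra)). lra.
  - assert ((py - ry) ^ 2 <= (1 - H) ^ 2) by (apply sq_le; unfold H; lra).
    replace ((1 - H) ^ 2) with (1 - 2 * H + H ^ 2) in * by ring.
    replace (H * (1 - H)) with (H - H ^ 2) in HH by ring. lra. }
assert (ws : sy <= w).
{ pose proof (sq_le H (1 - sy) ltac:(unfold H; lra)). pose proof (sq_id sy Hs). nra. }
(* The law of cosines at [q]: the last summand is minus twice the inner product of [p - q] and
   [s - q]. *)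
assert (E : (u + v + w) ^ 2 + (py - sy) ^ 2
  = u ^ 2 + (py - qy) ^ 2 + (v + w) ^ 2 + (sy - qy) ^ 2
    + 2 * (u * (v + w) - (py - qy) * (sy - qy))) by ring.
pose proof (pow2_ge_0 (v + w)). pose proof (pow2_ge_0 (sy - qy)).
destruct (Rle_lt_dec sy qy) as [sq | qs].
- assert (0 <= (py - qy) * (qy - sy)) by (apply Rmult_le_pos; lra).
  assert (0 <= u * (v + w)) by (apply Rmult_le_pos; lra).
  replace ((py - qy) * (sy - qy)) with (- ((py - qy) * (qy - sy))) in E by ring. lra.
- assert ((py - qy) * (sy - qy) <= u * (v + w)) by (apply Rmult_le_compat; lra).
  lra.
Qed.

Lemma no_turn_back (h : R) (p q r s : point) :
  (forall c, In c [p; q; r; s] -> h - 1 / 2 <= snd c <= h + 1 / 2) ->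
  fst p <= fst q -> fst q <= fst r -> fst r <= fst s ->
  far p q -> far p r -> far q r -> far r s -> far p s.
Proof.
intros bnd pq' qr' rs' pq pr qr rs.
assert (Bp := bnd p ltac:(simpl; auto)); assert (Bq := bnd q ltac:(simpl; auto));
  assert (Br := bnd r ltac:(simpl; auto)); assert (Bs := bnd s ltac:(simpl; auto 6)).
unfold far in *.
(* Ordinates are measured from one border of the strip; choosing the upper border reflects the
   picture when [s] is above [r]. *)
destruct (Rle_lt_dec (snd s) (snd r)) as [sr | rs''].
- pose proof (no_turn_back_oriented (fst p) (snd p - (h - 1/2)) (fst q) (snd q - (h - 1/2))
    (fst r) (snd r - (h - 1/2)) (fst s) (snd s - (h - 1/2))) as K.
  replace (snd p - (h - 1/2) - (snd q - (h - 1/2))) with (snd p - snd q) in K by ring.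
  replace (snd p - (h - 1/2) - (snd r - (h - 1/2))) with (snd p - snd r) in K by ring.
  replace (snd q - (h - 1/2) - (snd r - (h - 1/2))) with (snd q - snd r) in K by ring.
  replace (snd r - (h - 1/2) - (snd s - (h - 1/2))) with (snd r - snd s) in K by ring.
  replace (snd p - (h - 1/2) - (snd s - (h - 1/2))) with (snd p - snd s) in K by ring.
  apply K; lra.
- pose proof (no_turn_back_oriented (fst p) (h + 1/2 - snd p) (fst q) (h + 1/2 - snd q)
    (fst r) (h + 1/2 - snd r) (fst s) (h + 1/2 - snd s)) as K.
  replace (h + 1/2 - snd p - (h + 1/2 - snd q)) with (- (snd p - snd q)) in K by ring.
  replace (h + 1/2 - snd p - (h + 1/2 - snd r)) with (- (snd p - snd r)) in K by ring.
  replace (h + 1/2 - snd q - (h + 1/2 - snd r)) with (- (snd q - snd r)) in K by ring.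
  replace (h + 1/2 - snd r - (h + 1/2 - snd s)) with (- (snd r - snd s)) in K by ring.
  replace (h + 1/2 - snd p - (h + 1/2 - snd s)) with (- (snd p - snd s)) in K by ring.
  assert (E : forall z, (- z) ^ 2 = z ^ 2) by (intros; ring).
  rewrite !E in K. apply K; lra.
Qed.

(** * Right half circles as functions of the ordinate *)

Definition arc (c : point) (y : R) : R := fst c + sqrt (1 - (y - snd c) ^ 2).

Lemma half_circle_sq (u : R) :
  -1 <= u <= 1 -> 0 <= sqrt (1 - u ^ 2) /\ sqrt (1 - u ^ 2) ^ 2 = 1 - u ^ 2.
Proof.
intros Hu. split; [apply sqrt_pos|].
rewrite <- Rsqr_pow2. apply Rsqr_sqrt. nra.
Qed.

(** After squaring, this is the Cauchy-Schwarz inequality for the unit vectors [(x, X)] and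
    [(z, Z)]. *)
Lemma half_circle_concave (x z l : R) :
  -1 <= x <= 1 -> -1 <= z <= 1 -> 0 <= l <= 1 ->
  l * sqrt (1 - x ^ 2) + (1 - l) * sqrt (1 - z ^ 2)
    <= sqrt (1 - (l * x + (1 - l) * z) ^ 2).
Proof.
intros Hx Hz Hl.
destruct (half_circle_sq x Hx) as [X0 X2]. destruct (half_circle_sq z Hz) as [Z0 Z2].
set (X := sqrt (1 - x ^ 2)) in *. set (Z := sqrt (1 - z ^ 2)) in *.
rewrite <- (sqrt_pow2 (l * X + (1 - l) * Z)) by nra.
apply sqrt_le_1_alt.
assert (C : x * z + X * Z <= 1) by (pose proof (pow2_ge_0 (x - z)); pose proof (pow2_ge_0 (X - Z)); lra).
assert (0 <= l * (1 - l) * (1 - (x * z + X * Z))).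
{ apply Rmult_le_pos; [apply Rmult_le_pos |]; lra. }
assert (E : (l * X + (1 - l) * Z) ^ 2 + (l * x + (1 - l) * z) ^ 2
  = l ^ 2 * (X ^ 2 + x ^ 2) + (1 - l) ^ 2 * (Z ^ 2 + z ^ 2)
    + 2 * (l * (1 - l) * (x * z + X * Z))) by ring.
rewrite X2, Z2 in E. lra.
Qed.

(** Relative to the centers, the four ordinates involved are two extreme ones, [y - snd q] and
    [y' - snd p], and two between them with the same sum. Concavity with weights [l] and [1 - l] at
    the two inner ones, added up, gives the claim. *)
Lemma arc_gap_increasing (p q : point) (y y' : R) :
  snd p <= snd q -> y <= y' -> y' - snd p <= 1 -> -1 <= y - snd q ->
  arc q y - arc p y <= arc q y' - arc p y'.
Proof.
intros pq yy' Hp Hq. unfold arc.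
destruct (Rle_lt_dec (y' - snd p) (y - snd q)) as [da | ad].
{ replace (y' - snd q) with (y - snd q) by lra.
  replace (y' - snd p) with (y - snd p) by lra. lra. }
set (a := y - snd q) in *. set (d := y' - snd p) in *.
set (l := (snd q - snd p) / (d - a)).
assert (El : l * (d - a) = snd q - snd p) by (unfold l; field; lra).
assert (Ed : d - a = y' - y + (snd q - snd p)) by (unfold a, d; ring).
clearbody l.
assert (Hl : 0 <= l <= 1).
{ split; apply (Rmult_le_reg_r (d - a)); lra. }
pose proof (half_circle_concave d a l ltac:(lra) ltac:(lra) Hl) as K1.
pose proof (half_circle_concave d a (1 - l) ltac:(lra) ltac:(lra) ltac:(lra)) as K2.
replace (l * d + (1 - l) * a) with (y - snd p) in K1
  by (replace (l * d + (1 - l) * a) with (l * (d - a) + a) by ring; unfold a, d in *; lra).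
replace ((1 - l) * d + (1 - (1 - l)) * a) with (y' - snd q) in K2
  by (replace ((1 - l) * d + (1 - (1 - l)) * a) with (d - l * (d - a)) by ring;
      unfold a, d in *; lra).
lra.
Qed.

Lemma far_arc (i k : point) :
  fst i <= fst k -> -1 <= snd k - snd i <= 1 ->
  (far i k <-> arc i (snd k) < fst k).
Proof.
intros ik Hy. unfold far, arc.
destruct (half_circle_sq _ Hy) as [S0 S2].
set (S := sqrt (1 - (snd k - snd i) ^ 2)) in *.
split; intros H.
- apply Rnot_le_lt. intros C.
  assert ((fst k - fst i) ^ 2 <= S ^ 2) by (apply pow_incr; lra). lra.
- assert (S ^ 2 < (fst k - fst i) ^ 2).
  { assert (0 < (fst k - fst i - S) * (fst k - fst i + S)) by (apply Rmult_lt_0_compat; lra). lra. }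
  lra.
Qed.

Lemma arcs_cross (p s : point) (lo hi : R) :
  lo <= hi -> arc s lo < arc p lo -> arc p hi < arc s hi ->
  (forall y, lo <= y <= hi -> -1 <= y - snd p <= 1 /\ -1 <= y - snd s <= 1) ->
  exists y, lo <= y <= hi /\ arc p y = arc s y.
Proof.
intros lh Hlo Hhi Hin.
assert (cont : forall c y, -1 <= y - snd c <= 1 -> continuity_pt (arc c) y).
{ intros c y Hy. unfold arc.
  apply continuity_pt_plus; [apply continuity_pt_const; red; reflexivity |].
  apply (continuity_pt_comp (fun y => 1 - (y - snd c) ^ 2) sqrt).
  - apply derivable_continuous_pt. reg.
  - apply continuity_pt_sqrt. nra. }
destruct (Req_dec lo hi) as [E | E]; [subst; lra |].
destruct (IVT_interv (fun y => arc s y - arc p y) lo hi) as [z [Hz Ez]].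
- intros y Hy. apply continuity_pt_minus; apply cont; apply Hin; exact Hy.
- lra.
- cbv beta; lra.
- cbv beta; lra.
- exists z. split; [exact Hz | lra].
Qed.

(** * Comparing roots through signs of polynomials *)

Lemma sq_le_iff (a b : R) : 0 <= a -> 0 <= b -> (a <= b <-> a ^ 2 <= b ^ 2).
Proof. intros Ha Hb. split; intros H; [apply pow_incr; lra | nra]. Qed.

(** The first squaring leaves one root, which is isolated; the sign of the other side decides
    whether a second squaring is faithful. In the companion for [c < 0], the number [c] changes
    sides first so that both sides are nonnegative. *)
Lemma add_sqrt_le_nonneg (c A B : R) :
  0 <= c -> 0 <= A -> 0 <= B ->
  (c + sqrt A <= sqrt B <->
   0 <= B - A - c ^ 2 /\ 4 * c ^ 2 * A <= (B - A - c ^ 2) ^ 2).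
Proof.
intros Hc HA HB.
pose proof (sqrt_pos A). pose proof (sqrt_pos B).
assert (A2 := pow2_sqrt A HA). assert (B2 := pow2_sqrt B HB).
rewrite sq_le_iff by lra.
assert (0 <= c * sqrt A) by (apply Rmult_le_pos; lra).
replace (4 * c ^ 2 * A) with ((2 * (c * sqrt A)) ^ 2) by (rewrite <- A2 at 2; ring).
split.
- intros K. assert (2 * (c * sqrt A) <= B - A - c ^ 2) by lra.
  split; [lra | apply pow_incr; lra].
- intros [K1 K2]. apply sq_le_iff in K2; lra.
Qed.

Lemma add_sqrt_le_neg (c A B : R) :
  c < 0 -> 0 <= A -> 0 <= B ->
  (c + sqrt A <= sqrt B <->
   A - B - c ^ 2 <= 0 \/ (A - B - c ^ 2) ^ 2 <= 4 * c ^ 2 * B).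
Proof.
intros Hc HA HB.
pose proof (sqrt_pos A). pose proof (sqrt_pos B).
assert (A2 := pow2_sqrt A HA). assert (B2 := pow2_sqrt B HB).
assert (E : c + sqrt A <= sqrt B <-> sqrt A <= sqrt B - c) by lra.
rewrite E, sq_le_iff by lra.
assert (0 <= (- c) * sqrt B) by (apply Rmult_le_pos; lra).
replace (4 * c ^ 2 * B) with ((2 * ((- c) * sqrt B)) ^ 2) by (rewrite <- B2 at 2; ring).
split.
- intros K. destruct (Rle_lt_dec (A - B - c ^ 2) 0) as [|P]; [left; assumption | right].
  apply pow_incr. lra.
- intros [K | K]; [lra |].
  destruct (Rle_lt_dec (A - B - c ^ 2) 0) as [|P]; [lra |].
  apply sq_le_iff in K; lra.
Qed.

(** [W] is the root of [(4 - D) / D]. Sorting out the signs of [U] and [V] allows squaring, and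
    multiplying by [D] removes [W]. *)
Lemma le_mul_root_iff (U V W D : R) :
  0 < D -> 0 <= W -> W ^ 2 * D = 4 - D ->
  (U <= W * V <->
   (U <= 0 /\ 0 <= V) \/
   (U <= 0 /\ V < 0 /\ (4 - D) * V ^ 2 <= D * U ^ 2) \/
   (0 < U /\ 0 < V /\ D * U ^ 2 <= (4 - D) * V ^ 2)).
Proof.
intros HD HW EW.
assert (E : (4 - D) * V ^ 2 = D * (W * V) ^ 2) by (rewrite <- EW; ring).
rewrite E.
assert (C : forall a b, D * a <= D * b <-> a <= b).
{ intros a b. split; intros H; [apply (Rmult_le_reg_l D); lra |
  apply Rmult_le_compat_l; lra]. }
rewrite !C.
destruct (Rle_lt_dec U 0) as [U0 | U0]; destruct (Rle_lt_dec 0 V) as [V0 | V0].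
- assert (0 <= W * V) by (apply Rmult_le_pos; lra). split; intros; [left|]; lra.
- assert (0 <= W * - V) by (apply Rmult_le_pos; lra).
  replace ((W * V) ^ 2) with ((W * - V) ^ 2) by ring.
  replace (U ^ 2) with ((- U) ^ 2) by ring.
  rewrite <- (sq_le_iff (W * - V)) by lra. lra.
- assert (0 <= W * V) by (apply Rmult_le_pos; lra).
  rewrite <- (sq_le_iff U) by lra.
  destruct (Req_dec V 0) as [-> |]; lra.
- assert (0 <= W * - V) by (apply Rmult_le_pos; lra). lra.
Qed.

(** A horizontal line cuts the disk around [q] in a segment that ends on its two half circles; a
    point that is not to the left of the segment is in the disk as soon as it is not to the
    right. *)
Lemma right_arc_le (q : point) (x y : R) :
  -1 <= y - snd q <= 1 -> fst q - sqrt (1 - (y - snd q) ^ 2) <= x ->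
  (x <= arc q y <-> (x - fst q) ^ 2 + (y - snd q) ^ 2 <= 1).
Proof.
intros Hy Hx. unfold arc.
destruct (half_circle_sq _ Hy) as [S0 S2].
set (S := sqrt (1 - (y - snd q) ^ 2)) in *.
split; intros H.
- assert (0 <= (S - (x - fst q)) * (S + (x - fst q))) by (apply Rmult_le_pos; lra). lra.
- apply Rnot_lt_le. intros C.
  assert (0 < ((x - fst q) - S) * ((x - fst q) + S)) by (apply Rmult_lt_0_compat; lra). lra.
Qed.

(** Otherwise the disk around [q] would lie to the right of a point of the
    disk around [p], against one of the two order relations at the borders. *)
Lemma crossing_not_left (p q s : point) (lo hi y : R) :
  hi - lo <= 1 -> lo <= y <= hi ->
  lo <= snd p -> snd p <= snd q -> snd q <= snd s -> snd s <= hi ->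
  arc q lo < arc p lo -> arc q hi < arc s hi -> arc p y = arc s y ->
  fst q - sqrt (1 - (y - snd q) ^ 2) <= arc p y.
Proof.
intros band Hy Lp pq qs Ls Hlo Hhi cross.
apply Rnot_lt_le. intros C.
assert (mono : forall u v, -1 <= u <= 1 -> v ^ 2 <= u ^ 2 ->
  sqrt (1 - u ^ 2) <= sqrt (1 - v ^ 2)) by (intros; apply sqrt_le_1_alt; lra).
assert (sum : forall u v, 0 <= u -> 0 <= v -> u + v <= 1 ->
  1 <= sqrt (1 - u ^ 2) + sqrt (1 - v ^ 2)).
{ intros u v Hu Hv Huv.
  destruct (half_circle_sq u ltac:(lra)) as [U0 U2].
  destruct (half_circle_sq v ltac:(lra)) as [V0 V2].
  assert (sqrt (1 - u ^ 2) <= 1) by (rewrite <- sqrt_1 at 2; apply sqrt_le_1_alt; nra).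
  assert (sqrt (1 - v ^ 2) <= 1) by (rewrite <- sqrt_1 at 2; apply sqrt_le_1_alt; nra).
  nra. }
assert (top : forall u, sqrt (1 - u ^ 2) <= 1).
{ intros u. rewrite <- sqrt_1 at 2. apply sqrt_le_1_alt. pose proof (pow2_ge_0 u). lra. }
assert (even : forall u v, (u - v) ^ 2 = (v - u) ^ 2) by (intros; ring).
(* Two disks whose centers enclose the ordinate [y] have half widths there that sum to at least 1.
   Were the disk of [q] entirely to the right, [q] would be more than 1 to the right of the other
   center, against the comparison at the border, where roots are at most 1. *)
assert (between : forall a b, a <= y <= b -> b - a <= 1 ->
  1 <= sqrt (1 - (y - a) ^ 2) + sqrt (1 - (y - b) ^ 2)).
{ intros a b Hab Hd. rewrite (even y b). apply sum; lra. }
pose proof (sqrt_pos (1 - (lo - snd q) ^ 2)). pose proof (sqrt_pos (1 - (hi - snd q) ^ 2)).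
pose proof (sqrt_pos (1 - (y - snd q) ^ 2)).
pose proof (top (lo - snd p)). pose proof (top (hi - snd s)).
unfold arc in *.
destruct (Rle_lt_dec y (snd p)) as [Cp | Cp].
- assert (sqrt (1 - (lo - snd p) ^ 2) <= sqrt (1 - (y - snd p) ^ 2)) by (apply mono; nra). lra.
- destruct (Rle_lt_dec y (snd q)) as [Cq | Cq].
  + pose proof (between (snd p) (snd q) ltac:(lra) ltac:(lra)). lra.
  + destruct (Rle_lt_dec y (snd s)) as [Cs | Cs].
    * pose proof (between (snd q) (snd s) ltac:(lra) ltac:(lra)). lra.
    * assert (sqrt (1 - (hi - snd s) ^ 2) <= sqrt (1 - (y - snd s) ^ 2)) by (apply mono; nra).
      lra.
Qed.

(** The crossing point of the arcs of [p] and [s] lies on the perpendicular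
    bisector of [ps] at distance [W / 2 * |ps|] to the right of the midpoint. *)
Lemma crossing_below_arc (p q s : point) (lo hi : R) :
  hi - lo <= 1 ->
  lo <= snd p -> snd p <= snd q -> snd q <= snd s -> snd s <= hi ->
  arc s lo < arc q lo -> arc q lo < arc p lo ->
  arc p hi < arc q hi -> arc q hi < arc s hi ->
  let dx := fst s - fst p in
  let dy := snd s - snd p in
  let D := dx ^ 2 + dy ^ 2 in
  exists y W : R,
    lo <= y <= hi /\ arc p y = arc s y /\ 0 < D /\ 0 <= W /\ W ^ 2 * D = 4 - D /\
    (arc p y <= arc q y <->
     (fst q - fst p) * (fst q - fst s) + (snd q - snd p) * (snd q - snd s)
       <= W * ((fst q - fst p) * dy - (snd q - snd p) * dx)).
Proof.
intros band Lp pq qs Ls sq_lo qp_lo pq_hi qs_hi dx dy D.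
destruct (arcs_cross p s lo hi) as [y [Hy Ey]]; [lra.. | intros; lra |].
pose proof (crossing_not_left p q s lo hi y band Hy Lp pq qs Ls qp_lo qs_hi Ey) as left.
assert (HD : 0 < D).
{ destruct (Req_dec dy 0) as [E | E].
  - assert (dx <> 0).
    { intros E'. assert (fst s = fst p) by (unfold dx in *; lra).
      assert (snd s = snd p) by (unfold dy in *; lra).
      unfold arc in *. rewrite H, H0 in *. lra. }
    unfold D. nra.
  - unfold D. nra. }
pose proof (right_arc_le q (arc p y) y ltac:(lra) left) as RA.
assert (Ecross := Ey). unfold arc in Ey.
assert (Ep : arc p y = fst p + sqrt (1 - (y - snd p) ^ 2)) by reflexivity.
destruct (half_circle_sq (y - snd p) ltac:(lra)) as [P0 P2].
destruct (half_circle_sq (y - snd s) ltac:(lra)) as [S0 S2].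
set (u := y - snd p) in *. set (v := y - snd s) in *.
set (P := sqrt (1 - u ^ 2)) in *. set (S := sqrt (1 - v ^ 2)) in *.
assert (Edx : dx = P - S) by (unfold dx; lra).
assert (Edy : dy = u - v) by (unfold dy, u, v; lra).
(* [(P, u)] and [(S, v)] are the vectors from the two centers to the crossing point; their cross
   product is twice the area of the triangle formed with [p] and [s]. *)
assert (N : 0 <= u * S - v * P).
{ assert (uv : v <= u) by (unfold u, v; lra).
  destruct (Rle_lt_dec 0 v) as [v0 | v0].
  - assert (P <= S) by (apply sqrt_le_1_alt; nra).
    assert (v * P <= u * S) by (apply Rmult_le_compat; lra). lra.
  - destruct (Rle_lt_dec 0 u) as [u0 | u0].
    + assert (0 <= u * S) by (apply Rmult_le_pos; lra).
      assert (0 <= - v * P) by (apply Rmult_le_pos; lra). lra.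
    + assert (S <= P) by (apply sqrt_le_1_alt; nra).
      assert (- u * S <= - v * P) by (apply Rmult_le_compat; lra). lra. }
(* Twice the height of that triangle over the base [ps], divided by the base. Two sides have length
   1, so the squared height is [1 - D / 4]. *)
exists y, (2 * ((u * S - v * P) / D)).
split; [exact Hy |]. split; [exact Ecross |]. split; [exact HD |].
assert (EN : (u * S - v * P) ^ 2 * 4 = (4 - D) * D).
{ unfold D. rewrite Edx, Edy.
  assert (EP : P * P = 1 - u * u) by lra. assert (ES : S * S = 1 - v * v) by lra.
  assert (E1 : (P - S) ^ 2 + (u - v) ^ 2 = 2 - 2 * (P * S + u * v)) by (ring [EP ES]).
  rewrite E1.
  replace ((u * S - v * P) ^ 2) with (u * u * (S * S) + v * v * (P * P) - 2 * (P * S) * (u * v)) by ring.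
  replace ((4 - (2 - 2 * (P * S + u * v))) * (2 - 2 * (P * S + u * v)))
    with (4 - 4 * ((P * P) * (S * S) + 2 * (P * S) * (u * v) + u * u * (v * v))) by ring.
  rewrite EP, ES. ring. }
split.
{ apply Rmult_le_pos; [lra |]. apply Rmult_le_pos; [exact N | left; apply Rinv_0_lt_compat, HD]. }
split.
{ replace ((2 * ((u * S - v * P) / D)) ^ 2 * D) with ((u * S - v * P) ^ 2 * 4 / D) by (field; lra).
  rewrite EN. field. lra. }
set (L := (u * S - v * P) / D).
assert (EL : L * D = u * S - v * P) by (unfold L; field; lra).
clearbody L.
(* [L * dy] and [- L * dx] are the coordinates of the vector from the midpoint of [ps] to the
   crossing point. *)
assert (Ex : L * dy = (P + S) / 2).
{ apply (Rmult_eq_reg_r D); [| lra].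
  replace (L * dy * D) with (L * D * dy) by ring. rewrite EL. unfold D. rewrite Edx, Edy.
  assert (EP : P * P = 1 - u * u) by lra. assert (ES : S * S = 1 - v * v) by lra.
  replace ((P + S) / 2 * ((P - S) ^ 2 + (u - v) ^ 2))
    with ((P * (P * P + u * u) + S * (S * S + v * v) - P * (S * S) - S * (P * P)
           + P * (v * v) + S * (u * u) - 2 * u * v * (P + S)) / 2) by field.
  rewrite EP, ES. field. }
assert (Ey' : - L * dx = (u + v) / 2).
{ apply (Rmult_eq_reg_r D); [| lra].
  replace (- L * dx * D) with (- (L * D) * dx) by ring. rewrite EL. unfold D. rewrite Edx, Edy.
  assert (EP : P * P = 1 - u * u) by lra. assert (ES : S * S = 1 - v * v) by lra.
  replace (- (u * S - v * P) * (P - S))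
    with (- (u + v) * (P * S) + u * (S * S) + v * (P * P)) by ring.
  replace ((u + v) / 2 * ((P - S) ^ 2 + (u - v) ^ 2))
    with ((u + v) / 2 * (P * P + S * S + u * u + v * v - 2 * (P * S) - 2 * u * v)) by field.
  rewrite EP, ES. field. }
replace (2 * L * ((fst q - fst p) * dy - (snd q - snd p) * dx))
  with (2 * ((fst q - fst p) * (L * dy) + (snd q - snd p) * (- L * dx))) by ring.
rewrite RA, Ep, Ex, Ey'.
assert (Es : fst s = fst p + (P - S)) by (unfold dx in *; lra).
assert (Esy : snd s = y - v) by (unfold v; lra).
assert (Epy : snd p = y - u) by (unfold u; lra).
rewrite Es, Esy, Epy.
clear - P2 S2.
(* The power of [q] with respect to the unit circle around the crossing point, a circle through [p]
   and [s]. *)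
assert (E : (fst p + P - fst q) ^ 2 + (y - snd q) ^ 2 - 1
  = (fst q - fst p) * (fst q - (fst p + (P - S))) + (snd q - (y - u)) * (snd q - (y - v))
    - 2 * ((fst q - fst p) * ((P + S) / 2) + (snd q - (y - u)) * ((u + v) / 2))).
{ replace ((fst p + P - fst q) ^ 2)
    with ((fst q - fst p) ^ 2 - 2 * (fst q - fst p) * P + P ^ 2) by ring.
  rewrite P2. field. }
lra.
Qed.

Local Close Scope R_scope.
Local Open Scope nat_scope.

(** * A structured language for the real RAM *)

Inductive iexp : Type :=
  | IVar (x : nat)
  | INum (k : nat)
  | IBin (o : int_op) (a b : iexp)
  | IGet (a : iexp).

Inductive rexp : Type :=
  | RNum (k : Z)
  | RBin (o : real_op) (a b : rexp)
  | RGet (a : iexp).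

Inductive test : Type :=
  | ILe (a b : iexp)
  | RLe (a b : rexp).

Inductive cmd : Type :=
  | Skip
  | Seq (c1 c2 : cmd)
  | SetI (x : nat) (e : iexp)
  | PutI (a e : iexp)
  | PutR (a : iexp) (e : rexp)
  | If (b : test) (c1 c2 : cmd)
  | While (b : test) (c : cmd).

(** Variable [x] lives in the integer register [2 * x]; the odd registers hold
    intermediate values of expressions, as do all real registers. *)
Fixpoint compile_iexp (d : nat) (e : iexp) : program :=
  match e with
  | IVar x => [IMove (S (2 * d)) (2 * x)]
  | INum k => [IConst (S (2 * d)) k]
  | IBin o a b =>
      compile_iexp d a ++ compile_iexp (S d) b ++
      [IOp o (S (2 * d)) (S (2 * d)) (S (2 * S d))]
  | IGet a => compile_iexp d a ++ [ILoad (S (2 * d)) (S (2 * d))]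
  end.

Fixpoint compile_rexp (di d : nat) (e : rexp) : program :=
  match e with
  | RNum k => [RConst d k]
  | RBin o a b =>
      compile_rexp di d a ++ compile_rexp di (S d) b ++
      [ROp o d d (S d)]
  | RGet a => compile_iexp di a ++ [RLoad d (S (2 * di))]
  end.

(** The code of a test ends with a jump to [l], taken when the test succeeds. *)
Definition compile_test (b : test) (l : nat) : program :=
  match b with
  | ILe x y => compile_iexp 0 x ++ compile_iexp 1 y ++ [IJumpLe 1 3 l]
  | RLe x y => compile_rexp 0 0 x ++ compile_rexp 0 1 y ++ [RJumpLe 0 1 l]
  end.

Definition test_length (b : test) : nat := length (compile_test b 0).

(** Forward jumps need the length of code that is not yet placed. The same number is the time bound
    of a loop-free command. *)
Fixpoint code_length (c : cmd) : nat :=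
  match c with
  | Skip => 0
  | Seq c1 c2 => code_length c1 + code_length c2
  | SetI _ e => length (compile_iexp 0 e) + 1
  | PutI a e => length (compile_iexp 0 a) + (length (compile_iexp 1 e) + 1)
  | PutR a e => length (compile_iexp 0 a) + (length (compile_rexp 1 0 e) + 1)
  | If b c1 c2 => test_length b + (code_length c2 + (1 + code_length c1))
  | While b c => test_length b + (1 + (code_length c + 1))
  end.

(** The code of the second branch comes before that of the first, since a test jumps on success.
    Jump targets are absolute, whence the offset. *)
Fixpoint compile (off : nat) (c : cmd) : program :=
  match c with
  | Skip => []
  | Seq c1 c2 => compile off c1 ++ compile (off + code_length c1) c2
  | SetI x e => compile_iexp 0 e ++ [IMove (2 * x) 1]
  | PutI a e => compile_iexp 0 a ++ compile_iexp 1 e ++ [IStore 1 3]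
  | PutR a e => compile_iexp 0 a ++ compile_rexp 1 0 e ++ [RStore 1 0]
  | If b c1 c2 =>
      let l2 := off + test_length b in
      let l1 := l2 + code_length c2 + 1 in
      compile_test b l1 ++ compile l2 c2 ++ [Jump (l1 + code_length c1)] ++ compile l1 c1
  | While b c =>
      let l := off + test_length b in
      compile_test b (S l) ++ [Jump (S l + code_length c + 1)] ++
      compile (S l) c ++ [Jump off]
  end.

Record store : Type := Store {
  ivar : nat -> nat;
  imem_of : nat -> nat;
  rmem_of : nat -> R
}.

Fixpoint ieval (s : store) (e : iexp) : nat :=
  match e with
  | IVar x => ivar s x
  | INum k => k
  | IBin o a b => int_eval o (ieval s a) (ieval s b)
  | IGet a => imem_of s (ieval s a)
  end.

Fixpoint reval (s : store) (e : rexp) : R :=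
  match e with
  | RNum k => IZR k
  | RBin RAdd a b => (reval s a + reval s b)%R
  | RBin RSub a b => (reval s a - reval s b)%R
  | RBin RMul a b => (reval s a * reval s b)%R
  | RBin RDiv a b => (reval s a / reval s b)%R
  | RGet a => rmem_of s (ieval s a)
  end.

(** Only constants and results of operations need a bound: variables and loaded words are at most
    [m] by the last two fields of [agree]. *)
Fixpoint isafe (m : nat) (s : store) (e : iexp) : Prop :=
  match e with
  | IVar x => True
  | INum k => k <= m
  | IBin o a b => isafe m s a /\ isafe m s b /\ ieval s (IBin o a b) <= m
  | IGet a => isafe m s a /\ ieval s a < m
  end.

Fixpoint rsafe (m : nat) (s : store) (e : rexp) : Prop :=
  match e with
  | RNum _ => True
  | RBin RDiv a b => rsafe m s a /\ rsafe m s b /\ reval s b <> 0%R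
  | RBin _ a b => rsafe m s a /\ rsafe m s b
  | RGet a => isafe m s a /\ ieval s a < m
  end.

Definition test_safe (m : nat) (s : store) (b : test) : Prop :=
  match b with
  | ILe x y => isafe m s x /\ isafe m s y
  | RLe x y => rsafe m s x /\ rsafe m s y
  end.

Definition holds (s : store) (b : test) : Prop :=
  match b with
  | ILe x y => ieval s x <= ieval s y
  | RLe x y => (reval s x <= reval s y)%R
  end.

Definition set_ivar (x v : nat) (s : store) : store :=
  Store (update (ivar s) x v) (imem_of s) (rmem_of s).
Definition put_imem (a v : nat) (s : store) : store :=
  Store (ivar s) (update (imem_of s) a v) (rmem_of s).
Definition put_rmem (a : nat) (v : R) (s : store) : store :=
  Store (ivar s) (imem_of s) (update (rmem_of s) a v).

Lemma update_eq {A : Type} (f : nat -> A) (k : nat) (v : A) : update f k v k = v.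
Proof. unfold update. now rewrite Nat.eqb_refl. Qed.

Lemma update_neq {A : Type} (f : nat -> A) (k j : nat) (v : A) :
  j <> k -> update f k v j = f j.
Proof. intros H. unfold update. now rewrite (proj2 (Nat.eqb_neq _ _) H). Qed.

(** * Correctness of the compiler *)

Definition code_at (P : program) (off : nat) (code : program) : Prop :=
  forall k i, nth_error code k = Some i -> nth_error P (off + k) = Some i.

Lemma code_at_app (P : program) (off : nat) (a b : program) :
  code_at P off (a ++ b) -> code_at P off a /\ code_at P (off + length a) b.
Proof.
intros H. split; intros k i Hk.
- apply H. rewrite nth_error_app1; [exact Hk |].
  apply nth_error_Some. congruence.
- rewrite <- Nat.add_assoc. apply H. rewrite nth_error_app2 by lia.
  now replace (length a + k - length a) with k by lia.
Qed.

Lemma code_at_head (P : program) (off : nat) (i : instr) (code : program) :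
  code_at P off (i :: code) -> nth_error P off = Some i /\ code_at P (off + 1) code.
Proof.
intros H. split.
- rewrite <- (Nat.add_0_r off). now apply H.
- intros k j Hk. rewrite <- Nat.add_assoc. now apply H.
Qed.

Lemma run_app (m : nat) (P : program) (t1 t2 : nat) (s1 s2 : state) :
  run m P t1 s1 = Some s2 -> run m P (t1 + t2) s1 = run m P t2 s2.
Proof.
revert s1. induction t1 as [|t1 IH]; simpl; intros s1 H.
- now injection H as ->.
- destruct (step m P s1); [now apply IH | discriminate].
Qed.

Definition steps (m : nat) (P : program) (T : nat) (s s' : state) : Prop :=
  exists t, t <= T /\ run m P t s = Some s'.

Lemma steps_trans (m : nat) (P : program) (T1 T2 : nat) (s1 s2 s3 : state) :
  steps m P T1 s1 s2 -> steps m P T2 s2 s3 -> steps m P (T1 + T2) s1 s3.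
Proof.
intros [t1 [H1 R1]] [t2 [H2 R2]]. exists (t1 + t2). split; [lia |].
now rewrite (run_app _ _ _ _ _ _ R1).
Qed.

Lemma steps_one (m : nat) (P : program) (s s' : state) :
  step m P s = Some s' -> steps m P 1 s s'.
Proof. intros H. exists 1. split; [lia |]. simpl. now rewrite H. Qed.

Lemma steps_le (m : nat) (P : program) (T T' : nat) (s s' : state) :
  T <= T' -> steps m P T s s' -> steps m P T' s s'.
Proof. intros H [t [Ht R]]. exists t. split; [lia | exact R]. Qed.

(** Odd integer registers and all real registers are temporaries and have no counterpart in the
    store, but the word bound extends to every integer register. *)
Record agree (m : nat) (s : state) (u : store) : Prop := {
  agree_ivar : forall x, ireg s (2 * x) = ivar u x;
  agree_imem : forall a, imem s a = imem_of u a;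
  agree_rmem : forall a, rmem s a = rmem_of u a;
  agree_ireg_le : forall x, ireg s x <= m;
  agree_imem_le : forall a, imem s a <= m
}.

Ltac simpl_fields :=
  cbn [set_ireg set_rreg set_imem set_rmem put_imem put_rmem set_ivar ivar
       imem_of rmem_of pc ireg rreg imem rmem].

Lemma agree_goto (m l : nat) (s : state) (u : store) :
  agree m s u -> agree m (goto l s) u.
Proof. intros []. now split. Qed.

Lemma agree_set_temporary (m d v : nat) (s : state) (u : store) :
  agree m s u -> v <= m -> agree m (set_ireg (S (2 * d)) v s) u.
Proof.
intros [] Hv. split; simpl_fields; auto; intros x.
- rewrite update_neq by lia. auto.
- unfold update. destruct (Nat.eqb _ _); auto.
Qed.

Lemma agree_set_rreg (m d : nat) (v : R) (s : state) (u : store) :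
  agree m s u -> agree m (set_rreg d v s) u.
Proof.
intros []. split; simpl_fields; auto.
Qed.

Lemma agree_set_ivar (m x v : nat) (s : state) (u : store) :
  agree m s u -> v <= m -> agree m (set_ireg (2 * x) v s) (set_ivar x v u).
Proof.
intros [] Hv. split; simpl_fields; auto;
  intros y; unfold update.
- destruct (Nat.eqb_spec (2 * y) (2 * x)); destruct (Nat.eqb_spec y x); lia || auto.
- destruct (Nat.eqb _ _); auto.
Qed.

Lemma agree_put_imem (m a v : nat) (s : state) (u : store) :
  agree m s u -> v <= m -> agree m (set_imem a v s) (put_imem a v u).
Proof.
intros [] Hv. split; simpl; auto; intros y; unfold update; destruct (Nat.eqb _ _); auto.
Qed.

Lemma agree_put_rmem (m a : nat) (v : R) (s : state) (u : store) :
  agree m s u -> agree m (set_rmem a v s) (put_rmem a v u).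
Proof.
intros []. split; simpl; auto; intros y; unfold update; destruct (Nat.eqb _ _); auto.
Qed.

(** The clause about depths [d' < d] carries the induction: the value of a left operand survives the
    evaluation of the right one. *)
Lemma compile_iexp_correct (m : nat) (P : program) (u : store) (e : iexp) :
  forall (d : nat) (s : state),
  code_at P (pc s) (compile_iexp d e) -> agree m s u -> isafe m u e ->
  exists s', steps m P (length (compile_iexp d e)) s s' /\
    pc s' = pc s + length (compile_iexp d e) /\ agree m s' u /\
    ireg s' (S (2 * d)) = ieval u e /\
    (forall d', d' < d -> ireg s' (S (2 * d')) = ireg s (S (2 * d'))) /\
    rreg s' = rreg s.
Proof.
assert (exec : forall d s v, agree m s u -> v <= m ->
  step m P s = (if v <=? m then Some (set_ireg (S (2 * d)) v s) else None) ->
  exists s', steps m P 1 s s' /\ pc s' = pc s + 1 /\ agree m s' u /\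
    ireg s' (S (2 * d)) = v /\
    (forall d', d' < d -> ireg s' (S (2 * d')) = ireg s (S (2 * d'))) /\
    rreg s' = rreg s).
{ intros d s v A Hv Hs. rewrite (proj2 (Nat.leb_le _ _) Hv) in Hs.
  exists (set_ireg (S (2 * d)) v s).
  split; [now apply steps_one |]. split; [simpl; lia |].
  split; [now apply agree_set_temporary |].
  split; [apply update_eq |]. split; [| reflexivity].
  intros d' Hd. apply update_neq. lia. }
induction e as [x | k | o a IHa b IHb | a IHa]; intros d s C A Hsafe.
- cbn [compile_iexp] in *. apply code_at_head in C as [C _].
  apply (exec d s (ivar u x)); auto.
  + rewrite <- (agree_ivar _ _ _ A). apply (agree_ireg_le _ _ _ A).
  + unfold step. rewrite C. cbv zeta. now rewrite (agree_ivar _ _ _ A).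
- cbn [compile_iexp] in *. apply code_at_head in C as [C _].
  apply (exec d s k); auto. unfold step. now rewrite C.
- cbn [compile_iexp] in *. destruct Hsafe as [Sa [Sb Sv]].
  apply code_at_app in C as [Ca C]. apply code_at_app in C as [Cb C].
  apply code_at_head in C as [C _].
  destruct (IHa d s Ca A Sa) as [s1 [R1 [E1 [A1 [V1 [K1 F1]]]]]].
  rewrite <- E1 in Cb, C.
  destruct (IHb (S d) s1 Cb A1 Sb) as [s2 [R2 [E2 [A2 [V2 [K2 F2]]]]]].
  rewrite <- E2 in C.
  destruct (exec d s2 (ieval u (IBin o a b)) A2 Sv) as [s3 [R3 [E3 [A3 [V3 [K3 F3]]]]]].
  { unfold step. rewrite C. cbv zeta.
    rewrite V2, (K2 d) by lia. now rewrite V1. }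
  exists s3. rewrite !length_app. simpl length.
  split; [eapply steps_trans; [eassumption |]; eapply steps_trans; eassumption |].
  split; [lia |]. split; [exact A3 |]. split; [exact V3 |].
  split; [| congruence].
  intros d' Hd. rewrite K3, K2, K1 by lia. reflexivity.
- cbn [compile_iexp] in *. destruct Hsafe as [Sa Sv].
  apply code_at_app in C as [Ca C]. apply code_at_head in C as [C _].
  destruct (IHa d s Ca A Sa) as [s1 [R1 [E1 [A1 [V1 [K1 F1]]]]]].
  rewrite <- E1 in C.
  destruct (exec d s1 (ieval u (IGet a)) A1) as [s3 [R3 [E3 [A3 [V3 [K3 F3]]]]]].
  { simpl. rewrite <- (agree_imem _ _ _ A1). apply (agree_imem_le _ _ _ A1). }
  { unfold step. rewrite C. cbv zeta. rewrite V1.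
    rewrite (proj2 (Nat.ltb_lt _ _) Sv). now rewrite (agree_imem _ _ _ A1). }
  exists s3. rewrite !length_app. simpl length.
  split; [eapply steps_trans; eassumption |].
  split; [lia |]. split; [exact A3 |]. split; [exact V3 |].
  split; [| congruence].
  intros d' Hd. rewrite K3, K1 by lia. reflexivity.
Qed.

(** Two frame clauses are needed: real temporaries for the operands, and integer temporaries because
    a store of a real keeps its address in temporary 0 while the value is computed at depth
    [di = 1]. *)
Lemma compile_rexp_correct (m : nat) (P : program) (u : store) (di : nat) (e : rexp) :
  forall (d : nat) (s : state),
  code_at P (pc s) (compile_rexp di d e) -> agree m s u -> rsafe m u e ->
  exists s', steps m P (length (compile_rexp di d e)) s s' /\
    pc s' = pc s + length (compile_rexp di d e) /\ agree m s' u /\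
    rreg s' d = reval u e /\
    (forall d', d' < d -> rreg s' d' = rreg s d') /\
    (forall d', d' < di -> ireg s' (S (2 * d')) = ireg s (S (2 * d'))).
Proof.
assert (exec : forall d s v, agree m s u ->
  step m P s = Some (set_rreg d v s) ->
  exists s', steps m P 1 s s' /\ pc s' = pc s + 1 /\ agree m s' u /\
    rreg s' d = v /\
    (forall d', d' < d -> rreg s' d' = rreg s d') /\
    (forall d', d' < di -> ireg s' (S (2 * d')) = ireg s (S (2 * d')))).
{ intros d s v A Hs.
  exists (set_rreg d v s).
  split; [now apply steps_one |]. split; [simpl; lia |].
  split; [now apply agree_set_rreg |].
  split; [apply update_eq |]. split; [| reflexivity].
  intros d' Hd. apply update_neq. lia. }
induction e as [k | o a IHa b IHb | a]; intros d s C A Hsafe.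
- cbn [compile_rexp] in *. apply code_at_head in C as [C _].
  apply (exec d s (IZR k)); auto. unfold step. now rewrite C.
- cbn [compile_rexp] in *.
  assert (Sab : rsafe m u a /\ rsafe m u b) by (destruct o; simpl in Hsafe; tauto).
  destruct Sab as [Sa Sb].
  apply code_at_app in C as [Ca C]. apply code_at_app in C as [Cb C].
  apply code_at_head in C as [C _].
  destruct (IHa d s Ca A Sa) as [s1 [R1 [E1 [A1 [V1 [K1 F1]]]]]].
  rewrite <- E1 in Cb, C.
  destruct (IHb (S d) s1 Cb A1 Sb) as [s2 [R2 [E2 [A2 [V2 [K2 F2]]]]]].
  rewrite <- E2 in C.
  destruct (exec d s2 (reval u (RBin o a b)) A2) as [s3 [R3 [E3 [A3 [V3 [K3 F3]]]]]].
  { unfold step. rewrite C. cbv zeta.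
    rewrite V2, (K2 d) by lia. rewrite V1. destruct o; try reflexivity.
    unfold real_eval. destruct (Req_dec_T _ _) as [E | E]; [| reflexivity].
    simpl in Hsafe. tauto. }
  exists s3. rewrite !length_app. simpl length.
  split; [eapply steps_trans; [eassumption |]; eapply steps_trans; eassumption |].
  split; [lia |]. split; [exact A3 |]. split; [exact V3 |].
  split; intros d' Hd; [rewrite K3, K2, K1 by lia | rewrite F3, F2, F1 by lia]; reflexivity.
- cbn [compile_rexp] in *. destruct Hsafe as [Sa Sv].
  apply code_at_app in C as [Ca C]. apply code_at_head in C as [C _].
  destruct (compile_iexp_correct m P u a di s Ca A Sa) as [s1 [R1 [E1 [A1 [V1 [K1 F1]]]]]].
  rewrite <- E1 in C.
  destruct (exec d s1 (reval u (RGet a)) A1) as [s3 [R3 [E3 [A3 [V3 [K3 F3]]]]]].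
  { unfold step. rewrite C. cbv zeta. rewrite V1.
    rewrite (proj2 (Nat.ltb_lt _ _) Sv). now rewrite (agree_rmem _ _ _ A1). }
  exists s3. rewrite !length_app. simpl length.
  split; [eapply steps_trans; eassumption |].
  split; [lia |]. split; [exact A3 |]. split; [exact V3 |].
  split; intros d' Hd; [rewrite K3 by lia; now rewrite F1 | now rewrite F3, K1 by lia].
Qed.

Lemma length_compile_test (b : test) (l : nat) : length (compile_test b l) = test_length b.
Proof. destruct b; unfold test_length; simpl; rewrite !length_app; reflexivity. Qed.

Lemma length_compile (c : cmd) : forall off, length (compile off c) = code_length c.
Proof.
induction c; intros off; simpl; repeat (rewrite length_app; simpl);
  rewrite ?length_compile_test, ?IHc1, ?IHc2, ?IHc; lia.
Qed.

Lemma compile_test_correct (m : nat) (P : program) (u : store) (b : test) (l : nat) (s : state) :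
  code_at P (pc s) (compile_test b l) -> agree m s u -> test_safe m u b ->
  exists s', steps m P (test_length b) s s' /\ agree m s' u /\
    ((holds u b /\ pc s' = l) \/ (~ holds u b /\ pc s' = pc s + test_length b)).
Proof.
intros C A Hsafe. unfold test_length.
destruct b as [x y | x y]; destruct Hsafe as [Sx Sy]; cbn [compile_test] in *;
  apply code_at_app in C as [Cx C]; apply code_at_app in C as [Cy C];
  apply code_at_head in C as [C _].
- destruct (compile_iexp_correct m P u x 0 s Cx A Sx) as [s1 [R1 [E1 [A1 [V1 [K1 F1]]]]]].
  rewrite <- E1 in Cy, C.
  destruct (compile_iexp_correct m P u y 1 s1 Cy A1 Sy) as [s2 [R2 [E2 [A2 [V2 [K2 F2]]]]]].
  rewrite <- E2 in C.
  exists (goto (if ieval u x <=? ieval u y then l else S (pc s2)) s2).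
  rewrite !length_app. simpl length.
  split; [eapply steps_trans; [eassumption |]; eapply steps_trans; [eassumption |]; apply steps_one |].
  { unfold step. rewrite C. cbv zeta. simpl in V1, V2. rewrite V2.
    specialize (K2 0 ltac:(lia)). simpl in K2. now rewrite K2, V1. }
  split; [now apply agree_goto |].
  simpl. destruct (Nat.leb_spec (ieval u x) (ieval u y)); [left | right]; split; lia.
- destruct (compile_rexp_correct m P u 0 x 0 s Cx A Sx) as [s1 [R1 [E1 [A1 [V1 [K1 F1]]]]]].
  rewrite <- E1 in Cy, C.
  destruct (compile_rexp_correct m P u 0 y 1 s1 Cy A1 Sy) as [s2 [R2 [E2 [A2 [V2 [K2 F2]]]]]].
  rewrite <- E2 in C.
  exists (goto (if Rle_dec (reval u x) (reval u y) then l else S (pc s2)) s2).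
  rewrite !length_app. simpl length.
  split; [eapply steps_trans; [eassumption |]; eapply steps_trans; [eassumption |]; apply steps_one |].
  { unfold step. rewrite C. cbv zeta. simpl in V1, V2. rewrite V2.
    specialize (K2 0 ltac:(lia)). simpl in K2. now rewrite K2, V1. }
  split; [now apply agree_goto |].
  simpl. destruct (Rle_dec (reval u x) (reval u y)); [left | right]; split; auto; lia.
Qed.

(** * Total-correctness triples with a time bound, valid for the code in any program *)

Definition runs (m : nat) (c : cmd) (u : store) (T : nat) (Q : store -> Prop) : Prop :=
  forall (P : program) (s : state),
  code_at P (pc s) (compile (pc s) c) -> agree m s u ->
  exists (s' : state) (u' : store),
    steps m P T s s' /\ pc s' = pc s + code_length c /\ agree m s' u' /\ Q u'.

Lemma runs_weaken (m : nat) (c : cmd) (u : store) (T T' : nat) (Q Q' : store -> Prop) :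
  T <= T' -> (forall v, Q v -> Q' v) -> runs m c u T Q -> runs m c u T' Q'.
Proof.
intros HT HQ H P s C A. destruct (H P s C A) as [s' [u' [R [E [A' q]]]]].
exists s', u'. split; [eapply steps_le; eassumption |]. auto.
Qed.

Lemma runs_skip (m : nat) (u : store) (Q : store -> Prop) : Q u -> runs m Skip u 0 Q.
Proof.
intros q P s C A. exists s, u. split; [exists 0; simpl; auto |]. simpl. auto.
Qed.

Lemma runs_seq (m : nat) (c1 c2 : cmd) (u : store) (T1 T2 : nat) (Q : store -> Prop) :
  runs m c1 u T1 (fun v => runs m c2 v T2 Q) -> runs m (Seq c1 c2) u (T1 + T2) Q.
Proof.
intros H P s C A. simpl in C. apply code_at_app in C as [C1 C2].
destruct (H P s C1 A) as [s1 [u1 [R1 [E1 [A1 H2]]]]].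
rewrite length_compile, <- E1 in C2.
destruct (H2 P s1 C2 A1) as [s2 [u2 [R2 [E2 [A2 q]]]]].
exists s2, u2. split; [eapply steps_trans; eassumption |]. simpl. split; [lia | auto].
Qed.

Lemma runs_set_ivar (m x : nat) (e : iexp) (u : store) (Q : store -> Prop) :
  isafe m u e -> Q (set_ivar x (ieval u e) u) ->
  runs m (SetI x e) u (code_length (SetI x e)) Q.
Proof.
intros Se q P s C A. cbn [compile] in C. apply code_at_app in C as [Ce C].
apply code_at_head in C as [C _].
destruct (compile_iexp_correct m P u e 0 s Ce A Se) as [s1 [R1 [E1 [A1 [V1 _]]]]].
rewrite <- E1 in C. simpl in V1.
assert (L : ieval u e <= m) by (rewrite <- V1; apply (agree_ireg_le _ _ _ A1)).
exists (set_ireg (2 * x) (ieval u e) s1), (set_ivar x (ieval u e) u).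
split.
{ cbn [code_length]. eapply steps_trans; [eassumption |]. apply steps_one.
  unfold step. rewrite C. cbv zeta. rewrite V1. now rewrite (proj2 (Nat.leb_le _ _) L). }
split; [simpl; lia |]. split; [now apply agree_set_ivar | exact q].
Qed.

Lemma runs_put_imem (m : nat) (a e : iexp) (u : store) (Q : store -> Prop) :
  isafe m u a -> ieval u a < m -> isafe m u e ->
  Q (put_imem (ieval u a) (ieval u e) u) ->
  runs m (PutI a e) u (code_length (PutI a e)) Q.
Proof.
intros Sa La Se q P s C A. cbn [compile] in C. apply code_at_app in C as [Ca C].
apply code_at_app in C as [Ce C]. apply code_at_head in C as [C _].
destruct (compile_iexp_correct m P u a 0 s Ca A Sa) as [s1 [R1 [E1 [A1 [V1 _]]]]].
rewrite <- E1 in C, Ce.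
destruct (compile_iexp_correct m P u e 1 s1 Ce A1 Se) as [s2 [R2 [E2 [A2 [V2 [K2 _]]]]]].
rewrite <- E2 in C. specialize (K2 0 ltac:(lia)). simpl in V1, V2, K2.
assert (L : ieval u e <= m) by (rewrite <- V2; apply (agree_ireg_le _ _ _ A2)).
exists (set_imem (ieval u a) (ieval u e) s2), (put_imem (ieval u a) (ieval u e) u).
split.
{ cbn [code_length]. eapply steps_trans; [eassumption |].
  eapply steps_trans; [eassumption |]. apply steps_one.
  unfold step. rewrite C. cbv zeta. rewrite K2, V1, V2.
  now rewrite (proj2 (Nat.ltb_lt _ _) La). }
split; [simpl; lia |]. split; [now apply agree_put_imem | exact q].
Qed.

Lemma runs_put_rmem (m : nat) (a : iexp) (e : rexp) (u : store) (Q : store -> Prop) :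
  isafe m u a -> ieval u a < m -> rsafe m u e ->
  Q (put_rmem (ieval u a) (reval u e) u) ->
  runs m (PutR a e) u (code_length (PutR a e)) Q.
Proof.
intros Sa La Se q P s C A. cbn [compile] in C. apply code_at_app in C as [Ca C].
apply code_at_app in C as [Ce C]. apply code_at_head in C as [C _].
destruct (compile_iexp_correct m P u a 0 s Ca A Sa) as [s1 [R1 [E1 [A1 [V1 _]]]]].
rewrite <- E1 in C, Ce.
destruct (compile_rexp_correct m P u 1 e 0 s1 Ce A1 Se) as [s2 [R2 [E2 [A2 [V2 [_ K2]]]]]].
rewrite <- E2 in C. specialize (K2 0 ltac:(lia)). simpl in V1, V2, K2.
exists (set_rmem (ieval u a) (reval u e) s2), (put_rmem (ieval u a) (reval u e) u).
split.
{ cbn [code_length]. eapply steps_trans; [eassumption |].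
  eapply steps_trans; [eassumption |]. apply steps_one.
  unfold step. rewrite C. cbv zeta. rewrite K2, V1, V2.
  now rewrite (proj2 (Nat.ltb_lt _ _) La). }
split; [simpl; lia |]. split; [now apply agree_put_rmem | exact q].
Qed.

(** The bound adds the two branches instead of taking their maximum, so that it agrees with
    [code_length]. *)
Lemma runs_if (m : nat) (b : test) (c1 c2 : cmd) (u : store) (T1 T2 : nat) (Q : store -> Prop) :
  test_safe m u b ->
  (holds u b -> runs m c1 u T1 Q) -> (~ holds u b -> runs m c2 u T2 Q) ->
  runs m (If b c1 c2) u (test_length b + (T2 + (1 + T1))) Q.
Proof.
intros Sb H1 H2 P s C A. cbn [compile] in C. cbv zeta in C.
apply code_at_app in C as [Cb C]. apply code_at_app in C as [C2 C].
apply code_at_app in C as [CJ C1].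
rewrite length_compile_test in *. rewrite length_compile in *.
destruct (compile_test_correct m P u b _ s Cb A Sb) as [s1 [R1 [A1 [[Hb E1] | [Hb E1]]]]].
- simpl length in C1. rewrite <- E1 in C1.
  destruct (H1 Hb P s1 C1 A1) as [s2 [u2 [R2 [E2 [A2 q]]]]].
  exists s2, u2. split; [eapply steps_le; [| eapply steps_trans; eassumption]; lia |].
  split; [simpl; lia | auto].
- rewrite <- E1 in C2.
  destruct (H2 Hb P s1 C2 A1) as [s2 [u2 [R2 [E2 [A2 q]]]]].
  apply code_at_head in CJ as [CJ _]. rewrite <- E1, <- E2 in CJ.
  exists (goto (pc s2 + 1 + code_length c1) s2), u2.
  split.
  { apply (steps_le m P (test_length b + (T2 + 1))); [lia |].
    eapply steps_trans; [eassumption |]. eapply steps_trans; [eassumption |].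
    apply steps_one. unfold step. now rewrite CJ. }
  split; [simpl; lia |]. split; [now apply agree_goto | exact q].
Qed.

(** Each round pays for the test, the body and a jump; one extra round pays for the exit. Since the
    measure is arbitrary, amortized bounds come at no extra cost. *)
Lemma runs_while (m : nat) (b : test) (c : cmd) (T : nat) (I : store -> Prop)
    (measure : store -> nat) :
  (forall u, I u -> test_safe m u b) ->
  (forall u, I u -> holds u b ->
    runs m c u T (fun v => I v /\ measure v < measure u)) ->
  forall u, I u ->
  runs m (While b c) u ((measure u + 1) * (T + test_length b + 2))
    (fun v => I v /\ ~ holds v b).
Proof.
intros Hsafe Hbody u Iu P s C A.
remember (measure u) as k eqn:Ek. revert u s Iu Ek C A.
induction k as [k IH] using (well_founded_induction lt_wf). intros u s Iu Ek C A.
assert (C0 := C). cbn [compile] in C. cbv zeta in C.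
apply code_at_app in C as [Cb C]. apply code_at_app in C as [CJ C].
apply code_at_app in C as [Cc CK].
rewrite length_compile_test in *. rewrite length_compile in *. simpl length in *.
apply code_at_head in CJ as [CJ _]. apply code_at_head in CK as [CK _].
destruct (compile_test_correct m P u b _ s Cb A (Hsafe u Iu))
  as [s1 [R1 [A1 [[Hb E1] | [Hb E1]]]]].
- replace (pc s + test_length b + 1) with (pc s1) in Cc, CK by lia.
  replace (S (pc s + test_length b)) with (pc s1) in Cc by lia.
  destruct (Hbody u Iu Hb P s1 Cc A1) as [s2 [u2 [R2 [E2 [A2 [I2 M2]]]]]].
  rewrite <- E2 in CK.
  destruct (IH (measure u2) ltac:(lia) u2 (goto (pc s) s2) I2 eq_refl C0 (agree_goto _ _ _ _ A2))
    as [s3 [u3 [R3 [E3 [A3 q]]]]].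
  exists s3, u3. split; [| auto].
  apply (steps_le m P (test_length b + (T + (1 + (measure u2 + 1) * (T + test_length b + 2))))).
  { nia. }
  eapply steps_trans; [eassumption |]. eapply steps_trans; [eassumption |].
  eapply steps_trans; [| exact R3]. apply steps_one. unfold step. now rewrite CK.
- rewrite <- E1 in CJ.
  exists (goto (S (pc s1) + code_length c + 1) s1), u.
  split.
  { apply (steps_le m P (test_length b + 1)); [nia |].
    eapply steps_trans; [eassumption |]. apply steps_one. unfold step. now rewrite CJ. }
  split; [simpl; lia |]. split; [now apply agree_goto | auto].
Qed.

(** Loops get [False]: they are always treated by [runs_while] or [runs_for] with an explicit
    invariant. *)
Fixpoint wp (m : nat) (c : cmd) (Q : store -> Prop) (u : store) : Prop :=
  match c with
  | Skip => Q u
  | Seq c1 c2 => wp m c1 (wp m c2 Q) u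
  | SetI x e => isafe m u e /\ Q (set_ivar x (ieval u e) u)
  | PutI a e => isafe m u a /\ ieval u a < m /\ isafe m u e /\
      Q (put_imem (ieval u a) (ieval u e) u)
  | PutR a e => isafe m u a /\ ieval u a < m /\ rsafe m u e /\
      Q (put_rmem (ieval u a) (reval u e) u)
  | If b c1 c2 => test_safe m u b /\
      (holds u b -> wp m c1 Q u) /\ (~ holds u b -> wp m c2 Q u)
  | While _ _ => False
  end.

Lemma runs_wp (m : nat) (c : cmd) :
  forall Q u, wp m c Q u -> runs m c u (code_length c) Q.
Proof.
induction c; intros Q u; cbn [wp]; intros H.
- now apply runs_skip.
- apply runs_seq. eapply runs_weaken; [reflexivity | | apply IHc1; exact H].
  intros v Hv. apply IHc2, Hv.
- now apply runs_set_ivar.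
- now apply runs_put_imem.
- now apply runs_put_rmem.
- destruct H as [Sb [H1 H2]]. apply runs_if; auto.
- contradiction.
Qed.

(** The bound [n] is a variable, not a number. *)
Definition For (x n : nat) (c : cmd) : cmd :=
  Seq (SetI x (INum 0))
    (While (ILe (IBin IAdd (IVar x) (INum 1)) (IVar n))
      (Seq c (SetI x (IBin IAdd (IVar x) (INum 1))))).

(** The last test computes [N + 1], which must still fit in a word. The invariant for [S a] is
    required after the increment, so the body has to preserve the counter. *)
Lemma runs_for (m x n N : nat) (c : cmd) (T : nat) (I : nat -> store -> Prop)
    (u : store) (Q : store -> Prop) :
  N + 1 <= m ->
  (forall a v, I a v -> ivar v x = a /\ ivar v n = N) ->
  (forall a v, a < N -> I a v ->
    runs m c v T (fun w => ivar w x = a /\ I (S a) (set_ivar x (S a) w))) ->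
  I 0 (set_ivar x 0 u) ->
  (forall v, I N v -> Q v) ->
  runs m (For x n c) u ((N + 1) * (T + 20)) Q.
Proof.
intros Hm Hv Hbody H0 HQ.
apply (runs_weaken m _ u (2 + (N + 1) * (T + 4 + 6 + 2)) _ Q Q); [nia | auto |].
apply runs_seq. apply runs_set_ivar; [simpl; lia |]. simpl ieval.
set (J := fun v => exists a, a <= N /\ I a v).
apply (runs_weaken m _ _ ((N - ivar (set_ivar x 0 u) x + 1)
    * (T + 4 + test_length (ILe (IBin IAdd (IVar x) (INum 1)) (IVar n)) + 2)) _
  (fun v => J v /\ ~ holds v (ILe (IBin IAdd (IVar x) (INum 1)) (IVar n)))).
- replace (test_length _) with 5 by reflexivity. nia.
- intros v [[a [Ha Ia]] Hn]. apply HQ. destruct (Hv a v Ia) as [E1 E2].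
  simpl in Hn. rewrite E1, E2 in Hn. replace N with a by lia. exact Ia.
- apply (runs_while m _ _ (T + 4) J (fun v => N - ivar v x)).
  + intros v [a [Ha Ia]]. destruct (Hv a v Ia) as [E1 E2]. simpl. lia.
  + intros v [a [Ha Ia]] Hb. destruct (Hv a v Ia) as [E1 E2]. simpl in Hb.
    rewrite E1, E2 in Hb.
    apply runs_seq.
    eapply runs_weaken; [reflexivity | | apply (Hbody a v); [lia | exact Ia]].
    intros w [Ew Iw]. apply (runs_set_ivar m x (IBin IAdd (IVar x) (INum 1))).
    * simpl. lia.
    * replace (ieval w (IBin IAdd (IVar x) (INum 1))) with (S a) by (simpl; lia).
      split; [exists (S a); split; [lia | exact Iw] |].
      simpl. rewrite update_eq. lia.
  + exists 0. split; [lia | exact H0].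
Qed.

(** * Chains and lower envelopes *)

Section Chains.

Context (n : nat) (h : R) (pt : nat -> point).
Hypothesis pt_sorted : forall i j, i <= j -> j < n -> (fst (pt i) <= fst (pt j))%R.
Hypothesis pt_strip : forall i, i < n -> (h - 1 / 2 <= snd (pt i) <= h + 1 / 2)%R.

(** Chains are listed backwards: the head is the last, rightmost point, where a chain grows. *)
Fixpoint chain (l : list nat) : Prop :=
  match l with
  | [] => True
  | k :: l' => k < n /\ (forall j, In j l' -> j < k /\ far (pt j) (pt k)) /\ chain l'
  end.

(** The points [j] and [i] shield [k] from all their predecessors: this is
    [no_turn_back], and it does not need [i] to be far from [k]. *)
Lemma chain_far (i j k : nat) (l : list nat) :
  chain (j :: i :: l) -> j < k -> k < n -> far (pt j) (pt k) ->
  forall a, In a l -> a < k /\ far (pt a) (pt k).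
Proof.
intros [Hj [Hjl [Hi [Hil Hl]]]] jk kn Fjk a Ha.
destruct (Hjl i) as [ij Fij]; [now left |].
destruct (Hjl a) as [aj Faj]; [now right |].
destruct (Hil a Ha) as [ai Fai].
split; [lia |].
apply (no_turn_back h (pt a) (pt i) (pt j) (pt k)); auto; try (apply pt_sorted; lia).
intros c [<- | [<- | [<- | [<- | []]]]]; apply pt_strip; lia.
Qed.

Lemma chain_cons (i j k : nat) (l : list nat) :
  chain (j :: i :: l) -> j < k -> k < n -> far (pt j) (pt k) -> far (pt i) (pt k) ->
  chain (k :: j :: i :: l).
Proof.
intros C jk kn Fjk Fik.
split; [exact kn |]. split; [| exact C].
intros a [<- | [<- | Ha]]; [auto | | now apply (chain_far i j k l)].
split; [| exact Fik]. destruct C as [_ [Hjl _]]. specialize (Hjl i (or_introl eq_refl)). lia.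
Qed.

Lemma chain_swap (i j k : nat) (l : list nat) :
  chain (j :: i :: l) -> j < k -> k < n -> far (pt j) (pt k) -> chain (k :: j :: l).
Proof.
intros C jk kn Fjk. split; [exact kn |]. split.
- intros a [<- | Ha]; [auto | now apply (chain_far i j k l)].
- destruct C as [Hj [Hjl [_ [_ Hl]]]]. split; [exact Hj |]. split; [| exact Hl].
  intros a Ha. apply Hjl. now right.
Qed.

Lemma chain_two (j k : nat) : j < k -> k < n -> far (pt j) (pt k) -> chain [k; j].
Proof.
intros jk kn F. simpl. repeat split; try lia; intros; try contradiction;
  destruct H as [<- | []]; auto.
Qed.

Definition longest (j k v : nat) : Prop :=
  (exists l, chain (k :: j :: l) /\ S (S (length l)) = v) /\
  (forall l, chain (k :: j :: l) -> S (S (length l)) <= v).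

(** The value 0 marks near pairs. It is below every column maximum, so a near pair is never mistaken
    for one that attains it. *)
Definition entry (f : nat -> nat -> nat) (j k : nat) : Prop :=
  (far (pt j) (pt k) -> longest j k (f j k)) /\ (~ far (pt j) (pt k) -> f j k = 0).

Lemma chain_tail (k : nat) (l : list nat) : chain (k :: l) -> chain l.
Proof. now intros [_ [_ H]]. Qed.

Lemma chain_two_far (j k : nat) (l : list nat) :
  chain (k :: j :: l) -> j < k /\ k < n /\ far (pt j) (pt k).
Proof. intros [H1 [H2 _]]. destruct (H2 j); [now left | auto]. Qed.

(** The value 1 stands for the chain that consists of [j] alone. *)
Definition column_max (f : nat -> nat -> nat) (j F : nat) : Prop :=
  1 <= F /\ (forall i, i < j -> f i j <= F) /\ (F = 1 \/ exists i, i < j /\ f i j = F).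

Lemma column_max_chain (f : nat -> nat -> nat) (j F : nat) (l : list nat) :
  (forall i, i < j -> entry f i j) -> column_max f j F -> chain (j :: l) ->
  S (length l) <= F.
Proof.
intros He [F1 [Fub _]] C. destruct l as [| i l]; simpl; [lia |].
destruct (chain_two_far i j l C) as [ij [_ Fij]].
specialize (Fub i ij). destruct (He i ij) as [Hf _].
destruct (Hf Fij) as [_ Hub]. specialize (Hub l C). lia.
Qed.

(** Dropping [k] bounds the length from above. Conversely, an [i] attaining [F >= 1] is far from
    [j], and an optimal chain through [i] and [j] may be extended by [k]. *)
Lemma longest_succ (f : nat -> nat -> nat) (j k F : nat) :
  (forall i, i < j -> entry f i j) -> column_max f j F ->
  j < k -> k < n -> far (pt j) (pt k) ->
  F = 1 \/ (exists i, i < j /\ f i j = F /\ far (pt i) (pt k)) ->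
  longest j k (S F).
Proof.
intros He HF jk kn Fjk H. split.
- destruct H as [-> | [i [ij [Ef Fik]]]].
  + exists []. split; [now apply chain_two | reflexivity].
  + destruct (He i ij) as [Hf Hnf].
    destruct (Classical_Prop.classic (far (pt i) (pt j))) as [Fij | Nij].
    * destruct (Hf Fij) as [[l [C L]] _]. exists (i :: l).
      split; [now apply chain_cons | simpl; lia].
    * rewrite (Hnf Nij) in Ef. destruct HF. lia.
- intros l C. apply chain_tail in C.
  pose proof (column_max_chain f j F l He HF C). lia.
Qed.

(** Replacing [i] by [k] behind [j] in an optimal chain keeps its length. A chain of length [F + 1]
    would contain, just before [j], an [i] that attains [F] and is far from [k]. *)
Lemma longest_same (f : nat -> nat -> nat) (j k F : nat) :
  (forall i, i < j -> entry f i j) -> column_max f j F ->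
  j < k -> k < n -> far (pt j) (pt k) ->
  F <> 1 -> (forall i, i < j -> f i j = F -> ~ far (pt i) (pt k)) ->
  longest j k F.
Proof.
intros He HF jk kn Fjk F1 H. split.
- destruct HF as [F1' [Fub [E | [i [ij Ef]]]]]; [contradiction |].
  destruct (He i ij) as [Hf Hnf].
  destruct (Classical_Prop.classic (far (pt i) (pt j))) as [Fij | Nij].
  + destruct (Hf Fij) as [[l [C L]] _]. exists l. split; [now apply (chain_swap i) | lia].
  + rewrite (Hnf Nij) in Ef. lia.
- intros [| i l] C; simpl; [destruct HF; lia |].
  pose proof (column_max_chain f j F (i :: l) He HF (chain_tail _ _ C)) as K. simpl in K.
  destruct (Nat.eq_dec (S (S (length l))) F) as [E | E]; [exfalso | lia].
  destruct (chain_two_far _ _ _ (chain_tail _ _ C)) as [ij [_ Fij]].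
  apply (H i ij).
  + destruct HF as [_ [Fub _]]. specialize (Fub i ij).
    destruct (He i ij) as [Hf _]. destruct (Hf Fij) as [_ Hub].
    specialize (Hub l (chain_tail _ _ C)). lia.
  + destruct C as [_ [Hk _]]. apply Hk. right. now left.
Qed.

(** Lets the traceback ignore which case produced an entry. In an optimal chain [k :: j :: i :: l],
    dropping [k] gives [f i j >= v - 1]; and any chain ending with [i], [j] extends by [k], which
    gives [f i j <= v - 1]. *)
Lemma predecessor_exists (f : nat -> nat -> nat) (j k v : nat) :
  (forall i, i < j -> entry f i j) -> longest j k v -> 2 < v ->
  exists i, i < j /\ f i j = v - 1 /\ far (pt i) (pt k).
Proof.
intros He [[[| i l] [C L]] Hub] Hv; simpl in L; [lia |].
destruct (chain_two_far _ _ _ (chain_tail _ _ C)) as [ij [_ Fij]].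
assert (Fik : far (pt i) (pt k)) by (destruct C as [_ [Hk _]]; apply Hk; right; now left).
exists i. split; [exact ij |]. split; [| exact Fik].
destruct (He i ij) as [Hf _]. destruct (Hf Fij) as [[l' [C' L']] Hub'].
specialize (Hub' l (chain_tail _ _ C)).
destruct (chain_two_far _ _ _ C) as [jk [kn Fjk]].
specialize (Hub (i :: l') (chain_cons i j k l' C' jk kn Fjk Fik)). simpl in Hub. lia.
Qed.

(** * Lower envelopes over a band of ordinates *)

Context (lo hi : R).
Hypothesis lo_hi : (lo <= hi)%R.
Hypothesis narrow : (hi - lo <= 1)%R.
Hypothesis pt_band : forall i, i < n -> (lo <= snd (pt i) <= hi)%R.

(** Each arc is strictly lower at one border of the band, that of the higher center at the bottom;
    hence neither makes the other useless. *)
Definition linked (p q : nat) : Prop :=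
  p < n /\ q < n /\ (snd (pt p) <= snd (pt q))%R /\
  (arc (pt q) lo < arc (pt p) lo)%R /\ (arc (pt p) hi < arc (pt q) hi)%R.

(** The middle arc contributes to the envelope of the three. *)
Definition dips (p q s : nat) : Prop :=
  exists y, (lo <= y <= hi)%R /\ (arc (pt q) y < arc (pt p) y)%R /\
    (arc (pt q) y < arc (pt s) y)%R.

(** The arcs of a lower envelope; from the head on, their centers go down and
    their parts of the envelope go up. *)
Fixpoint envelope (l : list nat) : Prop :=
  match l with
  | [] => True
  | q :: l' => q < n /\ envelope l' /\
      match l' with
      | [] => True
      | p :: l'' => linked p q /\
          match l'' with
          | [] => True
          | o :: _ => dips o p q
          end
      end
  end.

Definition covers (l : list nat) (i : nat) : Prop :=
  forall y, (lo <= y <= hi)%R -> exists c, In c l /\ (arc (pt c) y <= arc (pt i) y)%R.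

Lemma gap_mono (p q : nat) (y y' : R) :
  p < n -> q < n -> (snd (pt p) <= snd (pt q))%R -> (lo <= y)%R -> (y <= y')%R -> (y' <= hi)%R ->
  (arc (pt q) y - arc (pt p) y <= arc (pt q) y' - arc (pt p) y')%R.
Proof.
intros Hp Hq pq Ly yy' Lh. pose proof (pt_band p Hp). pose proof (pt_band q Hq).
apply arc_gap_increasing; lra.
Qed.

(** Take an ordinate [z] where the arc of [p] dips below its two neighbors. As [q] is below [p] at
    [y] but above it at [z], monotonicity of the gap puts [y] before [z]; then [p], below [o] at
    [z], is below [o] at [y] too, and the induction goes on. *)
Lemma envelope_head_lowest (l : list nat) :
  forall q p y, envelope (q :: p :: l) -> (lo <= y <= hi)%R ->
  (arc (pt q) y < arc (pt p) y)%R ->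
  forall c, In c (p :: l) -> (arc (pt q) y < arc (pt c) y)%R.
Proof.
induction l as [| o l IH]; intros q p y E Hy Hqp c Hc.
- destruct Hc as [<- | []]. exact Hqp.
- destruct Hc as [<- | Hc]; [exact Hqp |].
  destruct E as [Hq [E [[Lp [Lq [pq _]]] [z [Hz [D1 D2]]]]]].
  assert (E' := E). destruct E as [Hp [_ [[Lo [_ [op _]]] _]]].
  assert (yz : (y <= z)%R).
  { apply Rnot_lt_le. intros zy.
    pose proof (gap_mono p q z y Lp Lq pq ltac:(lra) ltac:(lra) ltac:(lra)). lra. }
  pose proof (gap_mono o p y z Lo Lp op ltac:(lra) yz ltac:(lra)).
  specialize (IH p o y E' Hy ltac:(lra) c Hc). lra.
Qed.

Lemma covers_trans (l l' : list nat) (i : nat) :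
  (forall c, In c l -> covers l' c) -> covers l i -> covers l' i.
Proof.
intros Hl Hi y Hy. destruct (Hi y Hy) as [c [Hc Lc]].
destruct (Hl c Hc y Hy) as [d [Hd Ld]]. exists d. split; [exact Hd | lra].
Qed.

Lemma covers_in (l : list nat) (i : nat) : In i l -> covers l i.
Proof. intros Hi y Hy. exists i. split; [exact Hi | lra]. Qed.

(** The gap between the two arcs increases, so a nonnegative sign at the bottom persists over the
    whole band. The next lemma is its mirror image. *)
Lemma covers_below (q s : nat) (l : list nat) :
  q < n -> s < n -> (snd (pt q) <= snd (pt s))%R -> In q l ->
  (arc (pt q) lo <= arc (pt s) lo)%R -> covers l s.
Proof.
intros Hq Hs qs Hl L y Hy. exists q. split; [exact Hl |].
pose proof (gap_mono q s lo y Hq Hs qs ltac:(lra) ltac:(lra) ltac:(lra)). lra.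
Qed.

Lemma covers_above (q s : nat) (l : list nat) :
  q < n -> s < n -> (snd (pt q) <= snd (pt s))%R -> In s l ->
  (arc (pt s) hi <= arc (pt q) hi)%R -> covers l q.
Proof.
intros Hq Hs qs Hl L y Hy. exists s. split; [exact Hl |].
pose proof (gap_mono q s y hi Hq Hs qs ltac:(lra) ltac:(lra) ltac:(lra)). lra.
Qed.

(** Below the crossing of the outer arcs, [s] stays under [q]; above it, [p] does. *)
Lemma covers_middle (p q s : nat) (l : list nat) (y : R) :
  p < n -> q < n -> s < n -> (snd (pt p) <= snd (pt q))%R -> (snd (pt q) <= snd (pt s))%R ->
  In p l -> In s l -> (lo <= y <= hi)%R ->
  arc (pt p) y = arc (pt s) y -> (arc (pt p) y <= arc (pt q) y)%R -> covers l q.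
Proof.
intros Hp Hq Hs pq qs Ip Is Hy E L z Hz.
destruct (Rle_lt_dec z y) as [zy | yz].
- exists s. split; [exact Is |].
  pose proof (gap_mono q s z y Hq Hs qs ltac:(lra) ltac:(lra) ltac:(lra)). lra.
- exists p. split; [exact Ip |].
  pose proof (gap_mono p q y z Hp Hq pq ltac:(lra) ltac:(lra) ltac:(lra)). lra.
Qed.

End Chains.

(** * Sorting *)

Notation "c1 ;; c2" := (Seq c1 c2) (at level 61, right associativity).
Infix "+i" := (IBin IAdd) (at level 50, left associativity).
Infix "-i" := (IBin ISub) (at level 50, left associativity).
Infix "*i" := (IBin IMul) (at level 40, left associativity).
Infix "+r" := (RBin RAdd) (at level 50, left associativity).
Infix "-r" := (RBin RSub) (at level 50, left associativity).
Infix "*r" := (RBin RMul) (at level 40, left associativity).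
Notation "! x" := (IVar x) (at level 8, x at level 0, format "! x").
Notation "$ k" := (INum k) (at level 8, k at level 0, format "$ k").

(** The integer variables of the program; [v_n] is the input and output register. *)
Definition v_n : nat := 0.
Definition v_a : nat := 1.
Definition v_b : nat := 2.
Definition v_rank : nat := 3.
Definition v_off : nat := 4.
Definition v_stride : nat := 5.
Definition v_base : nat := 6.
Definition v_j : nat := 7.
Definition v_max : nat := 8.
Definition v_t : nat := 9.
Definition v_top : nat := 10.
Definition v_s : nat := 11.
Definition v_q : nat := 12.
Definition v_p : nat := 13.
Definition v_i : nat := 14.
Definition v_best : nat := 15.
Definition v_k : nat := 16.
Definition v_count : nat := 17.

Definition key_of (x : nat) : rexp := RGet (!v_off +i !v_stride *i !x).
Definition incr (x : nat) : cmd := SetI x (!x +i $1).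

(** Writes at [v_base] the indices of the keys in increasing order; the place
    of an index is the number of its predecessors, ties being broken by index. *)
Definition rank_sort : cmd :=
  For v_a v_n (
    SetI v_rank $0 ;;
    For v_b v_n (
      If (ILe (!v_b +i $1) !v_a)
        (If (RLe (key_of v_b) (key_of v_a)) (incr v_rank) Skip)
        (If (RLe (key_of v_a) (key_of v_b)) Skip (incr v_rank))) ;;
    PutI (!v_base +i !v_rank) !v_a).

Definition sorts (key : nat -> R) (N : nat) (o : nat -> nat) : Prop :=
  (forall r, r < N -> o r < N) /\
  (forall r r', r < r' -> r' < N -> o r <> o r') /\
  (forall r r', r <= r' -> r' < N -> (key (o r) <= key (o r'))%R) /\
  (forall a, a < N -> exists r, r < N /\ o r = a).

Section Rank.

Context (key : nat -> R) (N : nat).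

(** A strict total order on indices, written with the very tests of the program; breaking ties by
    index makes the ranks distinct. *)
Definition before (b a : nat) : bool :=
  if b + 1 <=? a then (if Rle_dec (key b) (key a) then true else false)
  else (if Rle_dec (key a) (key b) then false else true).

Definition rank_in (M a : nat) : nat := length (filter (fun b => before b a) (seq 0 M)).

Lemma before_spec (b a : nat) :
  before b a = true <-> (key b < key a)%R \/ (key b = key a /\ b < a).
Proof.
unfold before. destruct (Nat.leb_spec (b + 1) a); destruct (Rle_dec _ _) as [L | L];
  split; intros K; try discriminate; try reflexivity;
  try (destruct K as [K | [K K']]; lra || lia); try lra.
destruct (Req_dec (key b) (key a)); [right | left]; lra || (split; [assumption | lia]).
Qed.

Lemma before_irrefl (a : nat) : before a a = false.
Proof.
destruct (before a a) eqn:E; [| reflexivity]. rewrite before_spec in E.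
destruct E as [E | [_ E]]; lra || lia.
Qed.

Lemma filter_length_lt (f g : nat -> bool) (x : nat) (l : list nat) :
  (forall y, In y l -> f y = true -> g y = true) -> In x l -> f x = false -> g x = true ->
  length (filter f l) < length (filter g l).
Proof.
intros Hfg Hx Fx Gx. induction l as [| a l IH]; [contradiction |].
assert (le : forall l', incl l' (a :: l) -> length (filter f l') <= length (filter g l')).
{ induction l' as [| y l' IH']; intros Hi; [reflexivity |]. simpl.
  specialize (IH' (fun z Hz => Hi z (or_intror Hz))).
  destruct (f y) eqn:Fy; [rewrite (Hfg y (Hi y (or_introl eq_refl)) Fy); simpl; lia |].
  destruct (g y); simpl; lia. }
destruct Hx as [<- | Hx].
- simpl. rewrite Fx, Gx. simpl. specialize (le l (fun z Hz => or_intror Hz)). lia.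
- specialize (IH (fun y Hy => Hfg y (or_intror Hy)) Hx). simpl.
  destruct (f a) eqn:Fa; [rewrite (Hfg a (or_introl eq_refl) Fa); simpl; lia |].
  destruct (g a); simpl; lia.
Qed.

Lemma rank_lt (a b : nat) : a < N -> before a b = true -> rank_in N a < rank_in N b.
Proof.
intros Ha Hab. apply (filter_length_lt _ _ a).
- intros y _ Hy. rewrite before_spec in *.
  destruct Hy as [Hy | [Hy Hy']], Hab as [K | [K K']];
    [left; lra | left; lra | left; lra | right; split; [lra | lia]].
- apply in_seq. lia.
- now apply before_irrefl.
- exact Hab.
Qed.

Lemma rank_bound (a : nat) : a < N -> rank_in N a < N.
Proof.
intros Ha. unfold rank_in. rewrite <- (length_seq N 0) at 2.
rewrite <- (forallb_filter_id (fun _ => true) (seq 0 N)) at 2 by now apply forallb_forall.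
apply (filter_length_lt _ _ a); auto; [apply in_seq; lia | apply before_irrefl].
Qed.

Lemma rank_trichotomy (a b : nat) : a = b \/ before a b = true \/ before b a = true.
Proof.
rewrite !before_spec. destruct (Rtotal_order (key a) (key b)) as [H | [H | H]]; auto.
destruct (Nat.lt_total a b) as [K | [K | K]]; auto.
Qed.

(** Ranks are pairwise distinct and below [N], so by the pigeonhole principle every place is
    taken. *)
Lemma rank_sorts (o : nat -> nat) :
  (forall a, a < N -> o (rank_in N a) = a) -> sorts key N o.
Proof.
intros Ho.
assert (inj : forall a b, a < N -> b < N -> rank_in N a = rank_in N b -> a = b).
{ intros a b Ha Hb E. rewrite <- (Ho a Ha), <- (Ho b Hb). now rewrite E. }
assert (surj : forall r, r < N -> exists a, a < N /\ rank_in N a = r).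
{ intros r Hr.
  assert (I : incl (seq 0 N) (map (rank_in N) (seq 0 N))).
  { apply NoDup_length_incl.
    - apply NoDup_map_NoDup_ForallPairs; [| apply seq_NoDup].
      intros a b Ha Hb. apply in_seq in Ha, Hb. apply inj; lia.
    - now rewrite length_map.
    - intros x Hx. apply in_map_iff in Hx as [a [<- Ha]]. apply in_seq in Ha.
      apply in_seq. pose proof (rank_bound a). lia. }
  specialize (I r ltac:(apply in_seq; lia)). apply in_map_iff in I as [a [E Ha]].
  apply in_seq in Ha. exists a. split; [lia | exact E]. }
split; [| split; [| split]].
- intros r Hr. destruct (surj r Hr) as [a [Ha <-]]. now rewrite Ho.
- intros r r' L Hr'. destruct (surj r' Hr') as [a' [Ha' <-]].
  destruct (surj r ltac:(lia)) as [a [Ha <-]]. rewrite !Ho by assumption.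
  intros ->. lia.
- intros r r' L Hr'. destruct (surj r' Hr') as [a' [Ha' <-]].
  destruct (surj r ltac:(lia)) as [a [Ha <-]]. rewrite !Ho by assumption.
  destruct (rank_trichotomy a a') as [-> | [E | E]]; [lra | | ].
  + rewrite before_spec in E. destruct E; lra.
  + pose proof (rank_lt a' a Ha' E). lia.
- intros a Ha. exists (rank_in N a). split; [now apply rank_bound | now apply Ho].
Qed.

Lemma rank_in_succ (M a : nat) :
  rank_in (S M) a = if before M a then S (rank_in M a) else rank_in M a.
Proof.
unfold rank_in. rewrite seq_S, filter_app, length_app. simpl.
destruct (before M a); simpl; lia.
Qed.

Lemma rank_in_le (M a : nat) : rank_in M a <= M.
Proof.
unfold rank_in. etransitivity; [apply filter_length_le | now rewrite length_seq].
Qed.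

End Rank.

Ltac simpl_store :=
  cbn [wp test_safe holds isafe rsafe ieval reval int_eval incr
       set_ivar put_imem put_rmem ivar imem_of rmem_of update Nat.eqb
       v_n v_a v_b v_rank v_off v_stride v_base
       v_j v_max v_t v_top v_s v_q v_p v_i v_best v_k v_count] in *.

Ltac splits := repeat match goal with |- _ /\ _ => split end.

Ltac cost := apply Nat.leb_le; vm_compute; reflexivity.

(** Offset, stride and base are parameters because the routine runs twice: on the interleaved input
    coordinates, then on the copied array of ordinates. *)
Lemma rank_sort_runs (m N ko ks bo : nat) (u : store) :
  N + 1 <= m -> ko + ks * N <= m -> bo + N <= m -> 0 < ks ->
  ivar u v_n = N -> ivar u v_off = ko -> ivar u v_stride = ks -> ivar u v_base = bo ->
  runs m rank_sort u ((N + 1) * ((N + 1) * 100 + 50)) (fun v =>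
    rmem_of v = rmem_of u /\ ivar v v_n = N /\
    (forall a, a < bo \/ bo + N <= a -> imem_of v a = imem_of u a) /\
    sorts (fun b => rmem_of u (ko + ks * b)) N (fun r => imem_of v (bo + r))).
Proof.
intros Hm Hk Hb ks0 En Ek Es Eb.
set (key := fun b => rmem_of u (ko + ks * b)).
assert (ksle : forall b, b < N -> ks * b < ks * N) by (intros; nia).
set (fixed := fun v : store => rmem_of v = rmem_of u /\ ivar v v_n = N /\
  ivar v v_off = ko /\ ivar v v_stride = ks /\ ivar v v_base = bo /\
  (forall a, a < bo \/ bo + N <= a -> imem_of v a = imem_of u a)).
eapply runs_weaken; [| intros v Hv; exact Hv |
  apply (runs_for m v_a v_n N _ (2 + ((N + 1) * (80 + 20) + 20))
    (fun a v => fixed v /\ ivar v v_a = a /\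
       forall c, c < a -> imem_of v (bo + rank_in key N c) = c))].
- nia.
- exact Hm.
- intros a v [F [E _]]. split; [exact E | apply F].
- intros a v Ha [F [E Hr]].
  apply runs_seq. apply (runs_set_ivar m v_rank $0); [simpl; lia |].
  apply runs_seq.
  apply (runs_for m v_b v_n N _ 80 (fun b w => fixed w /\ ivar w v_a = a /\ ivar w v_b = b /\
    ivar w v_rank = rank_in key b a /\ forall c, c < a -> imem_of w (bo + rank_in key N c) = c)).
  + exact Hm.
  + intros b w [F' [_ [E' _]]]. split; [exact E' | apply F'].
  + intros b w Hbn [[F1 [F2 [F3 [F4 [F5 F6]]]]] [E1 [E2 [E3 E4]]]].
    pose proof (ksle b Hbn). pose proof (ksle a Ha). pose proof (rank_in_le key b a).
    eapply runs_weaken; [| intros w' Hw'; exact Hw' | apply runs_wp].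
    * cost.
    * assert (K : forall x c, ivar w x = c -> c < N ->
        rsafe m w (key_of x) /\ reval w (key_of x) = key c).
      { intros x c Ex Hc. pose proof (ksle c Hc). unfold key_of. simpl_store.
        rewrite Ex, F1, F3, F4. unfold key. split; [splits; auto; lia | reflexivity]. }
      destruct (K v_a a E1 Ha) as [Sa Va]. destruct (K v_b b E2 Hbn) as [Sb Vb].
      unfold fixed. simpl_store. rewrite ?F1, ?F2, ?F3, ?F4, ?F5, ?E1, ?E2, ?E3, ?Va, ?Vb.
      rewrite rank_in_succ. unfold before.
      destruct (Nat.leb_spec (b + 1) a); destruct (Rle_dec _ _);
        splits; intros; splits; intros; splits; auto; lia || contradiction.
  + split; [exact F |]. simpl_store. auto.
  + intros w [[F1 [F2 [F3 [F4 [F5 F6]]]]] [E1 [E2 [E3 E4]]]].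
    assert (rb := rank_bound key N a Ha).
    eapply runs_weaken; [| intros w' Hw'; exact Hw' | apply runs_wp].
    * cost.
    * unfold fixed. simpl_store. rewrite ?F1, ?F2, ?F3, ?F4, ?F5, ?E1, ?E2, ?E3.
      splits; auto; try lia.
      -- intros c Hc. rewrite update_neq by lia. now apply F6.
      -- intros c Hc. destruct (Nat.eq_dec c a) as [-> | Hca]; [apply update_eq |].
         rewrite update_neq; [apply E4; lia |].
         (* Two indices written to the same cell would have equal ranks, which trichotomy
            excludes. *)
         intros E5.
         destruct (rank_trichotomy key c a) as [K | [K | K]]; [contradiction | |].
         ++ pose proof (rank_lt key N c a ltac:(lia) K). lia.
         ++ pose proof (rank_lt key N a c ltac:(lia) K). lia.
- split; [unfold fixed; simpl_store; auto 10 |]. simpl_store. split; [reflexivity | intros; lia].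
- intros v [[F1 [F2 [F3 [F4 [F5 F6]]]]] [E Hr]]. splits; auto.
  now apply rank_sorts.
Qed.

(** * The table of chain lengths *)

(** With [n] disks, the integer memory holds the answer from cell 0, a stack
    from cell [n], the positions by ordinate from cell [2n], the input indices
    by position from cell [3n], and an [n * n] table from cell [4n]; the real
    memory holds the abscissas by position from cell [2n] and the ordinates
    from cell [3n].  Positions are the ranks by abscissa. *)
Definition px (x : nat) : rexp := RGet ($2 *i !v_n +i !x).
Definition py (x : nat) : rexp := RGet ($3 *i !v_n +i !x).
Definition by_ordinate (e : iexp) : iexp := IGet ($2 *i !v_n +i e).
Definition by_position (e : iexp) : iexp := IGet ($3 *i !v_n +i e).
Definition cell (x y : nat) : iexp := $4 *i !v_n +i !x *i !v_n +i !y.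
Definition stack (e : iexp) : iexp := IGet (!v_n +i e).
Definition lowest : rexp := RGet ($3 *i !v_n +i by_ordinate $0).
Definition highest : rexp := RGet ($3 *i !v_n +i by_ordinate (!v_n -i $1)).
Definition sq (e : rexp) : rexp := e *r e.

Definition if_near (x y : nat) (c1 c2 : cmd) : cmd :=
  If (RLe (sq (px x -r px y) +r sq (py x -r py y)) (RNum 1)) c1 c2.

(** Compares [px x + sqrt a] with [px z + sqrt b] by squaring twice. *)
Definition if_arc_le (x z : nat) (y : rexp) (c1 c2 : cmd) : cmd :=
  let c := px x -r px z in
  let a := RNum 1 -r sq (y -r py x) in
  let b := RNum 1 -r sq (y -r py z) in
  let d := b -r a -r sq c in
  let e := a -r b -r sq c in
  If (RLe (RNum 0) c)
    (If (RLe (RNum 0) d)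
      (If (RLe (RNum 4 *r sq c *r a) (sq d)) c1 c2)
      c2)
    (If (RLe e (RNum 0))
      c1
      (If (RLe (sq e) (RNum 4 *r sq c *r b)) c1 c2)).

(** By [crossing_below_arc], asks whether [u <= w * v] for the number [w >= 0]
    such that [w ^ 2 * d = 4 - d]. *)
Definition if_middle_useless (p q s : nat) (c1 c2 : cmd) : cmd :=
  let dx := px s -r px p in
  let dy := py s -r py p in
  let d := sq dx +r sq dy in
  let u := (px q -r px p) *r (px q -r px s) +r (py q -r py p) *r (py q -r py s) in
  let v := (px q -r px p) *r dy -r (py q -r py p) *r dx in
  let u2 := d *r sq u in
  let v2 := (RNum 4 -r d) *r sq v in
  If (RLe u (RNum 0))
    (If (RLe (RNum 0) v) c1 (If (RLe v2 u2) c1 c2))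
    (If (RLe v (RNum 0)) c2 (If (RLe u2 v2) c1 c2)).

Definition value (x y : nat) : iexp := IGet (cell x y).
Definition next : cmd := incr v_t.

Definition column_max_body : cmd :=
  If (ILe (!v_i +i $1) !v_j)
    (If (ILe (value v_i v_j) !v_max) Skip (SetI v_max (value v_i v_j)))
    Skip.

Definition column_max_loop : cmd := SetI v_max $1 ;; For v_i v_n column_max_body.

Definition push : cmd := PutI (!v_n +i !v_top) !v_s ;; incr v_top ;; next.
Definition pop : cmd := SetI v_top (!v_top -i $1).

(** The three geometric tests correspond to [covers_below], [covers_above] and [covers_middle]; if
    none applies, pushing [s] preserves the envelope. A pop leaves [v_t] unchanged, so the same arc
    is tried again in the next round. *)
Definition insert : cmd :=
  If (ILe !v_top $0)
    push
    (SetI v_q (stack (!v_top -i $1)) ;;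
     if_arc_le v_q v_s lowest
       next
       (if_arc_le v_s v_q highest
         pop
         (If (ILe !v_top $1)
           push
           (SetI v_p (stack (!v_top -i $2)) ;;
            if_middle_useless v_p v_q v_s pop push)))).

Definition envelope_body : cmd :=
  SetI v_s (by_ordinate !v_t) ;;
  If (ILe (!v_s +i $1) !v_j)
    (If (ILe (value v_s v_j) !v_max) (If (ILe !v_max (value v_s v_j)) insert next) next)
    next.

Definition envelope_loop : cmd :=
  SetI v_top $0 ;; SetI v_t $0 ;; While (ILe (!v_t +i $1) !v_n) envelope_body.

Definition set_same : cmd := PutI (cell v_j v_s) !v_max ;; next.
Definition set_succ : cmd := PutI (cell v_j v_s) (!v_max +i $1) ;; next.
Definition decide : cmd := if_near v_q v_s set_same set_succ.

(** The top of the stack has the lowest part of the envelope, so popping it moves the pointer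
    upwards, in step with the increasing ordinates of the points [k]. *)
Definition row_body : cmd :=
  SetI v_s (by_ordinate !v_t) ;;
  If (ILe !v_s !v_j)
    next
    (if_near v_j v_s
      (PutI (cell v_j v_s) $0 ;; next)
      (If (ILe !v_top $0)
        set_succ
        (SetI v_q (stack (!v_top -i $1)) ;;
         If (ILe !v_top $1)
           decide
           (SetI v_p (stack (!v_top -i $2)) ;;
            if_arc_le v_p v_q (py v_s) pop decide)))).

Definition row_loop : cmd :=
  SetI v_t $0 ;; While (ILe (!v_t +i $1) !v_n) row_body.

Definition table_body : cmd := column_max_loop ;; envelope_loop ;; row_loop.
Definition table_loop : cmd := For v_j v_n table_body.

Definition best_body : cmd :=
  If (ILe (!v_i +i $1) !v_k)
    (If (ILe (value v_i v_k) !v_best)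
      Skip
      (SetI v_best (value v_i v_k) ;; SetI v_p !v_i ;; SetI v_q !v_k))
    Skip.
Definition best_loop : cmd := SetI v_best $1 ;; For v_i v_n (For v_k v_n best_body).

Definition search_body : cmd :=
  If (ILe (!v_i +i $1) !v_p)
    (If (ILe (value v_i v_p) (!v_best -i $1))
      (If (ILe (!v_best -i $1) (value v_i v_p))
        (if_near v_i v_q Skip (SetI v_s !v_i))
        Skip)
      Skip)
    Skip.

Definition trace_step : cmd :=
  PutI !v_count (by_position !v_s) ;; incr v_count ;;
  SetI v_q !v_p ;; SetI v_p !v_s ;; SetI v_best (!v_best -i $1).
Definition trace_start : cmd :=
  PutI $0 (by_position !v_q) ;; PutI $1 (by_position !v_p) ;; SetI v_count $2.
Definition trace : cmd :=
  trace_start ;;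
  While (ILe $3 !v_best) (For v_i v_n search_body ;; trace_step) ;;
  SetI v_n !v_count.
Definition single : cmd := PutI $0 (by_position $0) ;; SetI v_n $1.
Definition answer : cmd :=
  If (ILe !v_n $0) Skip (If (ILe !v_best $1) single trace).

(** * Memory layout and correctness of the geometric tests *)

Section Layout.

Context (m N : nat) (h : R) (pt : nat -> point) (yo xo : nat -> nat).
Hypothesis room : 4 * N + N * N + 10 <= m.
Hypothesis pt_sorted : forall i j, i <= j -> j < N -> (fst (pt i) <= fst (pt j))%R.
Hypothesis pt_strip : forall i, i < N -> (h - 1 / 2 <= snd (pt i) <= h + 1 / 2)%R.
Hypothesis yo_sorts : sorts (fun p => snd (pt p)) N yo.

(** The part of the memory that stays fixed while the table is computed: [yo] lists positions by
    ordinate, [xo] gives input indices by position. Answer and stack lie below cell [2 * N], the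
    table from [4 * N] on. *)
Record layout (u : store) : Prop := {
  layout_n : ivar u v_n = N;
  layout_x : forall p, p < N -> rmem_of u (2 * N + p) = fst (pt p);
  layout_y : forall p, p < N -> rmem_of u (3 * N + p) = snd (pt p);
  layout_yo : forall t, t < N -> imem_of u (2 * N + t) = yo t;
  layout_xo : forall t, t < N -> imem_of u (3 * N + t) = xo t
}.

Lemma layout_frame (u v : store) :
  layout u -> ivar v v_n = N -> rmem_of v = rmem_of u ->
  (forall a, 2 * N <= a < 4 * N -> imem_of v a = imem_of u a) -> layout v.
Proof.
intros [] En Er Ei. split; [exact En | | | |]; intros p Hp; rewrite ?Er; auto;
  rewrite Ei by lia; auto.
Qed.

Lemma px_correct (u : store) (x : nat) : layout u -> ivar u x < N ->
  rsafe m u (px x) /\ reval u (px x) = fst (pt (ivar u x)).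
Proof.
intros L Hx. unfold px. simpl_store.
rewrite (layout_n u L), (layout_x u L) by exact Hx. splits; auto; lia.
Qed.

Lemma py_correct (u : store) (x : nat) : layout u -> ivar u x < N ->
  rsafe m u (py x) /\ reval u (py x) = snd (pt (ivar u x)).
Proof.
intros L Hx. unfold py. simpl_store.
rewrite (layout_n u L), (layout_y u L) by exact Hx. splits; auto; lia.
Qed.

Lemma yo_lt (t : nat) : t < N -> yo t < N.
Proof. apply yo_sorts. Qed.

Lemma yo_mono (t t' : nat) : t <= t' -> t' < N -> (snd (pt (yo t)) <= snd (pt (yo t')))%R.
Proof. apply yo_sorts. Qed.

Lemma by_ordinate_correct (u : store) (e : iexp) : layout u -> isafe m u e -> ieval u e < N ->
  isafe m u (by_ordinate e) /\ ieval u (by_ordinate e) = yo (ieval u e).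
Proof.
intros L Se He. unfold by_ordinate. simpl_store.
rewrite (layout_n u L), (layout_yo u L) by exact He. splits; auto; lia.
Qed.

Let lo := snd (pt (yo 0)).
Let hi := snd (pt (yo (N - 1))).

Lemma lowest_correct (u : store) : layout u -> 0 < N -> rsafe m u lowest /\ reval u lowest = lo.
Proof.
intros L HN.
destruct (by_ordinate_correct u $0 L) as [S E]; [simpl; lia | simpl; lia |].
simpl ieval in E at 2. assert (H := yo_lt 0 HN).
unfold lowest. simpl_store. rewrite E, (layout_n u L), (layout_y u L) by assumption. splits; auto; lia.
Qed.

Lemma highest_correct (u : store) : layout u -> 0 < N -> rsafe m u highest /\ reval u highest = hi.
Proof.
intros L HN.
assert (E1 : ieval u (!v_n -i $1) = N - 1) by (simpl; now rewrite <- (layout_n u L)).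
destruct (by_ordinate_correct u (!v_n -i $1) L) as [S E];
  [simpl; rewrite (layout_n u L); lia | rewrite E1; lia |].
rewrite E1 in E. assert (H := yo_lt (N - 1) ltac:(lia)).
unfold highest. simpl_store. rewrite E, (layout_n u L), (layout_y u L) by assumption. splits; auto; lia.
Qed.

Lemma band_narrow : 0 < N -> (hi - lo <= 1)%R.
Proof.
intros HN. pose proof (pt_strip (yo 0) (yo_lt 0 HN)).
pose proof (pt_strip (yo (N - 1)) (yo_lt (N - 1) ltac:(lia))). unfold lo, hi. lra.
Qed.

Lemma band_lo_hi : 0 < N -> (lo <= hi)%R.
Proof. intros HN. apply yo_mono; lia. Qed.

Lemma pt_band (i : nat) : i < N -> (lo <= snd (pt i) <= hi)%R.
Proof.
intros Hi. destruct yo_sorts as [_ [_ [_ surj]]]. destruct (surj i Hi) as [t [Ht <-]].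
split; apply yo_mono; lia.
Qed.

Lemma wp_if_near (x y : nat) (c1 c2 : cmd) (Q : store -> Prop) (u : store) :
  layout u -> ivar u x < N -> ivar u y < N ->
  (~ far (pt (ivar u x)) (pt (ivar u y)) -> wp m c1 Q u) ->
  (far (pt (ivar u x)) (pt (ivar u y)) -> wp m c2 Q u) ->
  wp m (if_near x y c1 c2) Q u.
Proof.
intros L Hx Hy H1 H2. unfold if_near, sq. cbn [wp test_safe rsafe holds reval].
destruct (px_correct u x L Hx) as [Sx ->]. destruct (px_correct u y L Hy) as [Sx' ->].
destruct (py_correct u x L Hx) as [Sy ->]. destruct (py_correct u y L Hy) as [Sy' ->].
split; [tauto |]. unfold far in *. split; intros H; [apply H1 | apply H2]; lra.
Qed.

(** The tested ordinate and both centers lie in a band of height at most 1, so the two radicands are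
    nonnegative and the root comparisons apply. *)
Lemma wp_if_arc_le (x z : nat) (y : rexp) (c1 c2 : cmd) (Q : store -> Prop) (u : store) :
  layout u -> ivar u x < N -> ivar u z < N -> rsafe m u y -> (lo <= reval u y <= hi)%R ->
  ((arc (pt (ivar u x)) (reval u y) <= arc (pt (ivar u z)) (reval u y))%R -> wp m c1 Q u) ->
  ((arc (pt (ivar u z)) (reval u y) < arc (pt (ivar u x)) (reval u y))%R -> wp m c2 Q u) ->
  wp m (if_arc_le x z y c1 c2) Q u.
Proof.
intros L Hx Hz Sy Hy H1 H2. unfold if_arc_le, sq. cbn [wp test_safe rsafe holds reval].
destruct (px_correct u x L Hx) as [Sx ->]. destruct (px_correct u z L Hz) as [Sx' ->].
destruct (py_correct u x L Hx) as [Sy1 ->]. destruct (py_correct u z L Hz) as [Sy' ->].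
pose proof (band_narrow ltac:(lia)) as W.
pose proof (pt_band _ Hx) as Bx. pose proof (pt_band _ Hz) as Bz.
set (Y := reval u y) in *. set (a := pt (ivar u x)) in *. set (b := pt (ivar u z)) in *.
assert (PA : (0 <= 1 - (Y - snd a) ^ 2)%R) by nra.
assert (PB : (0 <= 1 - (Y - snd b) ^ 2)%R) by nra.
assert (E : (arc a Y <= arc b Y <->
  (fst a - fst b) + sqrt (1 - (Y - snd a) ^ 2) <= sqrt (1 - (Y - snd b) ^ 2))%R)
  by (unfold arc; lra).
assert (H2' : ~ ((fst a - fst b) + sqrt (1 - (Y - snd a) ^ 2) <= sqrt (1 - (Y - snd b) ^ 2))%R ->
  wp m c2 Q u) by (intros K; apply H2; apply Rnot_le_lt; tauto).
rewrite E in H1. clear E H2.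
split; [tauto |]. split; intros C.
- rewrite (add_sqrt_le_nonneg _ _ _ C PA PB) in H1, H2'.
  split; [tauto |]. split; intros C1.
  + split; [tauto |]. split; intros C2; [apply H1 | apply H2'; intros [_ K]; apply C2]; [split |]; lra.
  + apply H2'. intros [K _]. apply C1. lra.
- rewrite (add_sqrt_le_neg _ _ _ (Rnot_le_lt _ _ C) PA PB) in H1, H2'.
  split; [tauto |]. split; intros C1.
  + apply H1. left. lra.
  + split; [tauto |]. split; intros C2; [apply H1; right; lra |].
    apply H2'. intros [K | K]; [apply C1 | apply C2]; lra.
Qed.

Lemma wp_if_middle_useless (p q s : nat) (c1 c2 : cmd) (Q : store -> Prop) (u : store) :
  layout u -> ivar u p < N ->
  linked N pt lo hi (ivar u p) (ivar u q) -> linked N pt lo hi (ivar u q) (ivar u s) ->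
  (forall y, (lo <= y <= hi)%R -> arc (pt (ivar u p)) y = arc (pt (ivar u s)) y ->
    (arc (pt (ivar u p)) y <= arc (pt (ivar u q)) y)%R -> wp m c1 Q u) ->
  (dips pt lo hi (ivar u p) (ivar u q) (ivar u s) -> wp m c2 Q u) ->
  wp m (if_middle_useless p q s c1 c2) Q u.
Proof.
intros L Hp [_ [Hq [pq [pq_lo pq_hi]]]] [_ [Hs [qs [qs_lo qs_hi]]]] H1 H2.
unfold if_middle_useless, sq. cbn [wp test_safe rsafe holds reval].
destruct (px_correct u p L Hp) as [Sx1 ->]. destruct (px_correct u q L Hq) as [Sx2 ->].
destruct (px_correct u s L Hs) as [Sx3 ->].
destruct (py_correct u p L Hp) as [Sy1 ->]. destruct (py_correct u q L Hq) as [Sy2 ->].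
destruct (py_correct u s L Hs) as [Sy3 ->].
pose proof (band_narrow ltac:(lia)) as W.
pose proof (pt_band _ Hp). pose proof (pt_band _ Hs).
destruct (crossing_below_arc (pt (ivar u p)) (pt (ivar u q)) (pt (ivar u s)) lo hi)
  as [y [K [Hy [cross [HD [HK [EK test]]]]]]]; try assumption; try lra.
set (a := pt (ivar u p)) in *. set (b := pt (ivar u q)) in *. set (c := pt (ivar u s)) in *.
rewrite (le_mul_root_iff _ _ K _ HD HK EK) in test.
specialize (H1 y Hy cross).
assert (H2' : ~ (arc a y <= arc b y)%R -> wp m c2 Q u).
(* The outer arcs coincide at [y], so an arc strictly below one of them there is below both. *)
{ intros C. apply H2. exists y. fold a b c. split; [exact Hy |]. split; lra. }
clear H2. rewrite test in H1, H2'. clear test.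
set (U := ((fst b - fst a) * (fst b - fst c) + (snd b - snd a) * (snd b - snd c))%R) in *.
set (V := ((fst b - fst a) * (snd c - snd a) - (snd b - snd a) * (fst c - fst a))%R) in *.
replace (((fst c - fst a) * (fst c - fst a) + (snd c - snd a) * (snd c - snd a)) * (U * U))%R
  with (((fst c - fst a) ^ 2 + (snd c - snd a) ^ 2) * U ^ 2)%R by ring.
replace ((4 - ((fst c - fst a) * (fst c - fst a) + (snd c - snd a) * (snd c - snd a))) * (V * V))%R
  with ((4 - ((fst c - fst a) ^ 2 + (snd c - snd a) ^ 2)) * V ^ 2)%R by ring.
split; [tauto |]. split; intros C.
- split; [tauto |]. split; intros C1; [apply H1; tauto |].
  split; [tauto |]. split; intros C2; [apply H1; right; left; split; [lra | split; lra] |].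
  apply H2'. intros [K1 | [K1 | K1]]; lra.
- split; [tauto |]. split; intros C1; [apply H2'; intros [K1 | [K1 | K1]]; lra |].
  split; [tauto |]. split; intros C2; [apply H1; right; right; split; [lra | split; lra] |].
  apply H2'. intros [K1 | [K1 | K1]]; lra.
Qed.

(** * Known rows of the table and column maxima *)

Definition tab (u : store) (i k : nat) : nat := imem_of u (4 * N + i * N + k).

(** The table is filled by rows, and row [J] consults only column [J] of the rows above it. *)
Definition known (J : nat) (u : store) : Prop :=
  forall i k, i < J -> i < k -> k < N -> entry N pt (tab u) i k.

Lemma cell_lt (i k : nat) : i < N -> k < N -> 4 * N + i * N + k < m.
Proof. intros. nia. Qed.

Lemma cell_correct (u : store) (x y : nat) : layout u -> ivar u x < N -> ivar u y < N ->
  isafe m u (cell x y) /\ ieval u (cell x y) = 4 * N + ivar u x * N + ivar u y /\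
  ieval u (cell x y) < m.
Proof.
intros L Hx Hy. unfold cell. pose proof (cell_lt _ _ Hx Hy). simpl_store.
rewrite (layout_n u L). splits; auto; lia.
Qed.

Lemma value_correct (u : store) (x y : nat) : layout u -> ivar u x < N -> ivar u y < N ->
  isafe m u (value x y) /\ ieval u (value x y) = tab u (ivar u x) (ivar u y).
Proof.
intros L Hx Hy. destruct (cell_correct u x y L Hx Hy) as [S [E B]].
unfold value. simpl_store. rewrite E in *. auto.
Qed.

Lemma entry_ext (f g : nat -> nat -> nat) (i k : nat) :
  f i k = g i k -> entry N pt f i k -> entry N pt g i k.
Proof. unfold entry. now intros ->. Qed.

Lemma column_max_runs (J : nat) (u : store) :
  layout u -> ivar u v_j = J -> J < N ->
  runs m column_max_loop u (2 + (N + 1) * (code_length column_max_body + 20)) (fun v =>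
    imem_of v = imem_of u /\ rmem_of v = rmem_of u /\ ivar v v_n = N /\ ivar v v_j = J /\
    column_max (tab u) J (ivar v v_max)).
Proof.
intros L EJ JN. apply runs_seq. apply (runs_set_ivar m v_max $1); [simpl; lia |].
apply (runs_for m v_i v_n N _ _ (fun a v =>
  imem_of v = imem_of u /\ rmem_of v = rmem_of u /\ ivar v v_n = N /\ ivar v v_j = J /\
  ivar v v_i = a /\ 1 <= ivar v v_max /\
  (forall i, i < a -> i < J -> tab u i J <= ivar v v_max) /\
  (ivar v v_max = 1 \/ exists i, i < J /\ tab u i J = ivar v v_max))).
- lia.
- tauto.
- intros a v Ha [Ei [Er [En [Ej [Ea [F1 [Fub Fex]]]]]]].
  assert (Lv : layout v) by (apply (layout_frame u); auto; now rewrite Ei).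
  apply runs_wp. unfold column_max_body.
  destruct (value_correct v v_i v_j Lv) as [Sv Vv]; [lia | lia |].
  unfold tab in Vv at 1. rewrite Ea, Ej, Ei in Vv. fold (tab u a J) in Vv.
  simpl_store. rewrite ?Ea, ?Ej, ?Vv, ?En, ?Er, ?Ei.
  assert (tab u a J <= ivar v v_max -> forall i, i < S a -> i < J -> tab u i J <= ivar v v_max).
  { intros Hle i Hi Hij. destruct (Nat.eq_dec i a) as [-> |]; [exact Hle | apply Fub; lia]. }
  splits; intros; splits; intros; splits; auto; try lia.
  + intros i Hi Hij. destruct (Nat.eq_dec i a) as [-> |]; [lia |].
    specialize (Fub i ltac:(lia) Hij). lia.
  + right. exists a. split; [lia | reflexivity].
  + apply Fub; lia.
- simpl_store. splits; auto; [apply L | intros; lia].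
- intros v [Ei [Er [En [Ej [_ [F1 [Fub Fex]]]]]]]. splits; auto.
  split; [exact F1 |]. split; [intros i Hi; apply Fub; lia | exact Fex].
Qed.

(** * The stack scan that builds the envelope *)

Fixpoint stack_of (f : nat -> nat) (k : nat) : list nat :=
  match k with
  | 0 => []
  | S k' => f (N + k') :: stack_of f k'
  end.

Lemma stack_of_ext (f g : nat -> nat) (k : nat) :
  (forall z, z < k -> f (N + z) = g (N + z)) -> stack_of f k = stack_of g k.
Proof.
induction k as [| k IH]; intros H; simpl; [reflexivity |].
rewrite H by lia. f_equal. apply IH. intros z Hz. apply H. lia.
Qed.

Lemma stack_of_push (f : nat -> nat) (k s : nat) :
  stack_of (update f (N + k) s) (S k) = s :: stack_of f k.
Proof.
simpl. rewrite update_eq. f_equal. apply stack_of_ext. intros z Hz. apply update_neq. lia.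
Qed.

Definition eligible (u : store) (J F i : nat) : Prop := i < J /\ tab u i J = F.

(** The arc under consideration may already have caused pops before being pushed, so what was popped
    is covered only with its help. The list [pending] is empty, or holds that arc from its first pop
    on. As [v_top <= v_t], the stack never leaves its [N] cells. *)
Definition envelope_inv (u : store) (J F : nat) (v : store) : Prop :=
  rmem_of v = rmem_of u /\ ivar v v_n = N /\ ivar v v_j = J /\ ivar v v_max = F /\
  (forall a, 2 * N <= a -> imem_of v a = imem_of u a) /\
  ivar v v_t <= N /\ ivar v v_top <= ivar v v_t /\
  envelope N pt lo hi (stack_of (imem_of v) (ivar v v_top)) /\
  (forall c, In c (stack_of (imem_of v) (ivar v v_top)) ->
    eligible u J F c /\ exists t, t < ivar v v_t /\ c = yo t) /\
  exists pending,
    (pending = [] \/ ivar v v_t < N /\ eligible u J F (yo (ivar v v_t)) /\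
       pending = [yo (ivar v v_t)]) /\
    forall t, t < ivar v v_t -> eligible u J F (yo t) ->
      covers pt lo hi (pending ++ stack_of (imem_of v) (ivar v v_top)) (yo t).

Lemma envelope_inv_layout (u v : store) (J F : nat) :
  layout u -> envelope_inv u J F v -> layout v.
Proof.
intros L [Er [En [_ [_ [Ei _]]]]]. apply (layout_frame u); auto.
intros a Ha. apply Ei. lia.
Qed.

Lemma envelope_inv_set (u v : store) (J F x a : nat) :
  ~ In x [v_n; v_j; v_max; v_t; v_top] -> envelope_inv u J F v ->
  envelope_inv u J F (set_ivar x a v).
Proof.
intros Hx Inv. unfold envelope_inv. cbn [set_ivar ivar imem_of rmem_of].
rewrite !update_neq by (intros <-; apply Hx; simpl; tauto). exact Inv.
Qed.

Lemma envelope_inv_next (u v : store) (J F : nat) :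
  envelope_inv u J F v -> ivar v v_t < N ->
  (eligible u J F (yo (ivar v v_t)) ->
   covers pt lo hi (stack_of (imem_of v) (ivar v v_top)) (yo (ivar v v_t))) ->
  envelope_inv u J F (set_ivar v_t (ivar v v_t + 1) v).
Proof.
intros [Er [En [Ej [Em [Ei [tN [topt [Env [Hin [pending [Hp Hc]]]]]]]]]]] Ht Hcov.
unfold envelope_inv. simpl_store. splits; auto; try lia.
- intros c Hc'. destruct (Hin c Hc') as [He [t [Htt Et]]]. split; [exact He |].
  exists t. split; [lia | exact Et].
- exists []. split; [now left |]. simpl app. intros t' Ht' He.
  destruct (Nat.eq_dec t' (ivar v v_t)) as [-> | Hne]; [now apply Hcov |].
  apply (covers_trans pt lo hi (pending ++ stack_of (imem_of v) (ivar v v_top)));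
    [| apply Hc; [lia | exact He]].
  intros c Hin'. apply in_app_or in Hin' as [Hin' | Hin']; [| now apply covers_in].
  destruct Hp as [-> | [_ [Hel ->]]]; [contradiction |].
  destruct Hin' as [<- | []]. now apply Hcov.
Qed.

Lemma envelope_inv_pop (u v : store) (J F q : nat) (l : list nat) :
  envelope_inv u J F v -> ivar v v_t < N -> eligible u J F (yo (ivar v v_t)) ->
  stack_of (imem_of v) (ivar v v_top) = q :: l ->
  covers pt lo hi (yo (ivar v v_t) :: l) q ->
  envelope_inv u J F (set_ivar v_top (ivar v v_top - 1) v).
Proof.
intros [Er [En [Ej [Em [Ei [tN [topt [Env [Hin [pending [Hp Hc]]]]]]]]]]] Ht Hel Est Hcov.
assert (Est' : stack_of (imem_of v) (ivar v v_top - 1) = l).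
{ destruct (ivar v v_top) as [| k]; [discriminate |]. simpl in Est.
  replace (S k - 1) with k by lia. now injection Est. }
unfold envelope_inv. simpl_store. rewrite Est'. rewrite Est in *. splits; auto; try lia.
- apply Env.
- intros c Hc'. apply Hin. now right.
- exists [yo (ivar v v_t)]. split; [now right |]. intros t' Ht' He.
  apply (covers_trans pt lo hi (pending ++ q :: l)); [| now apply Hc].
  intros c Hin'. apply in_app_or in Hin' as [Hin' | Hin'].
  + destruct Hp as [-> | [_ [_ ->]]]; [contradiction |].
    destruct Hin' as [<- | []]. apply covers_in. now left.
  + destruct Hin' as [<- | Hin']; [exact Hcov |]. apply covers_in. now right.
Qed.

Lemma envelope_inv_push (u v : store) (J F : nat) :
  envelope_inv u J F v -> ivar v v_t < N -> eligible u J F (yo (ivar v v_t)) ->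
  envelope N pt lo hi (yo (ivar v v_t) :: stack_of (imem_of v) (ivar v v_top)) ->
  envelope_inv u J F (set_ivar v_t (ivar v v_t + 1) (set_ivar v_top (ivar v v_top + 1)
    (put_imem (N + ivar v v_top) (yo (ivar v v_t)) v))).
Proof.
intros [Er [En [Ej [Em [Ei [tN [topt [Env [Hin [pending [Hp Hc]]]]]]]]]]] Ht Hel HE.
unfold envelope_inv. simpl_store. rewrite Nat.add_1_r with (n := ivar v v_top).
fold (update (imem_of v) (N + ivar v v_top) (yo (ivar v v_t))).
rewrite stack_of_push. splits; auto; try lia.
- intros a Ha. rewrite update_neq by lia. now apply Ei.
- intros c [<- | Hc'].
  + split; [exact Hel |]. exists (ivar v v_t). split; [lia | reflexivity].
  + destruct (Hin c Hc') as [He [t [Htt Et]]]. split; [exact He |].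
    exists t. split; [lia | exact Et].
- exists []. split; [now left |]. intros t' Ht' He.
  destruct (Nat.eq_dec t' (ivar v v_t)) as [-> | Hne]; [apply covers_in; now left |].
  apply (covers_trans pt lo hi (pending ++ stack_of (imem_of v) (ivar v v_top)));
    [| apply Hc; [lia | exact He]].
  intros c Hin'. apply covers_in. apply in_app_or in Hin' as [Hin' | Hin']; [| now right].
  destruct Hp as [-> | [_ [_ ->]]]; [contradiction |]. destruct Hin' as [<- | []]. now left.
Qed.

Lemma stack_top (u v : store) (J F d : nat) :
  layout v -> envelope_inv u J F v -> d < ivar v v_top ->
  isafe m v (stack (!v_top -i $(S d))) /\
  ieval v (stack (!v_top -i $(S d))) = imem_of v (N + (ivar v v_top - S d)).
Proof.
intros L [Er [En [Ej [Em [Ei [tN [topt _]]]]]]] Hd. unfold stack. simpl_store.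
rewrite En. splits; auto; lia.
Qed.

(** The measure counts every unread point twice: a push consumes a point and lengthens the stack by
    one, a pop only shortens the stack, and a skip only consumes a point. *)
Lemma insert_wp (u v : store) (J F : nat) :
  layout u -> J < N -> envelope_inv u J F v -> ivar v v_t < N ->
  ivar v v_s = yo (ivar v v_t) -> eligible u J F (yo (ivar v v_t)) ->
  wp m insert (fun w => envelope_inv u J F w /\
    2 * (N - ivar w v_t) + ivar w v_top < 2 * (N - ivar v v_t) + ivar v v_top) v.
Proof.
intros L JN Inv Ht Es El.
assert (Push : forall v', envelope_inv u J F v' -> ivar v' v_t = ivar v v_t ->
  ivar v' v_s = yo (ivar v v_t) -> ivar v' v_top = ivar v v_top -> imem_of v' = imem_of v ->
  envelope N pt lo hi (yo (ivar v v_t) :: stack_of (imem_of v) (ivar v v_top)) ->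
  wp m push (fun w => envelope_inv u J F w /\
    2 * (N - ivar w v_t) + ivar w v_top < 2 * (N - ivar v v_t) + ivar v v_top) v').
{ intros v' Inv' Et Es' Etop Eim HE. unfold push, next.
  assert (K := envelope_inv_push u v' J F Inv').
  destruct Inv' as [Er [En [Ej [Em [Ei [tN [topt _]]]]]]].
  rewrite Et, Etop, Eim in K. specialize (K Ht El HE).
  cbn [wp incr isafe ieval int_eval]. simpl_store.
  rewrite Et, Etop, En, Es'. rewrite Et, Etop in topt. splits; auto; try lia. }
unfold insert. cbn [wp]. split; [simpl; lia |]. split; intros C0; simpl in C0.
{ apply Push; auto. replace (ivar v v_top) with 0 by lia. simpl. split; [now apply yo_lt | auto]. }
destruct (ivar v v_top) as [| k] eqn:Etop; [lia |]. clear C0.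
assert (Lv := envelope_inv_layout u v J F L Inv).
destruct (stack_top u v J F 0 Lv Inv ltac:(lia)) as [Sq Vq].
split; [exact Sq |]. rewrite Vq, Etop. replace (S k - 1) with k by lia. clear Sq Vq.
set (q := imem_of v (N + k)). set (s := yo (ivar v v_t)) in *.
assert (Inv1 := envelope_inv_set u v J F v_q q ltac:(cbv; intuition discriminate) Inv).
assert (Lv1 := envelope_inv_layout u _ J F L Inv1).
assert (Est : stack_of (imem_of v) (ivar v v_top) = q :: stack_of (imem_of v) k)
  by now rewrite Etop.
assert (Facts := Inv). destruct Facts as [_ [En [_ [_ [_ [tN [topt [Env [Hin _]]]]]]]]].
rewrite Est in Env, Hin.
assert (low : forall c, In c (q :: stack_of (imem_of v) k) -> c < N /\ (snd (pt c) <= snd (pt s))%R).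
{ intros c Hc. destruct (Hin c Hc) as [_ [t [Htt ->]]].
  split; [apply yo_lt; lia | apply yo_mono; lia]. }
destruct (low q (or_introl eq_refl)) as [qN qs].
assert (sN : s < N) by now apply yo_lt.
pose proof (band_lo_hi ltac:(lia)) as lh.
pose proof (band_narrow ltac:(lia)) as W.
apply wp_if_arc_le; auto.
- simpl_store. now rewrite Es.
- now apply lowest_correct; [| lia].
- destruct (lowest_correct _ Lv1 ltac:(lia)) as [_ ->]. lra.
- destruct (lowest_correct _ Lv1 ltac:(lia)) as [_ ->]. intros Clo.
  simpl_store. rewrite Es in Clo. fold s in Clo.
  unfold next. simpl_store. split; [lia |]. split; [| simpl_store; lia].
  apply (envelope_inv_next u (set_ivar v_q q v) J F Inv1 Ht).
  intros _. simpl_store. rewrite Est.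
  apply (covers_below N pt lo hi W pt_band q s); auto. now left.
- destruct (lowest_correct _ Lv1 ltac:(lia)) as [_ ->]. intros Clo.
  simpl_store. rewrite Es in Clo. fold s in Clo.
  assert (Pop : forall v', envelope_inv u J F v' -> ivar v' v_t = ivar v v_t ->
    ivar v' v_top = ivar v v_top -> imem_of v' = imem_of v ->
    covers pt lo hi (s :: stack_of (imem_of v) k) q ->
    wp m pop (fun w => envelope_inv u J F w /\
      2 * (N - ivar w v_t) + ivar w v_top < 2 * (N - ivar v v_t) + S k) v').
  { intros v' Inv' Et Et' Eim Hcov. unfold pop. simpl_store.
    split; [rewrite Et'; lia |]. split; [| rewrite Et, Et'; lia].
    apply (envelope_inv_pop u v' J F q (stack_of (imem_of v) k)); auto.
    - simpl_store. now rewrite Et.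
    - simpl_store. now rewrite Et.
    - simpl_store. now rewrite Eim, Et'.
    - simpl_store. now rewrite Et. }
  apply wp_if_arc_le; auto.
  + simpl_store. now rewrite Es.
  + now apply highest_correct; [| lia].
  + destruct (highest_correct _ Lv1 ltac:(lia)) as [_ ->]. lra.
  + destruct (highest_correct _ Lv1 ltac:(lia)) as [_ ->]. intros Chi.
    simpl_store. rewrite Es in Chi. fold s in Chi.
    apply Pop; auto.
    apply (covers_above N pt lo hi W pt_band q s); auto. now left.
  + destruct (highest_correct _ Lv1 ltac:(lia)) as [_ ->]. intros Chi.
    simpl_store. rewrite Es in Chi. fold s in Chi.
    assert (link : linked N pt lo hi q s) by (unfold linked; auto).
    split; [lia |]. rewrite Etop. split; intros C1.
    * apply Push; auto. destruct k as [| k]; [| lia].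
      simpl in Env |- *. fold q. tauto.
    * destruct k as [| k]; [lia |].
      destruct (stack_top u _ J F 1 Lv1 Inv1) as [Sp Vp]; [simpl_store; lia |].
      split; [exact Sp |]. rewrite Vp. simpl_store. rewrite Etop.
      replace (S (S k) - 2) with k by lia. clear Sp Vp.
      set (p := imem_of v (N + k)) in *.
      assert (Inv2 := envelope_inv_set u _ J F v_p p ltac:(cbv; intuition discriminate) Inv1).
      assert (Lv2 := envelope_inv_layout u _ J F L Inv2).
      change (stack_of (imem_of v) (S k)) with (p :: stack_of (imem_of v) k) in *.
      destruct (low p) as [pN ps]; [simpl; auto |].
      assert (linkp : linked N pt lo hi p q) by (apply Env).
      apply wp_if_middle_useless; auto; simpl_store; rewrite ?Es; fold s; auto.
      -- intros y Hy cross below. apply Pop; auto.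
         apply (covers_middle N pt lo hi W pt_band p q s _ y); auto; try apply linkp;
           simpl; auto.
      -- intros D. apply Push; auto.
         simpl. fold q p. split; [exact sN |]. split; [exact Env |]. auto.
Qed.

Lemma envelope_runs (J F : nat) (u : store) :
  layout u -> ivar u v_j = J -> ivar u v_max = F -> J < N ->
  runs m envelope_loop u (2 + (2 + (2 * N + 1) * (code_length envelope_body + 7))) (fun v =>
    envelope_inv u J F v /\ ivar v v_t = N).
Proof.
intros L EJ EF JN.
apply runs_seq. apply (runs_set_ivar m v_top $0); [simpl; lia |].
apply (runs_seq m (SetI v_t $0) _ _ 2).
apply (runs_set_ivar m v_t $0); [simpl; lia |].
set (u0 := set_ivar v_t _ _).
assert (Inv0 : envelope_inv u J F u0).
{ unfold u0, envelope_inv. simpl_store. splits; auto; try lia; try apply L.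
  - simpl. auto.
  - simpl. contradiction.
  - exists []. split; [now left | lia]. }
apply (runs_weaken m _ _ ((2 * (N - ivar u0 v_t) + ivar u0 v_top + 1)
    * (code_length envelope_body + test_length (ILe (!v_t +i $1) !v_n) + 2)) _
  (fun v => envelope_inv u J F v /\ ~ holds v (ILe (!v_t +i $1) !v_n))).
- replace (test_length _) with 5 by reflexivity. unfold u0. simpl_store. nia.
- intros v [Inv Hn]. split; [exact Inv |].
  destruct Inv as [_ [En [_ [_ [_ [tN _]]]]]]. simpl_store. lia.
- apply (runs_while m _ _ (code_length envelope_body) (envelope_inv u J F)
    (fun v => 2 * (N - ivar v v_t) + ivar v v_top)); [| | exact Inv0].
  + intros v [_ [En [_ [_ [_ [tN _]]]]]]. simpl_store. lia.
  + intros v Inv Hb. apply runs_wp.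
    assert (Lv := envelope_inv_layout u v J F L Inv).
    assert (Facts := Inv). destruct Facts as [Er [En [Ej [Em [Ei [tN [topt _]]]]]]].
    simpl in Hb. assert (Ht : ivar v v_t < N) by (simpl_store; lia). clear Hb.
    unfold envelope_body. cbn [wp].
    destruct (by_ordinate_correct v !v_t Lv) as [St Vt]; [exact I | exact Ht |].
    split; [exact St |]. rewrite Vt. change (ieval v !v_t) with (ivar v v_t). clear St Vt.
    set (s := yo (ivar v v_t)).
    assert (sN : s < N) by now apply yo_lt.
    assert (Inv1 := envelope_inv_set u v J F v_s s ltac:(cbv; intuition discriminate) Inv).
    assert (Lv1 := envelope_inv_layout u _ J F L Inv1).
    assert (Next : ~ eligible u J F s -> wp m next
      (fun w => envelope_inv u J F w /\
        2 * (N - ivar w v_t) + ivar w v_top < 2 * (N - ivar v v_t) + ivar v v_top)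
      (set_ivar v_s s v)).
    { intros He. unfold next. simpl_store. split; [lia |]. split; [| simpl_store; lia].
      apply (envelope_inv_next u (set_ivar v_s s v) J F Inv1 Ht).
      intros K. contradiction. }
    cbn [test_safe isafe holds]. split; [simpl_store; lia |].
    split; intros C1; simpl_store; rewrite Ej in C1; [| apply Next; intros [K _]; lia].
    destruct (value_correct _ v_s v_j Lv1) as [Sv Vv]; [simpl_store; auto | simpl_store; lia |].
    assert (Vv' : ieval (set_ivar v_s s v) (value v_s v_j) = tab u s J).
    { rewrite Vv. unfold tab. simpl_store. rewrite Ej. apply Ei. lia. }
    simpl_store. fold s in C1. rewrite Vv', Em. split; [auto |].
    split; intros C2; [| apply Next; intros [_ K]; lia].
    split; [auto |]. split; intros C3; [| apply Next; intros [_ K]; lia].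
    apply (insert_wp u (set_ivar v_s s v) J F L JN Inv1); [exact Ht | reflexivity |].
    unfold eligible. simpl_store. fold s. split; lia.
Qed.

(** * Filling a row by moving along the envelope *)

(** Here [u] is the state at the start of the row, with the full stack of height [top]. A popped arc
    is never below the current top arc between the current ordinate and [hi]; this suffices, since
    later points are not lower. A nonempty stack is never emptied. *)
Definition row_inv (u : store) (J F top : nat) (v : store) : Prop :=
  rmem_of v = rmem_of u /\ ivar v v_n = N /\ ivar v v_j = J /\ ivar v v_max = F /\
  (forall a, a < 4 * N + J * N \/ 4 * N + J * N + N <= a -> imem_of v a = imem_of u a) /\
  ivar v v_t <= N /\ ivar v v_top <= top /\ (0 < top -> 0 < ivar v v_top) /\
  (forall t, t < ivar v v_t -> J < yo t -> entry N pt (tab v) J (yo t)) /\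
  (ivar v v_t < N ->
   match stack_of (imem_of u) (ivar v v_top) with
   | [] => True
   | q :: _ => forall c, In c (stack_of (imem_of u) top) ->
       In c (stack_of (imem_of u) (ivar v v_top)) \/
       (forall y, (snd (pt (yo (ivar v v_t))) <= y <= hi)%R ->
          (arc (pt q) y <= arc (pt c) y)%R)
   end).

Lemma row_inv_layout (u v : store) (J F top : nat) :
  J < N -> layout u -> row_inv u J F top v -> layout v.
Proof.
intros JN L [Er [En [_ [_ [Ei _]]]]]. apply (layout_frame u); auto.
intros a Ha. apply Ei. lia.
Qed.

Lemma row_inv_set (u v : store) (J F top x a : nat) :
  ~ In x [v_n; v_j; v_max; v_t; v_top] -> row_inv u J F top v ->
  row_inv u J F top (set_ivar x a v).
Proof.
intros Hx Inv. unfold row_inv, tab. cbn [set_ivar ivar imem_of rmem_of].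
rewrite !update_neq by (intros <-; apply Hx; simpl; tauto). exact Inv.
Qed.

Lemma row_inv_next (u v : store) (J F top : nat) :
  row_inv u J F top v -> ivar v v_t < N ->
  (J < yo (ivar v v_t) -> entry N pt (tab v) J (yo (ivar v v_t))) ->
  row_inv u J F top (set_ivar v_t (ivar v v_t + 1) v).
Proof.
intros [Er [En [Ej [Em [Ei [tN [topt [top0 [Hrow Hq]]]]]]]]] Ht He.
unfold row_inv. simpl_store. splits; auto; try lia.
- intros t Htt. destruct (Nat.eq_dec t (ivar v v_t)) as [-> |]; [exact He |].
  apply Hrow. lia.
- intros Ht1. specialize (Hq Ht).
  destruct (stack_of (imem_of u) (ivar v v_top)) as [| q l]; [exact I |].
  intros c Hc. destruct (Hq c Hc) as [K | K]; [now left | right].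
  intros y Hy. apply K. pose proof (yo_mono (ivar v v_t) (ivar v v_t + 1) ltac:(lia) Ht1). lra.
Qed.

Lemma row_inv_put (u v : store) (J F top a : nat) :
  J < N -> row_inv u J F top v -> ivar v v_t < N -> J < yo (ivar v v_t) ->
  ((far (pt J) (pt (yo (ivar v v_t))) -> longest N pt J (yo (ivar v v_t)) a) /\
   (~ far (pt J) (pt (yo (ivar v v_t))) -> a = 0)) ->
  row_inv u J F top (set_ivar v_t (ivar v v_t + 1)
    (put_imem (4 * N + J * N + yo (ivar v v_t)) a v)).
Proof.
intros JN Inv Ht Jk Ha.
assert (kN := yo_lt _ Ht). set (k := yo (ivar v v_t)) in *.
assert (E : forall k', tab (put_imem (4 * N + J * N + k) a v) J k'
  = if Nat.eqb k' k then a else tab v J k').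
{ intros k'. unfold tab, put_imem. cbn [imem_of]. unfold update.
  destruct (Nat.eqb_spec (4 * N + J * N + k') (4 * N + J * N + k));
    destruct (Nat.eqb_spec k' k); lia || reflexivity. }
apply (row_inv_next u (put_imem (4 * N + J * N + k) a v)).
- destruct Inv as [Er [En [Ej [Em [Ei [tN [topt [top0 [Hrow Hq]]]]]]]]].
  unfold row_inv. cbn [put_imem ivar rmem_of imem_of]. splits; auto.
  + intros b Hb. rewrite update_neq by lia. now apply Ei.
  + intros t Htt Hjt. specialize (Hrow t Htt Hjt). unfold entry. rewrite E.
    destruct (Nat.eqb_spec (yo t) k) as [-> |]; [exact Ha | exact Hrow].
- exact Ht.
- intros _. unfold entry. cbn [put_imem ivar]. fold (put_imem (4 * N + J * N + k) a v).
  fold k. rewrite E, Nat.eqb_refl. exact Ha.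
Qed.

(** Positions decrease strictly along a chain. This keeps table values at most [N], hence within an
    integer word. *)
Lemma chain_length (k : nat) (l : list nat) : chain N pt (k :: l) -> length l <= k.
Proof.
revert k. induction l as [| j l IH]; intros k C; simpl; [lia |].
destruct (chain_two_far N pt j k l C) as [jk _].
specialize (IH j (chain_tail N pt _ _ C)). lia.
Qed.

Lemma longest_le (j k v : nat) : longest N pt j k v -> v <= S k /\ k < N.
Proof.
intros [[l [C <-]] _]. pose proof (chain_length k (j :: l) C). simpl in H.
split; [lia | apply C].
Qed.

Lemma column_max_le (f : nat -> nat -> nat) (J F : nat) :
  J < N -> (forall i, i < J -> entry N pt f i J) -> column_max f J F -> F <= S J.
Proof.
intros JN He [_ [_ [-> | [i [iJ <-]]]]]; [lia |].
destruct (He i iJ) as [Hf Hnf].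
destruct (Classical_Prop.classic (far (pt i) (pt J))) as [K | K];
  [now destruct (longest_le _ _ _ (Hf K)) | rewrite (Hnf K); lia].
Qed.

Definition envelope_of (u : store) (J F top : nat) : Prop :=
  top <= N /\
  envelope N pt lo hi (stack_of (imem_of u) top) /\
  (forall c, In c (stack_of (imem_of u) top) -> eligible u J F c) /\
  (forall i, eligible u J F i -> covers pt lo hi (stack_of (imem_of u) top) i).

(** Why one disk answers for all: an eligible [i] far from [k] has its arc to the left of [k], and
    then so does some arc of the envelope, and so does the lowest one, that of [q]. *)
Lemma eligible_far (u : store) (J F top q k : nat) :
  J < k -> k < N -> envelope_of u J F top -> eligible u J F q ->
  (forall c, In c (stack_of (imem_of u) top) ->
     (arc (pt q) (snd (pt k)) <= arc (pt c) (snd (pt k)))%R) ->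
  forall i, eligible u J F i -> far (pt i) (pt k) -> far (pt q) (pt k).
Proof.
intros Jk kN [_ [_ [_ Hcov]]] [qJ _] Hq i Hi Fik.
destruct (Hcov i Hi (snd (pt k)) (pt_band k kN)) as [c [Hc Hci]]. specialize (Hq c Hc).
destruct Hi as [iJ _].
pose proof (band_narrow ltac:(lia)). pose proof (pt_band k kN).
pose proof (pt_band i ltac:(lia)). pose proof (pt_band q ltac:(lia)).
apply far_arc in Fik; [| apply pt_sorted; lia | lra].
apply far_arc; [apply pt_sorted; lia | lra | lra].
Qed.

Lemma decide_wp (u v : store) (J F top q k : nat) :
  layout u -> J < N -> known J u -> column_max (tab u) J F -> envelope_of u J F top ->
  row_inv u J F top v -> ivar v v_t < N -> yo (ivar v v_t) = k -> ivar v v_s = k -> J < k ->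
  far (pt J) (pt k) -> ivar v v_q = q -> eligible u J F q ->
  (forall c, In c (stack_of (imem_of u) top) ->
     (arc (pt q) (snd (pt k)) <= arc (pt c) (snd (pt k)))%R) ->
  wp m decide (fun w => row_inv u J F top w /\
    N - ivar w v_t + ivar w v_top < N - ivar v v_t + ivar v v_top) v.
Proof.
intros L JN K HF HE Inv Ht Ek Es Jk Fk Eq Hel Hq.
assert (kN : k < N) by (rewrite <- Ek; now apply yo_lt).
assert (Lv := row_inv_layout u v J F top JN L Inv).
assert (Facts := Inv). destruct Facts as [Er [En [Ej [Em _]]]].
assert (Hent : forall i, i < J -> entry N pt (tab u) i J) by (intros; now apply K).
pose proof (column_max_le _ J F JN Hent HF) as FJ.
destruct (cell_correct v v_j v_s Lv) as [Sc [Ec Bc]]; [lia | lia |].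
unfold decide, set_same, set_succ, next.
assert (qJ := proj1 Hel).
apply wp_if_near; [exact Lv | lia | lia | |]; rewrite Eq, Es; intros Hnear;
  cbn [wp incr isafe ieval int_eval]; rewrite Ec, Ej, Es in *; simpl_store;
  rewrite Em; (splits; auto; try lia).
- rewrite <- Ek in *. apply row_inv_put; auto. split; [intros _ | contradiction].
  apply (longest_same N h pt pt_sorted pt_strip (tab u)); auto.
  (* An eligible [q] ends up with [J] in a chain of at least two points, or else its entry is 0;
     neither value is 1. *)
  + intros F1. destruct Hel as [_ Eq'].
    destruct (Hent q qJ) as [Hf Hnf].
    destruct (Classical_Prop.classic (far (pt q) (pt J))) as [K' | K'].
    * destruct (Hf K') as [[l [_ El]] _]. lia.
    * rewrite (Hnf K') in Eq'. lia.
  + intros i iJ Ei Fi. apply Hnear.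
    apply (eligible_far u J F top q _ Jk kN HE Hel Hq i); [split; auto | exact Fi].
- rewrite <- Ek in *. apply row_inv_put; auto. split; [intros _ | contradiction].
  rewrite Nat.add_1_r.
  apply (longest_succ N h pt pt_sorted pt_strip (tab u)); auto.
  right. exists q. split; [exact qJ |]. split; [apply Hel | exact Hnear].
Qed.

Lemma row_body_wp (u v : store) (J F top : nat) :
  layout u -> J < N -> known J u -> column_max (tab u) J F -> envelope_of u J F top ->
  row_inv u J F top v -> ivar v v_t < N ->
  wp m row_body (fun w => row_inv u J F top w /\
    N - ivar w v_t + ivar w v_top < N - ivar v v_t + ivar v v_top) v.
Proof.
intros L JN K HF HE Inv Ht.
assert (Lv := row_inv_layout u v J F top JN L Inv).
assert (Facts := Inv). destruct Facts as [Er [En [Ej [Em [Ei [tN [topt [top0 [Hrow Hdom]]]]]]]]].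
unfold row_body. cbn [wp].
destruct (by_ordinate_correct v !v_t Lv) as [St Vt]; [exact I | exact Ht |].
split; [exact St |]. rewrite Vt. change (ieval v !v_t) with (ivar v v_t). clear St Vt.
remember (yo (ivar v v_t)) as k eqn:Ek.
assert (kN : k < N) by (rewrite Ek; now apply yo_lt).
assert (Inv1 := row_inv_set u v J F top v_s k ltac:(cbv; intuition discriminate) Inv).
assert (Lv1 := row_inv_layout u _ J F top JN L Inv1).
cbn [test_safe isafe holds]. split; [simpl_store; auto |].
split; intros C1; simpl_store; rewrite Ej in C1.
{ unfold next. simpl_store. split; [lia |]. split; [| simpl_store; lia].
  apply (row_inv_next u (set_ivar v_s k v)); auto.
  simpl_store. rewrite <- Ek. lia. }
destruct (cell_correct _ v_j v_s Lv1) as [Sc [Ec Bc]]; [simpl_store; lia | simpl_store; auto |].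
apply wp_if_near; auto; simpl_store; [lia | rewrite Ej; intros Hn .. ].
{ unfold next. simpl_store. rewrite Ec in *. rewrite Ej in *. splits; auto; try lia.
  rewrite Ek in *. apply (row_inv_put u (set_ivar v_s (yo (ivar v v_t)) v)); auto;
    simpl_store; [lia |].
  split; [contradiction | reflexivity]. }
assert (Hent : forall i, i < J -> entry N pt (tab u) i J) by (intros; now apply K).
pose proof (column_max_le _ J F JN Hent HF) as FJ.
split; [lia |]. split; intros C2.
{ unfold set_succ, next. simpl_store. rewrite Ec, Ej, Em in *. splits; auto; try lia.
  rewrite Ek in *. apply (row_inv_put u (set_ivar v_s (yo (ivar v v_t)) v)); auto;
    simpl_store; [lia |].
  split; [intros _ | contradiction]. rewrite Nat.add_1_r.
  apply (longest_succ N h pt pt_sorted pt_strip (tab u)); auto; [lia |].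
  (* The empty stack covers no arc, as seen at the ordinate [lo]; hence no [i] attains [F], which
     must be 1. *)
  destruct HF as [_ [_ [F1 | [i [iJ Hi]]]]]; [now left | exfalso].
  destruct HE as [_ [_ [_ Hcov]]]. replace top with 0 in Hcov by lia.
  destruct (Hcov i (conj iJ Hi) lo) as [c [[] _]].
  pose proof (band_lo_hi ltac:(lia)). lra. }
destruct (ivar v v_top) as [| z] eqn:Etop; [lia |]. clear C2.
set (q := imem_of u (N + z)).
assert (Eq : imem_of v (N + z) = q).
{ apply Ei. destruct HE as [HE _]. left. nia. }
assert (topN : S z <= N) by (destruct HE; lia).
split. { unfold stack. simpl_store. rewrite En, Etop. lia. }
assert (Vq : ieval (set_ivar v_s k v) (stack (!v_top -i $1)) = q).
{ unfold stack. simpl_store. rewrite En, Etop. replace (S z - 1) with z by lia. exact Eq. }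
rewrite Vq. clear Vq.
set (v2 := set_ivar v_q q (set_ivar v_s k v)).
assert (Inv2 := row_inv_set u _ J F top v_q q ltac:(cbv; intuition discriminate) Inv1).
assert (Lv2 := row_inv_layout u _ J F top JN L Inv2). fold v2 in Inv2, Lv2.
specialize (Hdom Ht). change (stack_of (imem_of u) (S z)) with (q :: stack_of (imem_of u) z) in Hdom.
cbv iota in Hdom.
(* Popping leaves a suffix of the initial stack, which is again an envelope of eligible points. *)
assert (suffix : forall d c, In c (stack_of (imem_of u) (top - d)) -> In c (stack_of (imem_of u) top)).
{ clear. induction top as [| t IH]; intros d c Hc; [exact Hc |].
  destruct d as [| d]; [exact Hc |]. right. apply (IH d). exact Hc. }
assert (sub : forall c, In c (q :: stack_of (imem_of u) z) -> In c (stack_of (imem_of u) top)).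
{ intros c Hc. apply (suffix (top - S z)). replace (top - (top - S z)) with (S z) by lia. exact Hc. }
assert (esub : envelope N pt lo hi (q :: stack_of (imem_of u) z)).
{ destruct HE as [_ [HE _]]. clear - HE topt. change (envelope N pt lo hi (stack_of (imem_of u) (S z))).
  remember (S z) as y. clear Heqy. induction top as [| t IH]; [now replace y with 0 by lia |].
  destruct (Nat.eq_dec y (S t)) as [-> | Hne]; [exact HE |].
  apply IH; [apply HE | lia]. }
assert (el : forall c, In c (stack_of (imem_of u) top) -> eligible u J F c) by apply HE.
assert (elq : eligible u J F q) by (apply el, sub; now left).
assert (qJ := proj1 elq).
pose proof (band_narrow ltac:(lia)) as W.
pose proof (pt_band k kN) as kB.
assert (Decide : forall v', row_inv u J F top v' -> ivar v' v_t = ivar v v_t ->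
  ivar v' v_top = S z -> ivar v' v_s = k -> ivar v' v_q = q ->
  (forall c, In c (stack_of (imem_of u) z) ->
     (arc (pt q) (snd (pt k)) <= arc (pt c) (snd (pt k)))%R) ->
  wp m decide (fun w => row_inv u J F top w /\
    N - ivar w v_t + ivar w v_top < N - ivar v v_t + S z) v').
{ intros v' Inv' Et Etop' Es' Eq' Hz. rewrite <- Et, <- Etop'.
  apply (decide_wp u v' J F top q k); auto; try lia; try congruence.
  intros c Hc. destruct (Hdom c Hc) as [[<- | Hc'] | Hc'].
  - lra.
  - now apply Hz.
  - apply Hc'. lra. }
split; [split; [exact I | lia] |]. split; intros C2.
{ apply Decide; auto. replace z with 0 by lia. contradiction. }
destruct z as [| z]; [lia |].
set (p := imem_of u (N + z)).
assert (Ep : imem_of v (N + z) = p) by (apply Ei; left; nia).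
split. { unfold stack, v2. simpl_store. rewrite En, Etop. lia. }
assert (Vp : ieval v2 (stack (!v_top -i $2)) = p).
{ unfold stack, v2. simpl_store. rewrite En, Etop. replace (S (S z) - 2) with z by lia. exact Ep. }
rewrite Vp. clear Vp.
assert (Inv3 := row_inv_set u _ J F top v_p p ltac:(cbv; intuition discriminate) Inv2).
assert (Lv3 := row_inv_layout u _ J F top JN L Inv3).
change (stack_of (imem_of u) (S z)) with (p :: stack_of (imem_of u) z) in *.
assert (link : linked N pt lo hi p q) by apply esub.
destruct link as [pN [qN [pq _]]].
destruct (py_correct (set_ivar v_p p v2) v_s Lv3) as [Sy Vy]; [unfold v2; simpl_store; auto |].
unfold v2 in Vy at 2. simpl_store.
apply wp_if_arc_le; auto; rewrite ?Vy; auto; unfold v2 at 1 2; simpl_store; intros C3.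
(* From the ordinate of [k] on, monotonicity of the gap keeps the arc of [p] from exceeding that of
   [q], and with it those of the points popped earlier. *)
- unfold pop, v2. simpl_store. rewrite Etop in *. split; [lia |]. split; [| lia].
  unfold v2, row_inv in Inv3. destruct Inv3 as [Fr [Fn [Fj [Fm [Fi [FtN [Ftop [Ftop0 [Frow _]]]]]]]]].
  simpl_store. unfold row_inv. replace (S (S z) - 1) with (S z) by lia.
  simpl_store. splits; auto; try lia.
  intros _. simpl. fold p. intros c Hc.
  destruct (Hdom c Hc) as [[<- | Hc'] | Hc'].
  + right. intros y Hy. rewrite <- Ek in Hy.
    pose proof (gap_mono N pt lo hi W pt_band p q (snd (pt k)) y pN qN pq ltac:(lra) ltac:(lra) ltac:(lra)).
    lra.
  + left. exact Hc'.
  + right. intros y Hy. rewrite <- Ek in Hy. specialize (Hc' y Hy).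
    pose proof (gap_mono N pt lo hi W pt_band p q (snd (pt k)) y pN qN pq ltac:(lra) ltac:(lra) ltac:(lra)).
    lra.
- apply Decide; auto.
  (* The top arc is strictly below the next one here, so by the shape of the envelope it is below
     all those deeper in the stack. *)
  intros c Hc. left.
  apply (envelope_head_lowest N pt lo hi W pt_band (stack_of (imem_of u) z) q p); auto.
Qed.

Lemma row_runs (J F top : nat) (u : store) :
  layout u -> J < N -> known J u -> ivar u v_j = J -> ivar u v_max = F -> ivar u v_top = top ->
  column_max (tab u) J F -> envelope_of u J F top ->
  runs m row_loop u (2 + (2 * N + 1) * (code_length row_body + 7)) (fun v =>
    layout v /\ known (S J) v /\ ivar v v_j = J).
Proof.
intros L JN K EJ EF Etop HF HE.
apply runs_seq. apply (runs_set_ivar m v_t $0); [simpl; lia |].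
set (u0 := set_ivar v_t _ _).
assert (Inv0 : row_inv u J F top u0).
{ unfold u0, row_inv. simpl_store. splits; auto; try lia; try apply L.
  rewrite Etop. intros _. destruct (stack_of _ _); auto. }
apply (runs_weaken m _ _ ((N - ivar u0 v_t + ivar u0 v_top + 1)
    * (code_length row_body + test_length (ILe (!v_t +i $1) !v_n) + 2)) _
  (fun v => row_inv u J F top v /\ ~ holds v (ILe (!v_t +i $1) !v_n))).
- replace (test_length _) with 5 by reflexivity. unfold u0. simpl_store.
  destruct HE as [topN _]. rewrite Etop. nia.
- intros v [Inv Hn]. split; [now apply (row_inv_layout u v J F top) |].
  destruct Inv as [Er [En [Ej [Em [Ei [tN [topt [top0 [Hrow _]]]]]]]]].
  split; [| exact Ej]. simpl_store. rewrite En in Hn.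
  intros i k Hi ik kN. destruct (Nat.eq_dec i J) as [-> | Hne].
  + destruct yo_sorts as [_ [_ [_ surj]]]. destruct (surj k kN) as [t [Ht <-]].
    apply Hrow; [lia | exact ik].
  + apply (entry_ext (tab u)); [| apply K; lia].
    unfold tab. symmetry. apply Ei. left. nia.
- apply (runs_while m _ _ (code_length row_body) (row_inv u J F top)
    (fun v => N - ivar v v_t + ivar v v_top)); [| | exact Inv0].
  + intros v [_ [En [_ [_ [_ [tN _]]]]]]. simpl_store. lia.
  + intros v Inv Hb. apply runs_wp. apply row_body_wp; auto.
    destruct Inv as [_ [En _]]. simpl_store. lia.
Qed.

Lemma layout_set (u : store) (x a : nat) : x <> v_n -> layout u -> layout (set_ivar x a u).
Proof.
intros Hx L. apply (layout_frame u); auto.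
unfold set_ivar. cbn [ivar]. rewrite update_neq by auto. apply L.
Qed.

Definition table_body_cost : nat :=
  code_length column_max_body + code_length envelope_body + code_length row_body + 50.

Lemma table_body_runs (J : nat) (u : store) :
  layout u -> known J u -> ivar u v_j = J -> J < N ->
  runs m table_body u ((2 * N + 1) * table_body_cost) (fun v =>
    layout v /\ known (S J) v /\ ivar v v_j = J).
Proof.
intros L K EJ JN.
apply (runs_weaken m _ _ ((2 + (N + 1) * (code_length column_max_body + 20)) +
  ((2 + (2 + (2 * N + 1) * (code_length envelope_body + 7))) +
   (2 + (2 * N + 1) * (code_length row_body + 7)))) _
  (fun v => layout v /\ known (S J) v /\ ivar v v_j = J)); [unfold table_body_cost; nia | auto |].
apply runs_seq.
eapply runs_weaken; [reflexivity | | apply (column_max_runs J u L EJ JN)].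
intros v [Ei [Er [En [Ej HF]]]].
assert (Lv : layout v) by (apply (layout_frame u); auto; now rewrite Ei).
apply runs_seq.
eapply runs_weaken; [reflexivity | | apply (envelope_runs J (ivar v v_max) v Lv Ej eq_refl JN)].
intros w [Inv Et].
assert (Lw := envelope_inv_layout v w J _ Lv Inv).
destruct Inv as [Fr [Fn [Fj [Fm [Fi [FtN [Ftop [Env [Hin [pending [Hp Hc]]]]]]]]]]].
assert (Etab : forall i k, tab w i k = tab u i k).
{ intros i k. unfold tab. rewrite Fi by lia. now rewrite Ei. }
assert (Eel : forall i, eligible v J (ivar v v_max) i -> eligible w J (ivar v v_max) i).
{ intros i [iJ Hi]. split; [exact iJ |]. rewrite Etab, <- Hi. unfold tab. now rewrite Ei. }
assert (Eel' : forall i, eligible w J (ivar v v_max) i -> eligible v J (ivar v v_max) i).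
{ intros i [iJ Hi]. split; [exact iJ |]. rewrite Etab in Hi. unfold tab. rewrite Ei. exact Hi. }
apply (row_runs J (ivar v v_max) (ivar w v_top) w); auto.
- intros i k iJ ik kN. apply (entry_ext (tab u)); [symmetry; apply Etab | now apply K].
- destruct HF as [F1 [Fub Fex]]. split; [exact F1 |]. split.
  + intros i iJ. rewrite Etab. now apply Fub.
  + destruct Fex as [E | [i [iJ E]]]; [now left | right]. exists i. now rewrite Etab.
- split; [lia |]. split; [exact Env |]. split.
  + intros c Hc'. apply Eel. now apply Hin.
  + intros i Hi. apply Eel' in Hi. assert (iJ := proj1 Hi).
    destruct yo_sorts as [_ [_ [_ surj]]]. destruct (surj i ltac:(lia)) as [t [Ht <-]].
    destruct Hp as [-> | [Hlt _]]; [| lia].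
    apply (Hc t); [lia | exact Hi].
Qed.

Lemma table_runs (u : store) :
  layout u ->
  runs m table_loop u ((N + 1) * ((2 * N + 1) * table_body_cost + 20)) (fun v =>
    layout v /\ known N v).
Proof.
intros L.
apply (runs_for m v_j v_n N _ _ (fun J v => layout v /\ known J v /\ ivar v v_j = J)).
- lia.
- intros a v [Lv [_ E]]. split; [exact E | apply Lv].
- intros J v HJ [Lv [K E]].
  eapply runs_weaken; [reflexivity | | apply (table_body_runs J v Lv K E HJ)].
  intros w [Lw [Kw Ew]]. split; [exact Ew |].
  split; [apply layout_set; [discriminate | exact Lw] |]. split; [exact Kw | reflexivity].
- split; [apply layout_set; [discriminate | exact L] |].
  split; [intros i k Hi; lia | reflexivity].
- tauto.
Qed.

(** * The longest chain and its traceback *)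

Definition best_pair (u : store) (b p q : nat) : Prop :=
  1 <= b /\ (forall i k, i < k -> k < N -> tab u i k <= b) /\
  (b = 1 \/ (p < q /\ q < N /\ tab u p q = b)).

Lemma best_runs (u : store) :
  layout u ->
  runs m best_loop u (2 + (N + 1) * ((N + 1) * (code_length best_body + 20) + 20)) (fun v =>
    imem_of v = imem_of u /\ rmem_of v = rmem_of u /\ ivar v v_n = N /\
    best_pair u (ivar v v_best) (ivar v v_p) (ivar v v_q)).
Proof.
intros L. apply runs_seq. apply (runs_set_ivar m v_best $1); [simpl; lia |].
set (same := fun v : store => imem_of v = imem_of u /\ rmem_of v = rmem_of u /\ ivar v v_n = N).
set (partial := fun (P : nat -> nat -> Prop) (v : store) => 1 <= ivar v v_best /\
  (forall i k, P i k -> i < k -> k < N -> tab u i k <= ivar v v_best) /\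
  (ivar v v_best = 1 \/ (ivar v v_p < ivar v v_q /\ ivar v v_q < N /\
     tab u (ivar v v_p) (ivar v v_q) = ivar v v_best))).
apply (runs_for m v_i v_n N _ _ (fun a v =>
  same v /\ ivar v v_i = a /\ partial (fun i k => i < a) v)).
- lia.
- intros a v [[_ [_ En]] [Ea _]]. auto.
- intros a v Ha [[Ei [Er En]] [Ea HP]].
  apply (runs_for m v_k v_n N _ _ (fun b w =>
    same w /\ ivar w v_i = a /\ ivar w v_k = b /\
    partial (fun i k => i < a \/ (i = a /\ k < b)) w)).
  + lia.
  + intros b w [[_ [_ Fn]] [_ [Fb _]]]. auto.
  + intros b w Hb [[Fi [Fr Fn]] [Fa [Fb [B1 [Bub Bex]]]]].
    assert (Lw : layout w) by (apply (layout_frame u); auto; now rewrite Fi).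
    apply runs_wp. unfold best_body.
    destruct (value_correct w v_i v_k Lw) as [Sv Vv]; [lia | lia |].
    unfold tab in Vv. rewrite Fa, Fb, Fi in Vv. fold (tab u a b) in Vv.
    unfold partial, same. simpl_store. rewrite ?Fa, ?Fb, ?Vv.
    repeat match goal with
      | |- _ /\ _ => split | |- _ <= _ -> _ => intros ? | |- ~ _ -> _ => intros ?
      end; auto; try lia.
    * intros i k Hik ik kN.
      assert (Hcase : (i < a \/ (i = a /\ k < b)) \/ (i = a /\ k = b)) by lia.
      destruct Hcase as [Hc | [-> ->]]; [now apply Bub | lia].
    * intros i k Hik ik kN.
      assert (Hcase : (i < a \/ (i = a /\ k < b)) \/ (i = a /\ k = b)) by lia.
      destruct Hcase as [Hc | [-> ->]]; [| lia]. specialize (Bub i k Hc ik kN). lia.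
    * intros i k Hik ik kN. apply Bub; auto. lia.
  + unfold same, partial in *. simpl_store. splits; auto; try lia; try apply HP.
    intros i k Hik ik kN. apply HP; auto. lia.
  + intros w [[Fi [Fr Fn]] [Fa [Fb HP']]]. unfold same, partial in *. simpl_store.
    splits; auto; try apply HP'.
    intros i k Hik ik kN. apply HP'; auto. lia.
- unfold same, partial. simpl_store. splits; auto; try lia; apply L.
- intros v [[Ei [Er En]] [Ea HP]]. splits; auto. unfold best_pair, partial in *.
  splits; try apply HP. intros i k ik kN. apply HP; auto. lia.
Qed.

Lemma by_position_correct (u : store) (e : iexp) : layout u -> isafe m u e -> ieval u e < N ->
  isafe m u (by_position e) /\ ieval u (by_position e) = xo (ieval u e).
Proof.
intros L Se He. unfold by_position. simpl_store.
rewrite (layout_n u L), (layout_xo u L) by exact He. splits; auto; lia.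
Qed.

Definition precedes (u : store) (p q b i : nat) : Prop :=
  i < p /\ tab u i p = b - 1 /\ far (pt i) (pt q).

(** Until a first hit [v_s] holds an arbitrary value, so the invariant only says that [v_s] is a
    predecessor if one has been passed. Later hits overwrite earlier ones. *)
Lemma search_runs (p q b : nat) (u : store) :
  layout u -> ivar u v_p = p -> ivar u v_q = q -> ivar u v_best = b ->
  p < N -> q < N -> b <= N -> (exists i, precedes u p q b i) ->
  runs m (For v_i v_n search_body) u ((N + 1) * (code_length search_body + 20)) (fun v =>
    imem_of v = imem_of u /\ rmem_of v = rmem_of u /\ ivar v v_n = N /\
    ivar v v_p = p /\ ivar v v_q = q /\ ivar v v_best = b /\ ivar v v_count = ivar u v_count /\
    precedes u p q b (ivar v v_s)).
Proof.
intros L Ep Eq Eb pN qN bN [i0 Hi0].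
apply (runs_for m v_i v_n N _ _ (fun a v =>
  imem_of v = imem_of u /\ rmem_of v = rmem_of u /\ ivar v v_n = N /\
  ivar v v_p = p /\ ivar v v_q = q /\ ivar v v_best = b /\ ivar v v_count = ivar u v_count /\
  ivar v v_i = a /\ forall i, i < a -> precedes u p q b i -> precedes u p q b (ivar v v_s))).
- lia.
- tauto.
- intros a v Ha [Ei [Er [En [Fp [Fq [Fb [Fc [Fa Hs]]]]]]]].
  assert (Lv : layout v) by (apply (layout_frame u); auto; now rewrite Ei).
  apply runs_wp. unfold search_body.
  destruct (value_correct v v_i v_p Lv) as [Sv Vv]; [lia | lia |].
  unfold tab in Vv. rewrite Fa, Fp, Ei in Vv. fold (tab u a p) in Vv.
  assert (skip : ~ precedes u p q b a -> forall i, i < S a -> precedes u p q b i ->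
    precedes u p q b (ivar v v_s)).
  { intros Hn i Hi Hp. destruct (Nat.eq_dec i a) as [-> |]; [contradiction |].
    apply (Hs i); [lia | exact Hp]. }
  cbn [wp]. simpl_store. rewrite Fa, Fp, Vv, Fb.
  repeat match goal with
  | |- _ /\ _ => split | |- _ <= _ -> _ => intros ? | |- ~ _ -> _ => intros ?
  end; auto; try lia; try (apply skip; intros [? [? ?]]; lia).
  apply wp_if_near; [exact Lv | lia | lia | |]; rewrite Fa, Fq; intros Hf; simpl_store;
    splits; auto.
  + apply skip. intros [_ [_ K]]. contradiction.
  + intros _ _ _. rewrite Fa. split; [lia |]. split; [lia | exact Hf].
- simpl_store. splits; auto; [apply L | intros i Hi; lia].
- intros v [Ei [Er [En [Fp [Fq [Fb [Fc [Fa Hs]]]]]]]]. splits; auto.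
  apply (Hs i0); [| exact Hi0]. destruct Hi0. lia.
Qed.

(** The list [l] holds the points already behind the current pair. Its last clause quantifies over
    all continuations [l'], as the rest of the chain is still to be chosen; it reduces each step to
    extending by the current pair alone. *)
Definition trace_inv (u : store) (b : nat) (v : store) : Prop :=
  rmem_of v = rmem_of u /\ ivar v v_n = N /\
  (forall a, N <= a -> imem_of v a = imem_of u a) /\
  longest N pt (ivar v v_p) (ivar v v_q) (ivar v v_best) /\
  exists l, length l + ivar v v_best = b /\ ivar v v_count = length l + 2 /\
    (forall t, t < length l + 2 ->
       imem_of v t = xo (nth t (l ++ [ivar v v_q; ivar v v_p]) 0)) /\
    (forall l', chain N pt (ivar v v_q :: ivar v v_p :: l') ->
       chain N pt (l ++ ivar v v_q :: ivar v v_p :: l')).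

Lemma trace_inv_layout (u v : store) (b : nat) : layout u -> trace_inv u b v -> layout v.
Proof.
intros L [Er [En [Ei _]]]. apply (layout_frame u); auto. intros a Ha. apply Ei. lia.
Qed.

Lemma longest_lt (j k v : nat) : longest N pt j k v ->
  2 <= v /\ v <= N /\ j < k /\ k < N /\ far (pt j) (pt k).
Proof.
intros H. pose proof (longest_le j k v H) as [B _]. destruct H as [[l [C <-]] _].
destruct (chain_two_far N pt j k l C) as [jk [kN F]]. splits; auto; lia.
Qed.

Definition trace_step_cost : nat := code_length search_body + code_length trace_step + 50.

Lemma trace_step_runs (u v : store) (b : nat) :
  layout u -> known N u -> trace_inv u b v -> 3 <= ivar v v_best -> b <= N ->
  runs m (For v_i v_n search_body ;; trace_step) v ((N + 1) * trace_step_cost) (fun w =>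
    trace_inv u b w /\ ivar w v_best < ivar v v_best).
Proof.
intros L K Inv B3 bN.
assert (Lv := trace_inv_layout u v b L Inv).
destruct Inv as [Er [En [Ei [Hl [l [Hb [Hc [Hout Hch]]]]]]]].
set (p := ivar v v_p) in *. set (q := ivar v v_q) in *.
destruct (longest_lt _ _ _ Hl) as [_ [_ [pq [qN _]]]].
assert (Kv : forall i, i < p -> entry N pt (tab v) i p).
{ intros i Hi. apply (entry_ext (tab u)); [| apply K; lia].
  unfold tab. symmetry. apply Ei. nia. }
(* As the remaining length is at least 3, there is a third point to find. *)
assert (ex := predecessor_exists N h pt pt_sorted pt_strip (tab v) p q _ Kv Hl ltac:(lia)).
apply (runs_weaken m _ _ ((N + 1) * (code_length search_body + 20) + code_length trace_step) _
  (fun w => trace_inv u b w /\ ivar w v_best < ivar v v_best)); [unfold trace_step_cost; nia | auto |].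
apply runs_seq.
eapply runs_weaken; [reflexivity | |
  apply (search_runs p q (ivar v v_best) v); auto; try lia].
intros w [Fi [Fr [Fn [Fp [Fq [Fb [Fc [sp [Es Fs]]]]]]]]].
set (s := ivar w v_s) in *.
assert (Lw : layout w) by (apply (layout_frame v); auto; now rewrite Fi).
apply runs_wp. unfold trace_step. cbn [wp].
destruct (by_position_correct w !v_s Lw) as [Sp Vp]; [exact I | simpl; fold s; lia |].
change (ieval w !v_s) with s in Vp.
assert (Hs : longest N pt s p (ivar v v_best - 1)).
{ destruct (Kv s sp) as [Hf Hnf]. rewrite Es in *.
  destruct (Classical_Prop.classic (far (pt s) (pt p))) as [F | F]; [now apply Hf |].
  specialize (Hnf F). lia. }
unfold trace_inv. simpl_store. rewrite Vp, ?Fc, ?Hc, ?Fp, ?Fb, ?Fn, ?Fr, ?Fi.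
splits; auto; try lia.
- intros a Ha. rewrite update_neq by lia. now apply Ei.
- exists (l ++ [q]). rewrite length_app. simpl length. splits; try lia.
  + intros t Ht. destruct (Nat.eq_dec t (length l + 2)) as [-> | Hne].
    * rewrite update_eq. rewrite app_nth2; rewrite length_app; simpl; [| lia].
      replace (length l + 2 - (length l + 1)) with 1 by lia. reflexivity.
    * rewrite update_neq by lia. rewrite Hout by lia. f_equal.
      rewrite <- app_assoc. simpl.
      destruct (Nat.lt_ge_cases t (length l)) as [Hlt | Hge].
      -- now rewrite !app_nth1.
      -- rewrite !app_nth2 by lia. destruct (t - length l) as [| [| k]] eqn:E;
           [reflexivity | reflexivity | lia].
  + intros l' C. rewrite <- app_assoc. simpl. apply Hch.
    destruct (longest_lt _ _ _ Hl) as [_ [_ [_ [_ Fpq]]]].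
    apply (chain_cons N h pt pt_sorted pt_strip s p q l'); auto.
Qed.

Definition answers (v : store) : Prop :=
  exists l, chain N pt l /\ ivar v 0 = length l /\
    (forall t, t < length l -> imem_of v t = xo (nth t l 0)) /\
    forall l', chain N pt l' -> length l' <= length l.

Definition answer_cost : nat :=
  test_length (ILe !v_n $0) + test_length (ILe !v_best $1) +
  code_length single + code_length trace_start + code_length (SetI v_n !v_count) +
  trace_step_cost + 50.

Lemma chain_bound (u : store) (b p q : nat) (l : list nat) :
  known N u -> best_pair u b p q -> chain N pt l -> length l <= b.
Proof.
intros K [B1 [Bub _]] C. destruct l as [| k [| j l]]; simpl; [lia | lia |].
destruct (chain_two_far N pt j k l C) as [jk [kN F]].
destruct (K j k ltac:(lia) jk kN) as [Hf _]. destruct (Hf F) as [_ Hub].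
specialize (Hub l C). specialize (Bub j k jk kN). lia.
Qed.

Lemma trace_runs (u : store) :
  layout u -> known N u -> best_pair u (ivar u v_best) (ivar u v_p) (ivar u v_q) ->
  1 < ivar u v_best ->
  runs m trace u (code_length trace_start +
    ((N + 1) * ((N + 1) * trace_step_cost + 7) + code_length (SetI v_n !v_count))) answers.
Proof.
intros L K HB B1.
assert (Hbound := fun l => chain_bound u _ _ _ l K HB).
destruct HB as [_ [_ [B | [pq [qN Et]]]]]; [lia |].
set (b := ivar u v_best) in *.
assert (Hl : longest N pt (ivar u v_p) (ivar u v_q) b).
{ destruct (K (ivar u v_p) (ivar u v_q) ltac:(lia) pq qN) as [Hf Hnf]. rewrite Et in *.
  destruct (Classical_Prop.classic (far (pt (ivar u v_p)) (pt (ivar u v_q)))) as [F | F];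
    [now apply Hf | specialize (Hnf F); lia]. }
destruct (longest_lt _ _ _ Hl) as [_ [bN _]].
apply runs_seq.
apply (runs_weaken m _ _ (code_length trace_start) _ (trace_inv u b)); [reflexivity | |].
- intros v Inv. apply runs_seq.
  apply (runs_weaken m _ _ ((ivar v v_best + 1) *
    ((N + 1) * trace_step_cost + test_length (ILe $3 !v_best) + 2)) _
    (fun w => trace_inv u b w /\ ~ holds w (ILe $3 !v_best))).
  + replace (test_length _) with 3 by reflexivity.
    assert (ivar v v_best <= N) by (apply (longest_lt _ _ _ (proj1 (proj2 (proj2 (proj2 Inv)))))).
    apply Nat.mul_le_mono; lia.
  + intros w [Inv' Hn].
    destruct Inv' as [Fr [Fn [Fi [Hlw [l [Hb [Hc [Hout Hch]]]]]]]].
    apply (runs_set_ivar m v_n !v_count); [exact I |].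
    destruct (longest_lt _ _ _ Hlw) as [B2 [_ [pqw [qwN Fpq]]]].
    assert (E2 : ivar w v_best = 2) by (simpl in Hn; lia).
    exists (l ++ [ivar w v_q; ivar w v_p]). rewrite length_app. simpl length.
    splits.
    * apply Hch. now apply chain_two.
    * simpl_store. exact Hc.
    * simpl_store. exact Hout.
    * intros l' C. specialize (Hbound l' C). lia.
  + apply (runs_while m _ _ _ (trace_inv u b) (fun v => ivar v v_best)); [| | exact Inv].
    * intros w _. simpl. lia.
    * intros w Inv' Hb. simpl in Hb. apply trace_step_runs; auto.
- apply runs_wp. unfold trace_start. cbn [wp].
  destruct (by_position_correct u !v_q L) as [Sq Vq]; [exact I | exact qN |].
  change (ieval u !v_q) with (ivar u v_q) in Vq. rewrite Vq.
  set (v := put_imem _ _ u).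
  assert (Lv : layout v).
  { apply (layout_frame u); auto; [apply L |]. intros a Ha. unfold v. simpl_store.
    apply update_neq. lia. }
  destruct (by_position_correct v !v_p Lv) as [Sp Vp]; [exact I | simpl; lia |].
  change (ieval v !v_p) with (ivar u v_p) in Vp. rewrite Vp.
  unfold trace_inv, v. simpl_store. fold b. splits; auto; try lia.
  + apply L.
  + intros a Ha. rewrite !update_neq by lia. reflexivity.
  + exists []. simpl length. splits; auto; try lia.
    intros [| [| t]] Ht; [reflexivity | reflexivity | lia].
Qed.

Lemma answer_runs (u : store) :
  layout u -> known N u -> best_pair u (ivar u v_best) (ivar u v_p) (ivar u v_q) ->
  runs m answer u ((N + 1) * ((N + 1) * answer_cost)) answers.
Proof.
intros L K HB.
assert (Hbound := fun l => chain_bound u _ _ _ l K HB).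
apply (runs_weaken m _ _ (test_length (ILe !v_n $0) + (
  (test_length (ILe !v_best $1) + ((code_length trace_start +
    ((N + 1) * ((N + 1) * trace_step_cost + 7) + code_length (SetI v_n !v_count))) +
     (1 + code_length single))) + (1 + 0))) _ answers); [unfold answer_cost; nia | auto |].
apply runs_if.
- simpl. lia.
- intros H0. simpl in H0. rewrite (layout_n u L) in H0. apply runs_skip.
  assert (En : ivar u 0 = N) by apply L.
  exists []. simpl. splits; try lia.
  intros [| k l] C; simpl; [lia |]. destruct C. lia.
- intros H0. simpl in H0. rewrite (layout_n u L) in H0. apply runs_if.
  + simpl. lia.
  + intros H1. simpl in H1. apply runs_wp. unfold single. cbn [wp].
    destruct (by_position_correct u $0 L) as [Sp Vp]; [simpl; lia | simpl; lia |].
    rewrite Vp. simpl_store. splits; auto; try lia.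
    exists [0]. splits.
    * split; [lia |]. split; [intros j [] | exact I].
    * reflexivity.
    * intros [| t] Ht; [reflexivity | simpl in Ht; lia].
    * intros l C. specialize (Hbound l C). simpl. lia.
  + intros H1. simpl in H1. apply trace_runs; auto. lia.
Qed.

End Layout.

(** * The whole program *)

Definition copy_body : cmd :=
  SetI v_b (by_position !v_a) ;;
  PutR ($2 *i !v_n +i !v_a) (RGet ($2 *i !v_b)) ;;
  PutR ($3 *i !v_n +i !v_a) (RGet ($2 *i !v_b +i $1)).

Definition sort_by_abscissa : cmd :=
  SetI v_off $0 ;; SetI v_stride $2 ;; SetI v_base ($3 *i !v_n).
Definition sort_by_ordinate : cmd :=
  SetI v_off ($3 *i !v_n) ;; SetI v_stride $1 ;; SetI v_base ($2 *i !v_n).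

Definition misudg : cmd :=
  sort_by_abscissa ;; rank_sort ;;
  For v_a v_n copy_body ;;
  sort_by_ordinate ;; rank_sort ;;
  table_loop ;; best_loop ;; answer.

Definition disk (D : list point) (o : nat -> nat) (p : nat) : point := nth (o p) D (0, 0)%R.

Lemma nth_coordinates (D : list point) (b : nat) :
  nth (2 * b) (coordinates D) 0%R = fst (nth b D (0, 0)%R) /\
  nth (2 * b + 1) (coordinates D) 0%R = snd (nth b D (0, 0)%R).
Proof.
revert b. induction D as [| c D IH]; intros b.
- simpl. destruct (2 * b), (2 * b + 1), b; auto.
- destruct b as [| b]; [split; reflexivity |].
  replace (2 * S b) with (S (S (2 * b))) by lia. apply IH.
Qed.

Definition misudg_cost : nat :=
  2 * (400 + code_length copy_body + 2 * table_body_cost + code_length best_body +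
       answer_cost).

Section Instance.

Context (h : R) (D : list point) (m : nat).
Let N := length D.
Hypothesis strip : forall c, In c D -> (h - 1 / 2 <= snd c <= h + 1 / 2)%R.
Hypothesis room : 4 * N + N * N + 10 <= m.

Lemma copy_runs (o : nat -> nat) (u : store) :
  (forall p, p < N -> o p < N) -> ivar u v_n = N ->
  (forall p, p < N -> imem_of u (3 * N + p) = o p) ->
  (forall k, rmem_of u k = nth k (coordinates D) 0%R) ->
  runs m (For v_a v_n copy_body) u ((N + 1) * (code_length copy_body + 20)) (fun v =>
    imem_of v = imem_of u /\ ivar v v_n = N /\
    forall p, p < N -> rmem_of v (2 * N + p) = fst (disk D o p) /\
                       rmem_of v (3 * N + p) = snd (disk D o p)).
Proof.
intros Ho En Eo Er.
apply (runs_for m v_a v_n N _ _ (fun a v => imem_of v = imem_of u /\ ivar v v_n = N /\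
  ivar v v_a = a /\ (forall k, k < 2 * N -> rmem_of v k = nth k (coordinates D) 0%R) /\
  forall p, p < a -> rmem_of v (2 * N + p) = fst (disk D o p) /\
                     rmem_of v (3 * N + p) = snd (disk D o p))).
- lia.
- tauto.
- intros a v Ha [Fi [Fn [Fa [Fk Fp]]]]. apply runs_wp. unfold copy_body, by_position.
  specialize (Ho a Ha). simpl_store. rewrite ?Fi, ?Fn, ?Fa, (Eo a Ha).
  splits; auto; try lia.
  + intros k Hk. rewrite !update_neq by lia. now apply Fk.
  + intros p Hp. rewrite (update_neq _ _ (2 * N + p)) by lia.
    rewrite !Fk by lia.
    destruct (nth_coordinates D (o a)) as [Cx Cy]. rewrite Cx.
    destruct (Nat.eq_dec p a) as [-> | Hne].
    * rewrite !update_eq. split; [reflexivity |]. rewrite update_neq by lia.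
      rewrite Fk by lia. exact Cy.
    * rewrite !update_neq by lia. apply Fp. lia.
- simpl_store. splits; auto; lia.
- tauto.
Qed.

Lemma misudg_runs (u : store) :
  ivar u v_n = N -> (forall k, rmem_of u k = nth k (coordinates D) 0%R) ->
  runs m misudg u (misudg_cost * (N ^ 2 + 1)) (fun v =>
    exists o, sorts (fun b => fst (nth b D (0, 0)%R)) N o /\ answers N (disk D o) o v).
Proof.
intros En Er.
apply (runs_weaken m _ _ (
  code_length sort_by_abscissa + ((N + 1) * ((N + 1) * 100 + 50) +
  ((N + 1) * (code_length copy_body + 20) +
  (code_length sort_by_ordinate + ((N + 1) * ((N + 1) * 100 + 50) +
  ((N + 1) * ((2 * N + 1) * table_body_cost + 20) +
  ((2 + (N + 1) * ((N + 1) * (code_length best_body + 20) + 20)) +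
  ((N + 1) * ((N + 1) * answer_cost))))))))) _
  (fun v => exists o, sorts (fun b => fst (nth b D (0, 0)%R)) N o /\ answers N (disk D o) o v));
  [| auto |].
{ replace (code_length sort_by_abscissa) with 8 by reflexivity.
  replace (code_length sort_by_ordinate) with 10 by reflexivity.
  unfold misudg_cost. rewrite Nat.pow_2_r.
  generalize table_body_cost (code_length best_body) answer_cost (code_length copy_body).
  intros a b c d. set (M := (N + 1) * (N + 1)).
  assert (M1 : 1 <= M) by (unfold M; nia).
  assert (ML : forall x, (N + 1) * x <= M * x) by (intros; unfold M; nia).
  assert (MM : forall x y, (N + 1) * ((N + 1) * x + y) <= M * x + M * y).
  { intros x y. specialize (ML y). rewrite Nat.mul_add_distr_l, Nat.mul_assoc. fold M. lia. }
  pose proof (ML (d + 20)). pose proof (MM 100 50). pose proof (MM (b + 20) 20).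
  pose proof (MM (2 * a) 20).
  assert ((N + 1) * ((2 * N + 1) * a + 20) <= (N + 1) * ((N + 1) * (2 * a) + 20))
    by (apply Nat.mul_le_mono_l; lia).
  rewrite (Nat.mul_assoc (N + 1) (N + 1) c). fold M.
  transitivity (M * (400 + d + 2 * a + b + c)); [lia |].
  (* The factor 2 in [misudg_cost]: every phase is bounded by a multiple of [(N + 1) ^ 2]. *)
  assert (M2 : M <= 2 * (N * N + 1)) by (unfold M; nia).
  set (X := 400 + d + 2 * a + b + c).
  rewrite (Nat.mul_comm 2 X), <- Nat.mul_assoc, (Nat.mul_comm M).
  now apply Nat.mul_le_mono_l. }
apply runs_seq. apply runs_wp. unfold sort_by_abscissa. cbn [wp]. simpl_store. rewrite En.
splits; try lia; auto.
apply runs_seq.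
eapply runs_weaken; [reflexivity | | apply (rank_sort_runs m N 0 2 (3 * N)); auto; lia].
intros v [Fr [Fn [Fi Fs]]]. simpl_store.
set (o := fun r => imem_of v (3 * N + r)) in *.
assert (Fo : sorts (fun b => fst (nth b D (0, 0)%R)) N o).
{ destruct Fs as [S1 [S2 [S3 S4]]]. split; [exact S1 |]. split; [exact S2 |]. split; [| exact S4].
  intros r r' Hr Hr'. specialize (S3 r r' Hr Hr'). cbv beta in S3. rewrite !Er in S3.
  simpl Nat.add in S3.
  destruct (nth_coordinates D (o r)) as [E1 _]. destruct (nth_coordinates D (o r')) as [E2 _].
  rewrite <- E1, <- E2. exact S3. }
clear Fs. assert (oN := proj1 Fo).
assert (dN : forall p, p < N -> In (disk D o p) D) by (intros p Hp; apply nth_In, oN, Hp).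
apply runs_seq.
eapply runs_weaken; [reflexivity | | apply (copy_runs o v oN Fn); auto].
2: { intros k. now rewrite Fr. }
intros w [Gi [Gn Gp]].
apply runs_seq. apply runs_wp. unfold sort_by_ordinate. cbn [wp]. simpl_store. rewrite Gn.
splits; try lia; auto.
apply runs_seq.
eapply runs_weaken; [reflexivity | | apply (rank_sort_runs m N (3 * N) 1 (2 * N)); auto; lia].
intros x [Hr [Hn [Hi Hs]]]. simpl_store.
set (yo := fun r => imem_of x (2 * N + r)) in *.
assert (Hy : sorts (fun p => snd (disk D o p)) N yo).
{ destruct Hs as [S1 [S2 [S3 S4]]]. split; [exact S1 |]. split; [exact S2 |]. split; [| exact S4].
  intros r r' Hrr Hr'. specialize (S3 r r' Hrr Hr'). cbv beta in S3.
  rewrite !Nat.mul_1_l in S3.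
  rewrite (proj2 (Gp _ (S1 r ltac:(lia)))), (proj2 (Gp _ (S1 r' Hr'))) in S3. exact S3. }
assert (Lx : layout N (disk D o) yo o x).
{ split; auto.
  - intros p Hp. rewrite Hr. now apply Gp.
  - intros p Hp. rewrite Hr. now apply Gp.
  - intros t Ht. rewrite Hi by lia. now rewrite Gi. }
assert (sorted : forall i j, i <= j -> j < N -> (fst (disk D o i) <= fst (disk D o j))%R)
  by apply Fo.
assert (inside : forall i, i < N -> (h - 1 / 2 <= snd (disk D o i) <= h + 1 / 2)%R)
  by (intros i Hi'; apply strip, dN, Hi').
apply runs_seq.
eapply runs_weaken; [reflexivity | |
  apply (table_runs m N h (disk D o) yo o room sorted inside Hy x Lx)].
intros y [Ly Ky].
apply runs_seq.
eapply runs_weaken; [reflexivity | | apply (best_runs m N (disk D o) yo o room y Ly)].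
intros z [Zi [Zr [Zn Zb]]].
eapply runs_weaken; [reflexivity | |
  apply (answer_runs m N h (disk D o) yo o room sorted inside z)].
- intros a Ha. exists o. auto.
- apply (layout_frame m N (disk D o) yo o room y); auto. now rewrite Zi.
- intros i k iN ik kN. apply (entry_ext N (disk D o) (tab N y)); [| now apply Ky].
  unfold tab. now rewrite Zi.
- destruct Zb as [B1 [Bub Bex]]. unfold best_pair, tab in *. rewrite Zi. auto.
Qed.

End Instance.

(** * Independent sets of disks as chains *)

Lemma far_sym (a b : point) : far a b -> far b a.
Proof. unfold far. lra. Qed.

Lemma dist_le_iff (c p : point) (r : R) : (0 <= r)%R ->
  ((dist_euc (fst p) (snd p) (fst c) (snd c) <= r)%R <->
   ((fst p - fst c) ^ 2 + (snd p - snd c) ^ 2 <= r ^ 2)%R).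
Proof.
intros Hr. unfold dist_euc. rewrite !Rsqr_pow2.
assert (P : (0 <= (fst p - fst c) ^ 2 + (snd p - snd c) ^ 2)%R)
  by (apply Rplus_le_le_0_compat; apply pow2_ge_0).
rewrite sq_le_iff by (auto using sqrt_pos). rewrite pow2_sqrt by exact P. reflexivity.
Qed.

(** A common point bounds the distance of the centers by the triangle inequality; conversely the
    midpoint of the centers is a common point. *)
Lemma disks_meet_iff (a b : point) : disks_meet a b <-> ~ far a b.
Proof.
unfold far. split.
- intros [p [Ha Hb]]. unfold in_disk in *.
  assert (K : (dist_euc (fst a) (snd a) (fst b) (snd b) <= 1)%R).
  { eapply Rle_trans; [apply (triangle _ _ _ _ (fst p) (snd p)) |].
    rewrite (distance_symm (fst a)). lra. }
  apply dist_le_iff in K; lra.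
- intros H. exists ((fst a + fst b) / 2, (snd a + snd b) / 2)%R.
  split; apply dist_le_iff; simpl fst; simpl snd; lra.
Qed.

Lemma disk_meets_line_strip (h : R) (c : point) :
  disk_meets_line h c -> (h - 1 / 2 <= snd c <= h + 1 / 2)%R.
Proof.
intros [x Hx]. unfold in_disk in Hx. apply dist_le_iff in Hx; [| lra]. simpl in Hx.
pose proof (pow2_ge_0 (x - fst c)). nra.
Qed.

Lemma point_eq_dec (a b : point) : {a = b} + {a <> b}.
Proof. decide equality; apply Req_dec_T. Qed.

(** Turns an arbitrary set of pairwise far positions into a chain, by listing it in decreasing
    order; this is how the competitors of the answer enter. *)
Lemma chain_filter (N : nat) (pt : nat -> point) (f : nat -> bool) (M : nat) :
  M <= N ->
  (forall i j, i < j -> j < N -> f i = true -> f j = true -> far (pt i) (pt j)) ->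
  chain N pt (filter f (rev (seq 0 M))).
Proof.
intros HM Hf. induction M as [| M IH]; [exact I |].
rewrite seq_S, rev_app_distr. simpl.
destruct (f M) eqn:E; [| apply IH; lia].
split; [lia |]. split; [| apply IH; lia].
intros j Hj. apply filter_In in Hj as [Hj Fj]. apply in_rev, in_seq in Hj.
split; [lia |]. apply Hf; auto; lia.
Qed.

Lemma chain_independent (N : nat) (pt : nat -> point) (l : list nat) :
  chain N pt l ->
  NoDup l /\ (forall p, In p l -> p < N) /\
  (forall p q, In p l -> In q l -> p <> q -> far (pt p) (pt q)).
Proof.
induction l as [| k l IH]; [intros _; split; [constructor | split; [intros p [] | intros p q []]] |].
intros [kN [Hk C]]. destruct (IH C) as [ND [HN HF]]. split; [| split].
- constructor; [| exact ND]. intros K. destruct (Hk k K). lia.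
- intros p [<- | Hp]; auto.
- intros p q [<- | Hp] [<- | Hq] Hne; auto; [contradiction | apply far_sym |]; now apply Hk.
Qed.

Lemma map_nth_seq (l : list nat) : map (fun t => nth t l 0) (seq 0 (length l)) = l.
Proof.
induction l as [| a l IH]; [reflexivity |]. simpl. f_equal.
rewrite <- seq_shift, map_map. exact IH.
Qed.

Lemma answers_maximum (D : list point) (o : nat -> nat) (v : store) :
  NoDup D -> sorts (fun b => fst (nth b D (0, 0)%R)) (length D) o ->
  answers (length D) (disk D o) o v ->
  exists E, map (fun j => nth_error D (imem_of v j)) (seq 0 (ivar v 0)) = map Some E /\
    maximum_independent_subset D E.
Proof.
intros ND [oN [oinj [_ osurj]]] [l [C [El [Hl Hmax]]]].
assert (inj : forall p q, p < length D -> q < length D -> p <> q -> disk D o p <> disk D o q).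
{ intros p q Hp Hq Hne E.
  (* Equal centers at distinct positions would be a repetition in the input. *)
  apply (NoDup_nth D (0, 0)%R) in E; auto.
  destruct (Nat.lt_total p q) as [K | [K | K]]; [| contradiction |].
  - now apply (oinj p q).
  - now apply (oinj q p). }
destruct (chain_independent _ _ _ C) as [NDl [lN lF]].
exists (map (disk D o) l). split.
- rewrite El, map_map. rewrite <- (map_nth_seq l) at 2. rewrite map_map.
  apply map_ext_in. intros t Ht. apply in_seq in Ht. rewrite Hl by lia.
  apply nth_error_nth'. apply oN, lN, nth_In. lia.
- split.
  + split; [| split].
    * apply NoDup_map_NoDup_ForallPairs; [| exact NDl].
      intros p q Hp Hq E. destruct (Nat.eq_dec p q) as [| Hne]; [assumption |].
      exfalso. exact (inj p q (lN p Hp) (lN q Hq) Hne E).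
    * intros c Hc. apply in_map_iff in Hc as [p [<- Hp]]. apply nth_In, oN, lN, Hp.
    * intros c1 c2 H1 H2 Hne M. apply in_map_iff in H1 as [p [<- Hp]].
      apply in_map_iff in H2 as [q [<- Hq]]. apply disks_meet_iff in M. apply M.
      apply lF; auto.
  + intros F [NDF [FD FI]].
    set (f := fun p => if in_dec point_eq_dec (disk D o p) F then true else false).
    assert (Hf : forall p, f p = true <-> In (disk D o p) F).
    { intros p. unfold f. destruct (in_dec _ _ _); split; auto; discriminate. }
    assert (CF : chain (length D) (disk D o) (filter f (rev (seq 0 (length D))))).
    { apply chain_filter; [reflexivity |]. intros i j ij jN Fi Fj.
      apply Hf in Fi, Fj.
      destruct (Classical_Prop.classic (far (disk D o i) (disk D o j))) as [K | K]; [exact K |].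
      apply disks_meet_iff in K. exfalso. revert K. apply FI; auto. apply inj; lia. }
    rewrite length_map. etransitivity; [| apply (Hmax _ CF)].
    (* [F] has no repetition and is contained in the image of the chain built from it, so it is no
       longer than that chain. *)
    rewrite <- (length_map (disk D o)). apply NoDup_incl_length; [exact NDF |].
    intros c Hc. destruct (In_nth D c (0, 0)%R (FD c Hc)) as [b [Hb <-]].
    destruct (osurj b Hb) as [p [Hp <-]].
    apply in_map_iff. exists p. split; [reflexivity |].
    apply filter_In. split; [apply in_rev; rewrite rev_involutive; apply in_seq; lia |].
    now apply Hf.
Qed.

(** The summand 1 only matters for the empty instance. *)
Theorem theorem4 :
  exists (P : program) (cT cS : nat),
    solves_MISUDG_L P (fun n => cT * (n ^ 2 + 1)) (fun n => cS * (n ^ 2 + 1)).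
Proof.
exists (compile 0 misudg ++ [Halt]), misudg_cost, 10.
(* The space constant 10 is large enough because [4 * N <= 9 * N ^ 2] for every natural number
   [N]. *)
intros h D ND Hline. set (m := 10 * (length D ^ 2 + 1)). set (s := input_state h D).
assert (room : 4 * length D + length D * length D + 10 <= m)
  by (unfold m; rewrite Nat.pow_2_r; nia).
(* Even registers are the variables; the number of disks, in register 0, is thus the variable
   [v_n]. *)
set (u := Store (fun x => ireg s (2 * x)) (imem s) (rmem s)).
assert (A : agree m s u).
{ split; try reflexivity.
  - intros [| x]; unfold s, input_state, update; simpl; lia.
  - intros x. unfold s, input_state. simpl. lia. }
assert (C : code_at (compile 0 misudg ++ [Halt]) (pc s) (compile (pc s) misudg)).
{ change (pc s) with 0. intros k i Hk. rewrite Nat.add_0_l. rewrite nth_error_app1; [exact Hk |].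
  apply nth_error_Some. congruence. }
destruct (misudg_runs h D m (fun c Hc => disk_meets_line_strip h c (Hline c Hc)) room u
  eq_refl (fun k => eq_refl) _ s C A) as [s' [v [[t [Ht R]] [Epc [A' [o [Ho Hv]]]]]]].
destruct (answers_maximum D o v ND Ho Hv) as [E [HE HM]].
exists s', E. split; [| split; [| exact HM]].
- exists t. split; [exact Ht |]. split; [exact R |].
  rewrite Epc. change (pc s) with 0. rewrite Nat.add_0_l.
  rewrite nth_error_app2; rewrite length_compile; [| reflexivity].
  now rewrite Nat.sub_diag.
- unfold outputs. rewrite <- HE. change 0 with (2 * 0) at 2.
  rewrite (agree_ivar _ _ _ A'). apply map_ext. intros j.
  now rewrite (agree_imem _ _ _ A').
Qed.
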